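(* Let $\Gamma$ be a crystal such that each Floquet eigenvalue function $E_1,\dots,E_\nu$ of $\mathcal{H}_\Gamma$ is Lipschitz continuous over $\mathbb{T}^d$. Suppose that for each $j$ we have $\nabla E_j\neq 0$ almost everywhere. Then the spectrum of $\mathcal{H}_\Gamma$ is purely absolutely continuous. As a partial converse, if $\Gamma$ is a crystal such that each eigenvalue function is Lipschitz continuous over $\mathbb{T}^d$ and if $\nabla E_j=0$ for some $j$ on a nonempty open subset $S\subset\mathbb{T}^d$, then $\mathcal{H}_\Gamma$ has an infinitely degenerate eigenvalue (an eigenvalue of infinite multiplicity).
   Context: A crystal ($\mathbb{Z}^d$-periodic graph with finite fundamental cell) $\Gamma=(w,Q)$ consists of: a countable vertex set $V\subset\mathbb{R}^d$ and linearly independent $\mathfrak{a}_1,\dots,\mathfrak{a}_d\in\mathbb{R}^d$ such that, with $k_{\mathfrak a}=\sum_i k_i\mathfrak{a}_i$ for $k\in\mathbb{Z}^d$, every $v\in V$ is uniquely $v=v_0+k_{\mathfrak a}$ with $v_0\in V_0=\{v_1,\dots,v_\nu\}$ (finite), $k\in\mathbb{Z}^d$, and all such points are in $V$; a function $w:V\times V\to[0,\infty)$ with $w(v,v')=w(v',v)$, $w(v,v)=0$, $\sum_{v'}w(v,v')<\infty$, $w(v+k_{\mathfrak a},v'+k_{\mathfrak a})=w(v,v')$; a potential $Q:V\to\mathbb{R}$ with $Q(v+k_{\mathfrak a})=Q(v)$; the graph with edges $\{w(v,v')>0\}$ being connected. Put $w_{ij}(k)=w(v_i,v_j+k_{\mathfrak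 a})$, $Q_i=Q(v_i)$, $\mathbb{T}^d=\mathbb{R}^d/\mathbb{Z}^d$. On $\ell^2(V)$, $(\mathcal{H}_\Gamma\psi)(v)=\sum_{v'}w(v,v')\psi(v')+Q(v)\psi(v)$. The Floquet matrix is $H(\theta)=(h_{ij}(\theta))_{i,j=1}^\nu$, $h_{ij}(\theta)=\sum_{k\in\mathbb{Z}^d}w_{ij}(k)e^{2\pi i\theta\cdot k}+\delta_{ij}Q_i$; the eigenvalue functions $E_1(\theta)\le\dots\le E_\nu(\theta)$ are its eigenvalues counted with multiplicity. By Rademacher's theorem Lipschitz functions are differentiable almost everywhere. *)

(* Defs.v *)
(* MathComp-Analysis, over an arbitrary [R : realType]; scalars are [R[i]]. *)
From HB Require Import structures.
From mathcomp Require Import all_boot all_order all_algebra.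
From mathcomp Require Import all_classical all_reals all_analysis.
From mathcomp Require Import complex.
Set Implicit Arguments.
Unset Strict Implicit.
Unset Printing Implicit Defensive.
Import Order.TTheory GRing.Theory Num.Theory.
Import numFieldNormedType.Exports.
Local Open Scope classical_set_scope.
Local Open Scope ring_scope.
Local Open Scope complex_scope.

Section Hilbert.
Variables (R : realType) (T : choiceType).
Implicit Types (phi psi : T -> R[i]) (A : (T -> R[i]) -> T -> R[i]).

(* Unconditional sums over [T]: the usual value when the family is absolutely
   summable, which is the case wherever they are used below; junk otherwise. *)
Definition rsum (f : T -> R) : R :=
  fine (\esum_(t in [set: T]) (Num.max (f t) 0)%:E) -
  fine (\esum_(t in [set: T]) (Num.max (- f t) 0)%:E).

Definition csum (f : T -> R[i]) : R[i] :=
  rsum (fun t => complex.Re (f t)) +i* rsum (fun t => complex.Im (f t)).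

Definition l2normsq psi : \bar R :=
  \esum_(t in [set: T]) (complex.Re (psi t) ^+ 2 + complex.Im (psi t) ^+ 2)%:E.

(* The Hilbert space l^2(T) is the set of [psi] such that [l2 psi]; operators
   are total maps on [T -> R[i]] of which only the values on l^2(T) matter. *)
Definition l2 psi : Prop := (l2normsq psi < +oo)%E.

Definition dotl2 phi psi : R[i] := csum (fun t => (phi t)^* * psi t).

Definition orthogonal_projection A : Prop :=
  [/\ forall psi, l2 psi -> l2 (A psi),
      forall (c : R[i]) phi psi, l2 phi -> l2 psi ->
        A (fun t => c * phi t + psi t) = (fun t => c * A phi t + A psi t),
      forall psi, l2 psi -> A (A psi) = A psi
    & forall phi psi, l2 phi -> l2 psi ->
        dotl2 phi (A psi) = dotl2 (A phi) psi].

(* [mu] is the measure B |-> <psi, P(B) psi>; it is determined by this. *)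
Definition spectral_measure (P : set R -> (T -> R[i]) -> T -> R[i]) psi
    (mu : {measure set (measurableTypeR R) -> \bar R}) : Prop :=
  forall B : set (measurableTypeR R), measurable B ->
    mu B = (complex.Re (dotl2 psi (P B psi)))%:E.

(* [P] is the projection-valued measure of the bounded self-adjoint operator
   [A] given by the spectral theorem, i.e. [A] is the integral of [x] against
   [P]. By polarization the last clause is only needed on the diagonal, and
   the integral in it is that of a bounded function on a finite measure,
   since [P] has bounded support. *)
Record spectral_resolution A (P : set R -> (T -> R[i]) -> T -> R[i]) : Prop := {
  sr_proj : forall B : set (measurableTypeR R), measurable B ->
    orthogonal_projection (P B);
  sr_set0 : forall psi, l2 psi -> P set0 psi = (fun=> 0);
  sr_bounded : exists a : R, forall psi, l2 psi -> P `]- a, a[%classic psi = psi;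
  sr_setI : forall B C : set (measurableTypeR R),
    measurable B -> measurable C -> forall psi, l2 psi ->
    P (B `&` C) psi = P B (P C psi);
  sr_sigma_additive : forall F : nat -> set (measurableTypeR R),
    (forall n, measurable (F n)) -> trivIset [set: nat] F ->
    forall psi, l2 psi ->
    (fun n => l2normsq (fun t =>
       P (\bigcup_k F k) psi t - \sum_(k < n) P (F k) psi t)) @ \oo --> 0%E;
  sr_integral : forall psi, l2 psi ->
    exists2 mu : {measure set (measurableTypeR R) -> \bar R},
      spectral_measure P psi mu
      & dotl2 psi (A psi) = (\int[mu]_x (x : R))%:C
}.

Definition purely_absolutely_continuous A : Prop :=
  exists2 P, spectral_resolution A P
  & forall psi, l2 psi ->
    forall mu, spectral_measure P psi mu -> mu `<< @lebesgue_measure R.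

Definition eigenvalue_of_infinite_multiplicity A (lambda : R[i]) : Prop :=
  forall n : nat, exists psi : 'I_n -> T -> R[i],
    [/\ forall i, l2 (psi i),
        forall i, A (psi i) = (fun t => lambda * psi i t)
      & forall c : 'I_n -> R[i],
          (forall t, \sum_i c i * psi i t = 0) -> forall i, c i = 0].

End Hilbert.

Section Crystal.
Variables (R : realType) (d nu : nat).

(* The rows of [basis] are the vectors a_1, ..., a_d. *)
Definition translation (basis : 'M[R]_d) (k : 'rV[int]_d) : 'rV[R]_d :=
  \sum_i (k 0 i)%:~R *: row i basis.

(* [weight] and [potential] are functions on the whole space of which only
   the values on [vertices] matter. *)
Record crystal := Crystal {
  vertices : set 'rV[R]_d;
  basis : 'M[R]_d;
  cell : 'I_nu -> 'rV[R]_d;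
  weight : 'rV[R]_d -> 'rV[R]_d -> R;
  potential : 'rV[R]_d -> R;
  vertices_countable : countable vertices;
  basis_free : row_free basis;
  vertices_cell : vertices =
    [set cell ik.1 + translation basis ik.2 | ik in [set: 'I_nu * 'rV[int]_d]];
  vertices_uniq : forall i j k l,
    cell i + translation basis k = cell j + translation basis l ->
    i = j /\ k = l;
  weight_ge0 : forall v v', vertices v -> vertices v' -> 0 <= weight v v';
  weight_sym : forall v v', vertices v -> vertices v' ->
    weight v v' = weight v' v;
  weight_diag : forall v, vertices v -> weight v v = 0;
  weight_summable : forall v, vertices v ->
    (\esum_(v' in vertices) (weight v v')%:E < +oo)%E;
  weight_periodic : forall v v' k, vertices v -> vertices v' ->
    weight (v + translation basis k) (v' + translation basis k) = weight v v';
  potential_periodic : forall v k, vertices v ->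
    potential (v + translation basis k) = potential v;
  crystal_connected : forall v v' : vertices,
    exists2 p : seq vertices,
      path (fun x y : vertices => 0 < weight (val x) (val y)) v p
      & last v p = v'
}.

Variable G : crystal.

Definition schrodinger (psi : vertices G -> R[i]) : vertices G -> R[i] :=
  fun v => csum (fun v' : vertices G => (weight G (val v) (val v'))%:C * psi v')
           + (potential G (val v))%:C * psi v.

Definition cell_weight (i j : 'I_nu) (k : 'rV[int]_d) : R :=
  weight G (cell G i) (cell G j + translation (basis G) k).

(* exp(i x) *)
Definition expi (x : R) : R[i] := cos x +i* sin x.

(* Functions on the torus R^d / Z^d are represented by their Z^d-periodic
   lifts to R^d. *)
Definition floquet (theta : 'rV[R]_d) : 'M[R[i]]_nu :=
  \matrix_(i, j)
    (csum (fun k : 'rV[int]_d => (cell_weight i j k)%:C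
             * expi (2 * pi * \sum_l theta 0 l * (k 0 l)%:~R))
     + (potential G (cell G i))%:C *+ (i == j)).

(* E_1 <= ... <= E_nu are the eigenvalues of the Floquet matrix, counted with
   multiplicity. *)
Definition floquet_eigenvalues (E : 'I_nu -> 'rV[R]_d -> R) : Prop :=
  forall theta,
    (forall i j : 'I_nu, (i <= j)%N -> E i theta <= E j theta) /\
    char_poly (floquet theta) = \prod_j ('X - ((E j theta)%:C)%:P).

End Crystal.

Section Euclidean.
Variables (R : realType) (d : nat).

(* Lebesgue-null subsets of R^d: covered by countably many boxes of
   arbitrarily small total volume. *)
Definition lebesgue_null (A : set 'rV[R]_d) : Prop :=
  forall e : R, 0 < e -> exists a b : nat -> 'rV[R]_d,
    [/\ forall n i, a n 0 i <= b n 0 i,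
        A `<=` \bigcup_n [set x | forall i, a n 0 i <= x 0 i <= b n 0 i]
      & (\sum_(n <oo) (\prod_i (b n 0 i - a n 0 i))%:E <= e%:E)%E].

Definition almost_everywhere_on (S : set 'rV[R]_d) (P : 'rV[R]_d -> Prop) :=
  lebesgue_null [set x | S x /\ ~ P x].

Definition gradient (f : 'rV[R]_d -> R) (x : 'rV[R]_d) : 'rV[R]_d :=
  \row_i 'D_(delta_mx 0 i) (f : 'rV[R]_d -> R^o) x.

End Euclidean.

(* Main.v *)
Require Import Defs.
From HB Require Import structures.
From mathcomp Require Import all_boot all_order all_algebra.
From mathcomp Require Import all_classical all_reals all_analysis.
From mathcomp Require Import measurable_realfun complex spectral ring lra zify.
From mathcomp Require finmap.
Import Order.TTheory GRing.Theory Num.Theory.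
Import numFieldNormedType.Exports.
Set Implicit Arguments.
Unset Strict Implicit.
Unset Printing Implicit Defensive.
Local Open Scope classical_set_scope.
Local Open Scope ring_scope.

(* Each Floquet eigenvalue is tied to the operator through a density of states
   formula that needs neither the Fourier transform nor measures on the torus:
   averaging Bloch waves over a grid of N^d quasimomenta gives a comb supported
   on N Z^d, which tends to a delta function, so the spectral moments of the
   delta functions of a cell are limits of grid averages of powers of the E_j.
   Hence the spectral measure per cell is the push-forward of the grid averages
   by the E_j.

   If grad E_j <> 0 a.e., then replacing a coordinate by E_j gives a map which
   is inverse-Lipschitz on countably many pieces covering almost all of R^d, so
   the preimage by E_j of a null set is null. For a compact null set the
   preimage in the unit cube is compact and null, hence contains few grid
   points, and the spectral measure of the compact set vanishes; general Borel
   null sets follow by inner regularity.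

   If grad E_j = 0 a.e. on an open set, then E_j is constant along almost all
   lines parallel to the axes (slicing the exceptional null set one coordinate
   at a time) and so on a cube, which has a positive fraction of the grid
   points; its value is then an atom of the spectral measure, i.e. an
   eigenvalue. The translates of an eigenvector are linearly independent, since
   a nonzero square summable sequence satisfies no linear recurrence.

   The spectral theorem itself is derived for a symmetric operator between 0 and
   1 on a real Hilbert space from the Hausdorff moment problem. *)

(** * Bernstein polynomials and completely monotone functionals *)

(** The grid sees only eigenvalues, through traces of powers of the Floquet matrix; eigenvectors,
    which may depend badly on [theta] at crossings, are never chosen as functions of [theta]. Bloch
    waves are bounded but not square summable, so the operator also acts on bounded functions, where
    pointwise convergence under a uniform bound replaces convergence in norm. The weights being
    real, the operator acts separately on real and imaginary parts: the spectral theorem is proved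
    on real square summable functions and complexified at the end. It rests on Bernstein
    polynomials, hence the passage to [(H + M) / 2M], whose spectrum lies in the unit interval. Grid
    averages are controlled only against Lipschitz test functions, and a null set may contain every
    grid point; hence the detour through compact sets, where finitely many open boxes bound the
    number of grid points. The Lipschitz condition enters twice: it compares values at nearby points
    when preimages of null sets are covered, and it excludes Cantor-like functions, whose derivative
    vanishes almost everywhere although they are not constant. *)

Section Bernstein.
Variable R : realType.
Implicit Types (p : {poly R}) (L : {scalar {poly R}}) (n k j : nat) (x : R).

Definition bernstein n k : {poly R} := ('X^k * (1 - 'X) ^+ (n - k)) *+ 'C(n, k).

(** Both sides count the [k]-subsets of an [n]-set together with an ordered choice of [j] of their
    points. Multiplied by [(k - j)!] and [(n - k)!], both become [n!]. *)
Lemma bin_ffact_shift n k j : (j <= k)%N -> (k <= n)%N ->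
  ('C(n, k) * k ^_ j = n ^_ j * 'C(n - j, k - j))%N.
Proof.
move=> jk kn; have jn := leq_trans jk kn.
apply/eqP; rewrite -(eqn_pmul2r (fact_gt0 (k - j))).
rewrite -mulnA ffact_fact// bin_ffact -mulnA bin_ffact.
rewrite -(eqn_pmul2r (fact_gt0 (n - k))) ffact_fact//.
have -> : (n - k = (n - j) - (k - j))%N by rewrite subnBA// subnK.
by rewrite -mulnA ffact_fact ?leq_sub2r// ffact_fact.
Qed.

(* Expand [X^j = X^j (X + (1 - X))^(n - j)]. *)
Lemma sum_bernstein n j : (j <= n)%N ->
  \sum_(k < n.+1) ((k ^_ j)%:R / (n ^_ j)%:R) *: bernstein n k = 'X^j :> {poly R}.
Proof.
move=> jn.
have nj0 : (n ^_ j)%:R != 0 :> R by rewrite pnatr_eq0 -lt0n ffact_gt0.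
have -> : 'X^j = 'X^j * ((1 - 'X) + 'X) ^+ (n - j) :> {poly R}.
  by rewrite subrK expr1n mulr1.
rewrite exprDn mulr_sumr.
rewrite -(big_mkord xpredT (fun k => ((k ^_ j)%:R / (n ^_ j)%:R) *: bernstein n k)).
rewrite (big_cat_nat (n := j)) ?leqW//= big_nat big1 ?add0r; last first.
  by move=> k /andP[_ kj]; rewrite ffact_small// mul0r scale0r.
rewrite -{1}(add0n j) big_addn subSn// big_mkord; apply: eq_bigr => i _.
have ile : (i <= n - j)%N by rewrite -ltnS.
have ijn : (i + j <= n)%N by move: (ile) jn; clear; lia.
rewrite /bernstein -[_ *+ 'C(n, _)]scaler_nat scalerA mulrAC -natrM.
rewrite mulnC bin_ffact_shift ?leq_addl// addnK natrM mulrAC divff// mul1r.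
rewrite scaler_nat mulrnAr; congr (_ *+ _).
rewrite exprD -mulrA [in LHS]mulrC -!mulrA; congr (_ * _).
by rewrite addnC subnDA.
Qed.

Lemma ffact_ratio_le1 n k j : (k <= n)%N -> (j <= n)%N ->
  0 <= ((k ^_ j)%:R / (n ^_ j)%:R : R) <= 1.
Proof.
move=> kn jn; rewrite divr_ge0//= ler_pdivrMr ?ltr0n ?ffact_gt0// mul1r ler_nat.
elim: j {jn} => // j IH.
by rewrite !ffactnSr leq_mul// leq_sub2r.
Qed.

(** The factor [(k - j) / (n - j)] differs from [k / n] by at most [j / (n - j)], which is at most
    [2 * j / n] once [2 * j <= n]. These errors add up over the factors. *)
Lemma ffact_ratio_approx n k j : (k <= n)%N -> (0 < n)%N -> (j.*2 <= n)%N ->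
  `|(k ^_ j)%:R / (n ^_ j)%:R - (k%:R / n%:R) ^+ j| <= (2 * j ^ 2)%:R / n%:R :> R.
Proof.
move=> kn n0; elim: j => [|j IH] jn.
  by rewrite !ffactn0 divr1 expr0 subrr normr0 divr_ge0.
have {}IH := IH (ltac:(lia)).
have n0' : 0 < n%:R :> R by rewrite ltr0n.
have x01 : 0 <= (k%:R / n%:R : R) <= 1.
  by rewrite divr_ge0//= ler_pdivrMr// mul1r ler_nat.
have a01 : 0 <= ((k ^_ j)%:R / (n ^_ j)%:R : R) <= 1 by apply: ffact_ratio_le1; lia.
rewrite !ffactnSr !natrM exprSr -mulf_div.
set a := (k ^_ j)%:R / (n ^_ j)%:R in IH a01 *; set x := k%:R / n%:R in IH x01 *.
have Hb : `|a * ((k - j)%:R / (n - j)%:R - x)| <= (2 * j)%:R / n%:R.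
  (* For [k < j] the truncated subtraction does no harm, since [k ^_ j = 0]. *)
  have [kj|jk] := ltnP k j.
    by rewrite /a ffact_small// mul0r mul0r normr0 divr_ge0.
  have nj0 : 0 < (n - j)%:R :> R by rewrite ltr0n; lia.
  rewrite normrM; apply: (@le_trans _ _ (1 * (j%:R / (n - j)%:R))).
    apply: ler_pM => //; first by rewrite ger0_norm; case/andP: a01.
    have -> : (k - j)%:R / (n - j)%:R - x = - (j%:R / (n - j)%:R) * (1 - x) :> R.
      have jn' : (j <= n)%N by lia.
      move: nj0; rewrite /x !natrB// => nj0.
      by field; rewrite ?gt_eqF.
    have x1 : 0 <= 1 - x by rewrite subr_ge0; case/andP: x01.
    rewrite normrM normrN (ger0_norm x1) ger0_norm ?divr_ge0//.
    by rewrite -[leRHS]mulr1 ler_wpM2l ?divr_ge0// gerBl; case/andP: x01.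
  rewrite mul1r ler_pdivrMr// mulrAC ler_pdivlMr// -!natrM ler_nat.
  by rewrite -mulnA [leqRHS]mulnCA leq_mul2l; apply/orP; right; lia.
have -> : a * ((k - j)%:R / (n - j)%:R) - x ^+ j * x =
  a * ((k - j)%:R / (n - j)%:R - x) + (a - x ^+ j) * x by ring.
apply: (le_trans (ler_normD _ _)).
apply: (@le_trans _ _ ((2 * j)%:R / n%:R + (2 * j ^ 2)%:R / n%:R)).
  apply: lerD => //; rewrite normrM; apply: (le_trans _ IH).
  by rewrite -[leRHS]mulr1 ler_wpM2l// ger0_norm; case/andP: x01.
rewrite -mulrDl ler_pM2r ?invr_gt0// -natr1 !natrM.
by have t0 : 0 <= j%:R :> R by []; nra.
Qed.

(** Hausdorff's condition: all iterated differences of the moment sequence [L 'X^k] are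
    nonnegative. *)
Definition completely_monotone L := forall k l, 0 <= L ('X^k * (1 - 'X) ^+ l).

Lemma bernstein_ge0 L n k : completely_monotone L -> 0 <= L (bernstein n k).
Proof. by move=> HL; rewrite /bernstein linearMn mulrn_wge0. Qed.

Lemma ler_addgt0_scaled (c a b : R) : 0 <= c -> (forall e, 0 < e -> a <= b + c * e) -> a <= b.
Proof.
move=> c0 H; apply/ler_addgt0Pr => e e0.
have c1 : 0 < c + 1 by rewrite ltr_wpDl.
apply: (le_trans (H (e / (c + 1)) (divr_gt0 e0 c1))).
rewrite lerD2l mulrCA ger_pMr// ler_pdivrMr// mul1r; lra.
Qed.

(** By [sum_bernstein], [p] is a combination of Bernstein polynomials with coefficients within
    [C / n] of the values [p.[k / n]], which are nonnegative. As [L] is nonnegative on Bernstein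
    polynomials and these sum to [1], [L p >= - C / n * L 1] for all large [n]. *)
Lemma completely_monotone_ge0 L p : completely_monotone L ->
  (forall x, 0 <= x <= 1 -> 0 <= p.[x]) -> 0 <= L p.
Proof.
move=> HL Hp.
have L1 : 0 <= L 1 by have := HL 0 0; rewrite !expr0 mulr1.
set C := \sum_(j < size p) `|p`_j| * (2 * j ^ 2)%:R.
have C0 : 0 <= C by apply: sumr_ge0 => j _; rewrite mulr_ge0.
apply: (@ler_addgt0_scaled (C * L 1)); first exact: mulr_ge0.
(* The first bound lets [ffact_ratio_approx] apply to every coefficient, the second makes [1 / n] at
   most [e]. *)
move=> e e0; pose n := maxn (size p).*2 (Num.bound e^-1).
have n0 : (0 < n)%N.
  rewrite leq_max; apply/orP; right; rewrite -(ltr0n R).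
  by apply: (le_lt_trans _ (archi_boundP _)); rewrite ?invr_ge0 ltW.
have n0' : 0 < n%:R :> R by rewrite ltr0n.
have en : n%:R^-1 <= e.
  rewrite -[leRHS]invrK lef_pV2 ?posrE ?invr_gt0//.
  apply: ltW; apply: (lt_le_trans (archi_boundP _)); first by rewrite invr_ge0 ltW.
  by rewrite ler_nat leq_max leqnn orbT.
have sn j : (j < size p)%N -> (j.*2 <= n)%N.
  by move=> js; rewrite leq_max leq_double ltnW.
have -> : L p = \sum_(k < n.+1)
    (\sum_(j < size p) p`_j * ((k ^_ j)%:R / (n ^_ j)%:R)) * L (bernstein n k).
  rewrite -[in LHS](coefK p) poly_def linear_sum /=.
  under [RHS]eq_bigr do rewrite mulr_suml.
  rewrite [RHS]exchange_big /=; apply: eq_bigr => j _.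
  rewrite linearZ/= -(@sum_bernstein n j); last by have := sn _ (ltn_ord j); lia.
  rewrite linear_sum/= mulr_sumr; apply: eq_bigr => k _.
  by rewrite linearZ/= mulrA.
have sum1 : \sum_(k < n.+1) L (bernstein n k) = L 1.
  rewrite -linear_sum -(expr0 'X) -(@sum_bernstein n 0)//; congr (L _).
  by apply: eq_bigr => k _; rewrite !ffactn0 divr1 scale1r.
apply: (@le_trans _ _ (\sum_(k < n.+1)
    (\sum_(j < size p) p`_j * ((k ^_ j)%:R / (n ^_ j)%:R) + C * e) * L (bernstein n k))); last first.
  under eq_bigr do rewrite mulrDl.
  by rewrite big_split/= -mulr_sumr sum1 mulrAC.
apply: sumr_ge0 => k _; apply: mulr_ge0; last exact: bernstein_ge0.
have kn : (k <= n)%N by rewrite -ltnS.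
have := Hp (k%:R / n%:R); rewrite divr_ge0//= ler_pdivrMr// mul1r ler_nat kn => /(_ isT).
move=> /le_trans; apply.
rewrite horner_coef -lerBlDl -sumrB.
apply: (@le_trans _ _ (C * n%:R^-1)); last by rewrite ler_wpM2l.
rewrite mulr_suml; apply: ler_sum => j _; rewrite -mulrBr.
apply: (le_trans (ler_norm _)); rewrite normrM -mulrA ler_wpM2l// distrC.
by apply: ffact_ratio_approx => //; exact: sn.
Qed.

Lemma horner_bernstein_ge0 n k x : 0 <= x <= 1 -> 0 <= (bernstein n k).[x].
Proof.
case/andP=> x0 x1; rewrite /bernstein hornerMn mulrn_wge0// !hornerE.
by rewrite mulr_ge0 ?exprn_ge0 ?subr_ge0.
Qed.

Lemma sum_horner_bernstein n j x : (j <= n)%N ->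
  \sum_(k < n.+1) (k ^_ j)%:R / (n ^_ j)%:R * (bernstein n k).[x] = x ^+ j.
Proof.
move=> jn; have /(congr1 (horner^~ x)) := sum_bernstein jn.
rewrite horner_sum hornerXn => <-.
by apply: eq_bigr => k _; rewrite hornerZ.
Qed.

(** The variance of a binomial frequency, obtained from the factorial moments of orders 0, 1 and 2;
    the last one divides by [n * (n - 1)]. *)
Lemma bernstein_variance n x : (1 < n)%N ->
  \sum_(k < n.+1) (k%:R / n%:R - x) ^+ 2 * (bernstein n k).[x] = x * (1 - x) / n%:R.
Proof.
move=> n1.
have n0' : 0 < n%:R :> R by rewrite ltr0n; lia.
have n1' : 0 < n%:R - 1 :> R by rewrite subr_gt0 ltr1n.
have E0 := @sum_horner_bernstein n 0 x (ltac:(lia)).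
have E1 := @sum_horner_bernstein n 1 x (ltac:(lia)).
have E2 := @sum_horner_bernstein n 2 x (ltac:(lia)).
have f2 (m : nat) : (m ^_ 2)%:R = m%:R * (m%:R - 1) :> R.
  by case: m => [|m]; rewrite ?mul0r// ffactnS ffactn1 natrM -natr1 addrK.
transitivity ((1 - n%:R^-1) * x ^+ 2 + (n%:R^-1 - 2 * x) * x ^+ 1 + x * x * x ^+ 0).
  rewrite -E0 -E1 -E2 !mulr_sumr -!big_split /=; apply: eq_bigr => k _.
  rewrite !f2 !ffactn1 !ffactn0 invr1.
  by field; rewrite ?gt_eqF// -subr_eq0 ?gt_eqF.
by field; rewrite ?gt_eqF.
Qed.

Lemma archi_inv_lt (e : R) : 0 < e -> exists2 n : nat, (0 < n)%N & n%:R^-1 < e.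
Proof.
move=> e0; have i0 : 0 < e^-1 by rewrite invr_gt0.
have H := archi_boundP (ltW i0); exists (Num.bound e^-1).
  by rewrite -(ltr0n R) (lt_trans i0).
by rewrite -[ltRHS]invrK ltf_pV2 ?posrE// (lt_trans i0).
Qed.

(** Bernstein's proof. The bound [t <= d + t ^ 2 / d] reduces the mean of [|k / n - x|] to the
    variance, which is at most [d ^ 2] for large [n]; the total [2 * K * d] is then at most [e] by
    the choice of [d]. *)
Lemma weierstrass_lipschitz (f : R -> R) (K e : R) : 0 < e ->
  (forall x y, 0 <= x <= 1 -> 0 <= y <= 1 -> `|f x - f y| <= K * `|x - y|) ->
  exists p : {poly R}, forall x, 0 <= x <= 1 -> `|p.[x] - f x| <= e.
Proof.
move=> e0 Hf.
have K0 : 0 <= K.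
  by have := Hf 0 1; rewrite !lexx ler01/= sub0r normrN1 mulr1 => /(_ isT isT); apply: le_trans.
pose d := e / (2 * (K + 1)).
have d0 : 0 < d by rewrite divr_gt0// mulr_gt0// ltr_wpDl.
have [n n0 nd] := archi_inv_lt (exprn_gt0 2 d0).
have {}nd : (n.+1)%:R^-1 <= d ^+ 2.
  by apply: (le_trans _ (ltW nd)); rewrite lef_pV2 ?posrE ?ltr0n// ler_nat.
exists (\sum_(k < n.+2) f (k%:R / n.+1%:R) *: bernstein n.+1 k) => x x01.
have S1 : \sum_(k < n.+2) (bernstein n.+1 k).[x] = 1.
  rewrite -(expr0 x) -(@sum_horner_bernstein n.+1 0)//.
  by apply: eq_bigr => k _; rewrite !ffactn0 divr1 mul1r.
rewrite horner_sum -[f x]mulr1 -[X in f x * X]S1 mulr_sumr -sumrB.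
apply: (le_trans (ler_norm_sum _ _ _)).
apply: (@le_trans _ _ (\sum_(k < n.+2) K * (d + (k%:R / n.+1%:R - x) ^+ 2 / d) * (bernstein n.+1 k).[x])).
  apply: ler_sum => k _; rewrite hornerZ -mulrBl normrM.
  rewrite [X in _ * X]ger0_norm ?horner_bernstein_ge0// ler_wpM2r ?horner_bernstein_ge0//.
  apply: (le_trans (Hf _ _ _ x01)).
    by rewrite divr_ge0//= ler_pdivrMr// mul1r ler_nat -ltnS.
  rewrite ler_wpM2l// -(ler_pM2r d0) mulrDl divfK ?gt_eqF// -[leRHS]addr0.
  rewrite -real_normK ?num_real//; set t := `|_|; nra.
rewrite (eq_bigr (fun k : 'I__ => K * d * (bernstein n.+1 k).[x]
    + K / d * ((k%:R / n.+1%:R - x) ^+ 2 * (bernstein n.+1 k).[x]))); last by move=> k _; ring.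
rewrite big_split/= -!mulr_sumr S1 bernstein_variance// mulr1.
have xx : x * (1 - x) <= 1 by case/andP: x01; nra.
apply: (@le_trans _ _ (K * d + K / d * d ^+ 2)).
  rewrite lerD2l; apply: ler_wpM2l; first by rewrite divr_ge0// ltW.
  apply: le_trans nd.
  by rewrite -[leRHS]mul1r ler_wpM2r// invr_ge0.
have -> : K / d * d ^+ 2 = K * d by field; rewrite gt_eqF.
have -> : K * d + K * d = (K * e) / (K + 1) by rewrite /d; field; rewrite gt_eqF// ltr_wpDl.
by rewrite ler_pdivrMr ?ltr_wpDl//; nra.
Qed.
End Bernstein.

(** * Bounded functions on the unit interval *)

Section BoundedIntegral.
Variable R : realType.
Implicit Types (h g : R -> R) (B : set (measurableTypeR R)).
Let T := measurableTypeR R.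
Let I01 : set T := `[0, 1]%classic.

(** Bounded on the unit interval only, so that polynomials qualify. *)
Definition bounded_measurable h :=
  measurable_fun [set: T] h /\ exists C, forall x : R, 0 <= x <= 1 -> `|h x| <= C.

Let mI01 : measurable I01. Proof. exact: measurable_itv. Qed.

Lemma measurable_fun_lipschitzT h (K : R) : (forall x y, `|h x - h y| <= K * `|x - y|) ->
  measurable_fun [set: T] h.
Proof.
move=> Hh.
have ch : continuous h.
  move=> x; apply/cvgrPdist_le => e e0.
  have K1 : 0 < `|K| + 1 by rewrite ltr_wpDl.
  near=> y; apply: (le_trans (Hh _ _)).
  apply: (@le_trans _ _ ((`|K| + 1) * `|x - y|)).
    by rewrite ler_wpM2r// (le_trans (ler_norm _))// lerDl.
  rewrite mulrC -ler_pdivlMr//; near: y.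
  apply: cvgr_dist_le => //; exact: divr_gt0.
exact: (@continuous_measurable_fun R h ch).
Unshelve. all: by end_near. Qed.

Lemma bounded_measurable_horner (p : {poly R}) : bounded_measurable (horner p).
Proof.
split.
  exact: (@continuous_measurable_fun R _ (@continuous_horner _ p)).
exists (\sum_(i < size p) `|p`_i|) => x /andP[x0 x1].
rewrite horner_coef; apply: (le_trans (ler_norm_sum _ _ _)); apply: ler_sum => i _.
by rewrite normrM ler_piMr// normrX exprn_ile1// ger0_norm.
Qed.

Lemma bounded_measurableX k : bounded_measurable (fun x => x ^+ k).
Proof.
rewrite (_ : (fun x => _) = horner 'X^k); first exact: bounded_measurable_horner.
by apply/funext => x; rewrite hornerXn.
Qed.

Lemma bounded_measurable_cst c : bounded_measurable (fun=> c).
Proof. by split; [exact: measurable_cst | exists `|c|]. Qed.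

Lemma bounded_measurableD h g : bounded_measurable h -> bounded_measurable g ->
  bounded_measurable (fun x => h x + g x).
Proof.
move=> [mh [C HC]] [mg [C' HC']]; split; first exact: measurable_funD.
by exists (C + C') => x x01; rewrite (le_trans (ler_normD _ _))// lerD ?HC ?HC'.
Qed.

Lemma bounded_measurableM h g : bounded_measurable h -> bounded_measurable g ->
  bounded_measurable (fun x => h x * g x).
Proof.
move=> [mh [C HC]] [mg [C' HC']]; split; first exact: measurable_funM.
by exists (C * C') => x x01; rewrite normrM ler_pM ?HC ?HC'.
Qed.

Lemma bounded_measurableZ c h : bounded_measurable h -> bounded_measurable (fun x => c * h x).
Proof. by apply: bounded_measurableM; exact: bounded_measurable_cst. Qed.

Lemma bounded_measurable_indic B : measurable B -> bounded_measurable (\1_B : R -> R).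
Proof.
move=> mB; split; first exact: measurable_indic.
by exists 1 => x _; rewrite indicE; case: (_ \in _); rewrite ?normr1 ?normr0.
Qed.

Section Integral.
Variable mu : {measure set T -> \bar R}.
Hypothesis fin_mu : (mu setT < +oo)%E.

Definition integral01 h : R := \int[mu]_(x in I01) h x.

Let finI : (mu I01 < +oo)%E.
Proof. by apply: le_lt_trans fin_mu; apply: le_measure; rewrite ?inE. Qed.

Lemma bounded_measurable_integrable h : bounded_measurable h -> mu.-integrable I01 (EFin \o h).
Proof.
move=> [mh [C HC]]; apply: measurable_bounded_integrable => //.
  exact: measurable_funTS.
exists C; split; first exact: num_real.
by move=> M CM x; rewrite /I01/= in_itv/= => /HC/le_trans; apply; exact: ltW.
Qed.

Lemma integral01D h g : bounded_measurable h -> bounded_measurable g ->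
  integral01 (fun x => h x + g x) = integral01 h + integral01 g.
Proof. by move=> mh mg; apply: RintegralD => //; exact: bounded_measurable_integrable. Qed.

Lemma integral01Z c h : bounded_measurable h ->
  integral01 (fun x => c * h x) = c * integral01 h.
Proof. by move=> mh; apply: RintegralZl => //; exact: bounded_measurable_integrable. Qed.

Lemma integral01_sum n (h : 'I_n -> R -> R) : (forall i, bounded_measurable (h i)) ->
  bounded_measurable (fun x => \sum_i h i x) /\
  integral01 (fun x => \sum_i h i x) = \sum_i integral01 (h i).
Proof.
elim: n h => [|n IH] h mh.
  under eq_fun do rewrite big_ord0; rewrite big_ord0; split; first exact: bounded_measurable_cst.
  by rewrite /integral01 Rintegral_cst ?mul0r.
have [m1 e1] := IH (fun i => h (lift ord0 i)) (fun i => mh _).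
under eq_fun do rewrite big_ord_recl; rewrite big_ord_recl; split.
  exact: bounded_measurableD.
by rewrite integral01D// e1.
Qed.

Lemma le_integral01 h g : bounded_measurable h -> bounded_measurable g ->
  (forall x, 0 <= x <= 1 -> h x <= g x) -> integral01 h <= integral01 g.
Proof.
move=> mh mg hg; apply: le_Rintegral => //; try exact: bounded_measurable_integrable.
Qed.

Lemma eq_integral01 h g : (forall x, 0 <= x <= 1 -> h x = g x) -> integral01 h = integral01 g.
Proof.
by move=> hg; apply: eq_Rintegral => x; rewrite inE /I01/= in_itv/=; exact: hg.
Qed.

Lemma integral01_indic B : measurable B -> integral01 \1_B = fine (mu (B `&` I01)).
Proof. by move=> mB; rewrite /integral01/Rintegral integral_indic. Qed.

Lemma integral01_cvg (h : nat -> R -> R) (g : R -> R) (C : R) :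
  (forall n, measurable_fun [set: T] (h n)) ->
  (forall n x, 0 <= x <= 1 -> `|h n x| <= C) ->
  (forall x, 0 <= x <= 1 -> h ^~ x @ \oo --> g x) ->
  bounded_measurable g ->
  (fun n => integral01 (h n)) @ \oo --> integral01 g.
Proof.
move=> mh hC hg mg.
rewrite /integral01 /Rintegral; apply: fine_cvg.
rewrite fineK; last by apply: integrable_fin_num => //; exact: bounded_measurable_integrable.
apply: (@dominated_cvg _ _ _ mu I01 mI01 (fun n x => (h n x)%:E) _ (cst C%:E)) => //.
- by move=> n; apply/measurable_EFinP; exact: measurable_funTS.
- by move=> x; rewrite /I01/= in_itv/= => x01; apply: cvg_EFin; [exact: nearW|exact: hg].
- by apply: (@bounded_measurable_integrable (cst C)); exact: bounded_measurable_cst.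
Qed.

End Integral.

Lemma clamp01_lipschitz (a b : R) :
  `|Num.max 0 (Num.min 1 a) - Num.max 0 (Num.min 1 b)| <= `|a - b|.
Proof.
rewrite ler_norml; have h1 := ler_norm (a - b); have h2 := ler_norm (b - a).
rewrite distrC in h2; move: `|a - b| h1 h2 => d h1 h2.
have [a0|a0] := leP 0 (Num.min 1 a); have [b0|b0] := leP 0 (Num.min 1 b);
  move: a0 b0; have [a1|a1] := leP 1 a; have [b1|b1] := leP 1 b => a0 b0; lra.
Qed.

Lemma clamp01_le1 (a : R) : `|Num.max 0 (Num.min 1 a)| <= 1.
Proof.
by rewrite ger0_norm ?le_max ?lexx// ge_max ler01 ge_min lexx.
Qed.

Lemma clamp01_ge1 (a : R) : 1 <= a -> Num.max 0 (Num.min 1 a) = 1.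
Proof. by move=> a1; rewrite (min_idPl a1) (max_idPr ler01). Qed.

Lemma clamp01_le0 (a : R) : a <= 0 -> Num.max 0 (Num.min 1 a) = 0.
Proof. by move=> a0; apply/max_idPl; rewrite ge_min a0 orbT. Qed.

(** The ramp is [1] up to [t] and falls with slope [- n] to [0] at [t + 1 / n]. For fixed [n] it is
    Lipschitz, and as [n] grows it tends to the indicator of the ray []-oo, t]]. *)
Lemma ramp_approx (t : R) (n : nat) (e : R) : 0 < e -> exists p : {poly R},
  forall x, 0 <= x <= 1 -> `|p.[x] - Num.max 0 (Num.min 1 (1 - n%:R * (x - t)))| <= e.
Proof.
move=> e0; apply: (@weierstrass_lipschitz _ _ n%:R) => // x y _ _.
have -> : n%:R * `|x - y| = `|(1 - n%:R * (x - t)) - (1 - n%:R * (y - t))|.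
  rewrite (_ : 1 - _ - _ = n%:R * (y - x)); last by ring.
  by rewrite normrM ger0_norm// distrC.
exact: clamp01_lipschitz.
Qed.

(* The rays are bounded pointwise limits of polynomials, so Dynkin's lemma applies. *)
Lemma bounded_class_indic (V : (R -> R) -> Prop) :
  (forall k, V (fun x => x ^+ k)) ->
  (forall c h g, bounded_measurable h -> bounded_measurable g -> V h -> V g ->
     V (fun x => c * h x + g x)) ->
  (forall (h : nat -> R -> R) (g : R -> R) (C : R),
     (forall n, measurable_fun [set: T] (h n)) ->
     (forall n x, 0 <= x <= 1 -> `|h n x| <= C) ->
     (forall x, 0 <= x <= 1 -> h ^~ x @ \oo --> g x) ->
     bounded_measurable g -> (forall n, V (h n)) -> V g) ->
  forall B, measurable B -> V \1_B.
Proof.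
move=> VX Vlin Vlim.
have bX := bounded_measurableX.
have V1 : V (fun=> 1) by have := VX 0.
have V0 : V (fun=> 0).
  have := Vlin (-1) _ _ (bounded_measurable_cst 1) (bounded_measurable_cst 1) V1 V1.
  by congr V; apply/funext => x; rewrite mulr1 addNr.
have Vp (p : {poly R}) : V (horner p).
  have H n : V (fun x => \sum_(i < n) p`_i * x ^+ i) /\
     bounded_measurable (fun x => \sum_(i < n) p`_i * x ^+ i).
    elim: n => [|n [IH1 IH2]].
      by under eq_fun do rewrite big_ord0; split; [|exact: bounded_measurable_cst].
    rewrite (_ : (fun x => _) = fun x => p`_n * x ^+ n + \sum_(i < n) p`_i * x ^+ i); last first.
      by apply/funext => x; rewrite big_ord_recr addrC.
    split; first exact: Vlin.
    by apply: bounded_measurableD => //; exact: bounded_measurableZ.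
  have [+ _] := H (size p); congr V; apply/funext => x.
  by rewrite horner_coef.
have invS0 n : 0 < n.+1%:R^-1 :> R by rewrite invr_gt0.
have ray t : V (\1_(`]-oo, t]%classic : set T)).
  pose p n : {poly R} := sval (cid (@ramp_approx t n _ (invS0 n))).
  have Hp n x : 0 <= x <= 1 -> `|(p n).[x] - Num.max 0 (Num.min 1 (1 - n%:R * (x - t)))| <= n.+1%:R^-1.
    exact: (svalP (cid (@ramp_approx t n _ (invS0 n)))).
  apply: (Vlim (fun n => horner (p n)) _ 2) => //.
  - by move=> n; case: (bounded_measurable_horner (p n)).
  - move=> n x x01; rewrite -[(p n).[x]](subrK (Num.max 0 (Num.min 1 (1 - n%:R * (x - t))))).
    apply: (le_trans (ler_normD _ _)); rewrite -[2]/(1 + 1) lerD//.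
      by apply: (le_trans (Hp n x x01)); rewrite invf_le1// ler1n.
    exact: clamp01_le1.
  - move=> x x01; apply/cvgrPdist_le => e e0.
    have [N1 N10 N1e] := archi_inv_lt e0.
    (* From [N2] on, the ramp has already come down to [0] at a point [x] to the right of [t]. *)
    have [N2 N20 HN2] : exists2 N2 : nat, (0 < N2)%N & t < x -> 1 <= N2%:R * (x - t).
      have [tx|xt] := ltP t x; last by exists 1%N.
      have xt0 : 0 < x - t by rewrite subr_gt0.
      have [N2 N20 /ltW N2e] := archi_inv_lt xt0; exists N2 => // _.
      by rewrite mulrC -ler_pdivrMr ?ltr0n// mul1r.
    exists (maxn N1 N2) => // n; rewrite /= geq_max => /andP[n1 n2].
    have -> : \1_(`]-oo, t]%classic : set T) x = Num.max 0 (Num.min 1 (1 - n%:R * (x - t))).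
      have n2' : N2%:R <= n%:R :> R by rewrite ler_nat.
      rewrite indicE mem_setE in_itv/=; have [xt|tx] := leP x t.
        have : 0 <= n%:R * (t - x) by rewrite mulr_ge0// subr_ge0.
        by rewrite mulrBr => h; rewrite clamp01_ge1//; lra.
      have := HN2 tx; have : 0 < x - t by rewrite subr_gt0.
      by move=> xt h; rewrite clamp01_le0//; nra.
    rewrite distrC; apply: (le_trans (Hp n x x01)); apply: ltW; apply: le_lt_trans N1e.
    by rewrite lef_pV2 ?posrE ?ltr0n// ler_nat; apply: (leq_trans n1).
  - exact: bounded_measurable_indic.
(* The measurable sets with indicator in [V] form a Dynkin system. Half-open intervals are closed
   under intersection, generate the Borel sets, and are differences of two rays. *)
have lam : lambda_system setT [set B : set T | measurable B /\ V \1_B].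
  split => //.
  - split=> //; suff -> : \1_[set: T] = (fun=> 1 : R) by [].
    by apply/funext => x; rewrite indicE in_setT.
  - move=> A B AB [mA VA] [mB VB]; split; first exact: measurableD.
    have := Vlin (-1) _ _ (bounded_measurable_indic mB) (bounded_measurable_indic mA) VB VA.
    congr V; apply/funext => x; rewrite !indicE in_setD.
    have [xB|xB] := boolP (x \in B); have [xA|xA] := boolP (x \in A); rewrite /=; try lra.
    by exfalso; move: xB; rewrite inE => /AB xA'; move: xA; rewrite mem_set.
  - move=> F ndF HF; split; first by apply: bigcup_measurable => n _; case: (HF n).
    apply: (Vlim (fun n => \1_(F n)) _ 1).
    + by move=> n; apply: measurable_indic; case: (HF n).
    + by move=> n x _; rewrite indicE; case: (_ \in _); rewrite ?normr1 ?normr0.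
    + move=> x _; apply/cvgrPdist_le => e e0.
      rewrite indicE; have [|xF] := boolP (x \in \bigcup_n F n).
        rewrite inE => -[N _ xN]; exists N => // n /= Nn.
        rewrite indicE mem_set ?subrr ?normr0 ?(ltW e0)//.
        by move/subsetPset: (ndF _ _ Nn); apply.
      exists 0 => // n _ /=; rewrite indicE memNset ?subrr ?normr0 ?(ltW e0)// => Fx.
      by move: xF; rewrite notin_setE; apply; exists n.
    + by apply: bounded_measurable_indic; apply: bigcup_measurable => n _; case: (HF n).
    + by move=> n; case: (HF n).
move=> B mB; suff : [set B : set T | measurable B /\ V \1_B] B by case.
apply: (lambda_system_subset (G := @ocitv R) _ lam) => //.
- exact: ocitvI.
- move=> _ [[a b] _ <-] /=; split; first exact: measurable_itv.
  have [ab|ba] := leP a b; last first.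
    by rewrite set_itv_ge ?indic0// bnd_simp -leNgt ltW.
  have := Vlin (-1) _ _ (bounded_measurable_indic (measurable_itv `]-oo, a]))
    (bounded_measurable_indic (measurable_itv `]-oo, b])) (ray a) (ray b).
  congr V; apply/funext => x; rewrite !indicE !mem_setE !in_itv/=.
  by have [xa|ax] := leP x a; have [xb|bx] := leP x b; rewrite /=; lra.
Qed.

End BoundedIntegral.

(** * The Hausdorff moment problem *)

Section StepFunctions.
Variables (R : realType) (f : R -> R) (N : nat) (m : R).
Hypothesis N0 : (0 < N)%N.
Hypothesis fni : forall x y, 0 <= x -> x <= y -> y <= 1 -> f y <= f x.
Let tt (i : nat) : R := i%:R / N%:R.
Let c (i : nat) : R := f (tt i) - f (tt i.+1).
Hypothesis cm : forall i, (i < N)%N -> c i <= m.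

Let N0' : 0 < N%:R :> R. Proof. by rewrite ltr0n. Qed.

Let tt01 i : (i <= N)%N -> 0 <= tt i <= 1.
Proof. by move=> iN; rewrite divr_ge0//= ler_pdivrMr// mul1r ler_nat. Qed.

Let ttS i j : (i <= j)%N -> tt i <= tt j.
Proof. by move=> ij; rewrite ler_pM2r ?invr_gt0// ler_nat. Qed.

Let ttN : tt N = 1. Proof. by rewrite /tt divff// gt_eqF. Qed.

Let c0 i : (i < N)%N -> 0 <= c i.
Proof.
move=> iN; rewrite subr_ge0; apply: fni; last by case/andP: (tt01 iN).
  by case/andP: (tt01 (ltnW iN)).
exact: ttS.
Qed.

(** By telescoping, for [s] between consecutive nodes the sum with the nodes [tt i.+1] is [f - f 1]
    at the node to the left of [s], and the sum with the nodes [tt i] is [f - f 1] at the node to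
    the right. Monotonicity and the bound [m] on the jumps give this estimate and the next two. *)
Lemma step_upper_ge s : 0 <= s <= 1 ->
  f s - f 1 <= \sum_(i < N) c i * (s <= tt i.+1)%R%:R.
Proof.
move=> /andP[s0 s1].
suff H n : (n <= N)%N -> s <= tt n -> f s - f (tt n) <= \sum_(i < n) c i * (s <= tt i.+1)%R%:R.
  by have := H N (leqnn N); rewrite ttN; apply.
elim: n => [|n IH] nN sn.
  have -> : s = tt 0 by apply/eqP; rewrite eq_le sn /tt mul0r.
  by rewrite big_ord0 subrr.
rewrite big_ord_recr/= sn mulr1; have [sn'|sn'] := leP s (tt n).
  by have := IH (ltnW nN) sn'; rewrite /c; lra.
have : 0 <= \sum_(i < n) c i * (s <= tt i.+1)%R%:R.
  by apply: sumr_ge0 => i _; rewrite mulr_ge0// c0// (ltn_trans _ nN).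
have : f s <= f (tt n).
  by apply: fni; [case/andP: (tt01 (ltnW nN))|exact: ltW|rewrite (le_trans sn)//; case/andP: (tt01 nN)].
by rewrite /c; lra.
Qed.

Lemma step_upper_le s : 0 <= s <= 1 ->
  \sum_(i < N) c i * (s <= tt i.+1)%R%:R <= f s - f 1 + m.
Proof.
move=> /andP[s0 s1].
have m0 : 0 <= m by apply: le_trans (cm N0); exact: c0.
suff H n : (n <= N)%N -> s <= tt n -> \sum_(i < n) c i * (s <= tt i.+1)%R%:R <= f s - f (tt n) + m.
  by have := H N (leqnn N); rewrite ttN; apply.
elim: n => [|n IH] nN sn.
  have -> : s = tt 0 by apply/eqP; rewrite eq_le sn /tt mul0r.
  by rewrite big_ord0 subrr add0r.
rewrite big_ord_recr/= sn mulr1; have [sn'|sn'] := leP s (tt n).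
  by have := IH (ltnW nN) sn'; rewrite /c; lra.
rewrite big1 ?add0r => [|i _]; last first.
  by rewrite leNgt (le_lt_trans _ sn') ?mulr0// ttS.
have : f (tt n.+1) <= f s by apply: fni => //; case/andP: (tt01 nN).
by have := cm nN; lra.
Qed.

Lemma step_lower_ge s : 0 <= s <= 1 ->
  f s - f 1 - m <= \sum_(i < N) c i * (s <= tt i)%R%:R.
Proof.
move=> /andP[s0 s1].
have m0 : 0 <= m by apply: le_trans (cm N0); exact: c0.
suff H n : (n <= N)%N -> s <= tt n -> f s - f (tt n) - m <= \sum_(i < n) c i * (s <= tt i)%R%:R.
  by have := H N (leqnn N); rewrite ttN; apply.
elim: n => [|n IH] nN sn.
  have -> : s = tt 0 by apply/eqP; rewrite eq_le sn /tt mul0r.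
  by rewrite big_ord0 subrr add0r oppr_le0.
rewrite big_ord_recr/=; have [sn'|sn'] := leP s (tt n).
  by have := IH (ltnW nN) sn'; rewrite mulr1 /c; lra.
rewrite mulr0 addr0; have : 0 <= \sum_(i < n) c i * (s <= tt i)%R%:R.
  by apply: sumr_ge0 => i _; rewrite mulr_ge0// c0// (ltn_trans _ nN).
have : f s <= f (tt n).
  by apply: fni; [case/andP: (tt01 (ltnW nN))|exact: ltW|rewrite (le_trans sn)//; case/andP: (tt01 nN)].
have := cm nN; rewrite /c; lra.
Qed.
End StepFunctions.

(** * From a completely monotone functional to a measure *)

Section Hausdorff.
Variables (R : realType) (L : {scalar {poly R}}).
Hypothesis HL : completely_monotone L.
Implicit Types (p : {poly R}) (t x : R).

Let L1 : 0 <= L 1. Proof. by have := HL 0 0; rewrite !expr0 mulr1. Qed.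

Let leL p q : (forall x, 0 <= x <= 1 -> p.[x] <= q.[x]) -> L p <= L q.
Proof.
move=> pq; rewrite -subr_ge0 -linearB; apply: completely_monotone_ge0 => // x x01.
by rewrite hornerD hornerN subr_ge0 pq.
Qed.

Let LC c : L c%:P = c * L 1.
Proof. by rewrite -[c%:P]mulr1 mul_polyC linearZ. Qed.

(** Polynomials that dominate the indicator of []-oo, t]] on the unit interval. The infimum of [L]
    over them is the only possible mass of that ray. *)
Definition majorants t : set {poly R} :=
  [set p | forall x, 0 <= x <= 1 -> 0 <= p.[x] /\ (x <= t -> 1 <= p.[x])].

Definition moment_cdf t : R := inf [set L p | p in majorants t].

Let has_inf_majorants t : has_inf [set L p | p in majorants t].
Proof.
split; first by exists (L 1), 1 => // x _; rewrite hornerC.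
exists 0 => _ [p pt <-]; apply: completely_monotone_ge0 => // x /pt[].
by [].
Qed.

Lemma moment_cdf_le t p : majorants t p -> moment_cdf t <= L p.
Proof. by move=> pt; apply: ge_inf; [case: (has_inf_majorants t)|exists p]. Qed.

Lemma moment_cdf_approx t e : 0 < e -> exists2 p, majorants t p & L p < moment_cdf t + e.
Proof.
by move=> e0; have [_ [p pt <-] pe] := inf_adherent e0 (has_inf_majorants t); exists p.
Qed.

Lemma moment_cdf_ge t c : (forall p, majorants t p -> c <= L p) -> c <= moment_cdf t.
Proof.
move=> H; apply: lb_le_inf; first by case: (has_inf_majorants t).
by move=> _ [p pt <-]; exact: H.
Qed.

Lemma moment_cdf_nd : {homo moment_cdf : s t / s <= t}.
Proof.
move=> s t st; apply: moment_cdf_ge => p pt; apply: moment_cdf_le => x /pt[p0 p1].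
by split=> // xs; apply: p1; exact: le_trans st.
Qed.

Lemma moment_cdf_lt0 t : t < 0 -> moment_cdf t = 0.
Proof.
move=> t0; apply/eqP; rewrite eq_le; apply/andP; split.
  rewrite -(linear0 L); apply: moment_cdf_le => x /andP[x0 _]; rewrite horner0.
  by split=> // xt; have := le_lt_trans (le_trans x0 xt) t0; rewrite ltxx.
apply: moment_cdf_ge => p pt; apply: completely_monotone_ge0 => // x /pt[].
by [].
Qed.

Lemma moment_cdf_ge1 t : 1 <= t -> moment_cdf t = L 1.
Proof.
move=> t1; apply/eqP; rewrite eq_le; apply/andP; split.
  by apply: moment_cdf_le => x _; rewrite hornerC.
apply: moment_cdf_ge => p pt; apply: leL => x x01; rewrite hornerC.
by have [_ ->] := pt x x01; case/andP: x01 => // _ /le_trans; apply.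
Qed.

(** For [t] in [[0, 1[], a nearly optimal majorant [p] at [t] satisfies [1 <= p.[t]], so by
    continuity [p + e'] is still a majorant slightly to the right of [t]. Outside that range the
    function is constant near [t] on the right. *)
Lemma moment_cdf_right t e : 0 < e -> exists2 d, 0 < d & moment_cdf (t + d) <= moment_cdf t + e.
Proof.
move=> e0; have [t0|t0] := ltP t 0.
  exists (- t / 2); first by rewrite divr_gt0// oppr_gt0.
  by rewrite !moment_cdf_lt0 ?add0r ?ltW//; lra.
have [t1|t1] := leP 1 t.
  by exists 1 => //; rewrite !moment_cdf_ge1//; lra.
have c0 : 0 < L 1 + 1 by rewrite ltr_wpDl.
pose e' := e / (L 1 + 1 + 1).
have c1 : 0 < L 1 + 1 + 1 by rewrite ltr_wpDl// ltW.
have e'0 : 0 < e' by rewrite divr_gt0.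
have [p pt Lp] := moment_cdf_approx t e'0.
have /cvgrPdist_lt /(_ _ e'0) [d /= d0 Hd] := @continuous_horner R p t.
exists (d / 2); first exact: divr_gt0.
apply: (@le_trans _ _ (L (p + e'%:P))); last first.
  rewrite linearD/= LC; have : e' * (L 1 + 1 + 1) = e by rewrite /e' divfK// gt_eqF.
  by nra.
apply: moment_cdf_le => x x01; have [p0 p1] := pt x x01.
rewrite !hornerE; split; first by rewrite addr_ge0// ltW.
move=> xtd; have [xt|tx] := leP x t; first by have := p1 xt; lra.
have : `|t - x| < d by rewrite ltr0_norm; lra.
move=> /Hd; have [_ /(_ (lexx t))] := pt t (ltac:(by rewrite t0 ltW)).
have := ler_norm (p.[t] - p.[x]); lra.
Qed.

Let cdf_rc : right_continuous moment_cdf.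
Proof.
move=> t; apply/cvgrPdist_le => e e0; have [d d0 Hd] := moment_cdf_right t e0.
near=> x.
have tx : t <= x by near: x; exact: nbhs_right_ge.
have xd : x <= t + d by near: x; apply: nbhs_right_le; rewrite ltrDl.
have := moment_cdf_nd tx; have := moment_cdf_nd xd => h1 h2.
by rewrite distrC ger0_norm; lra.
Unshelve. all: by end_near. Qed.

HB.instance Definition _ := isCumulative.Build R _ R moment_cdf moment_cdf_nd cdf_rc.

Let T := measurableTypeR R.

Let m11 : measurable (`]-1, 1]%classic : set T). Proof. exact: measurable_itv. Qed.

(** [moment_cdf] is constant to the left of [0] and to the right of [1]. Restricting to []-1, 1]]
    makes the total mass that of one half-open interval, and starting to the left of [0] keeps a
    possible atom there. *)
Definition moment_measure :=
  mrestr (lebesgue_stieltjes_measure moment_cdf) m11.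

HB.instance Definition _ := Measure.on moment_measure.

Lemma moment_measure_itv a b : -1 <= a -> a <= b -> b <= 1 ->
  moment_measure `]a, b]%classic = (moment_cdf b - moment_cdf a)%:E.
Proof.
move=> a1 ab b1; rewrite /moment_measure /mrestr.
have -> : `]a, b]%classic `&` `]-1, 1]%classic = `]a, b]%classic :> set T.
  apply/seteqP; split => x /=; rewrite !in_itv/=; first by case.
  by move=> /andP[ax xb]; rewrite ax xb (le_lt_trans a1 ax) (le_trans xb b1).
rewrite /lebesgue_stieltjes_measure/= /measure_extension/= measurable_mu_extE//; last exact: is_ocitv.
exact: wlength_itv_bnd.
Qed.

Lemma moment_measure_fin : (moment_measure setT < +oo)%E.
Proof.
have -> : moment_measure setT = moment_measure `]-1, 1]%classic.
  by rewrite /moment_measure /mrestr setTI setIid.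
by rewrite moment_measure_itv ?ltry//; lra.
Qed.

Let null_neg : moment_measure `]-1, 0[%classic = 0%E.
Proof.
rewrite itv_bnd_open_bigcup; apply: measure_negligible.
  by apply: bigcupT_measurable => n; exact: measurable_itv.
apply: negligible_bigcup => n; apply/negligibleP; first exact: measurable_itv.
have n0 : 0 < n.+1%:R^-1 :> R by rewrite invr_gt0.
have n1 : n.+1%:R^-1 <= 1 :> R by rewrite invf_le1// ler1n.
move: (n.+1%:R^-1) n0 n1 => v n0 n1.
rewrite [LHS](@moment_measure_itv (-1) (0 - v)); [|lra..].
by rewrite !moment_cdf_lt0 ?subrr//; lra.
Qed.

Lemma moment_measure_ray t : 0 <= t <= 1 ->
  integral01 moment_measure \1_(`]-oo, t]%classic : set T) = moment_cdf t.
Proof.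
move=> /andP[t0 t1]; rewrite integral01_indic//.
transitivity (fine (moment_cdf t)%:E) => //; congr fine.
have -> : moment_cdf t = moment_cdf t - moment_cdf (-1) by rewrite (@moment_cdf_lt0 (-1)) ?ltrN10// subr0.
rewrite -moment_measure_itv//; last exact: le_trans t0.
have -> : `]-1, t]%classic = `]-1, 0[%classic `|` (`]-oo, t]%classic `&` `[0, 1]%classic) :> set T.
  apply/seteqP; split => x /=; rewrite !in_itv/=.
    by move=> /andP[x1 xt]; have [x0|x0] := ltP x 0; [left; rewrite x1|right; rewrite xt (le_trans xt t1)].
  move=> [/andP[-> x0]|[xt /andP[x0 x1]]]; first by rewrite (le_trans (ltW x0) t0).
  by rewrite xt (lt_le_trans _ x0).
rewrite measureU//; last 2 first.
- exact: measurableI.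
- by apply/seteqP; split=> x //=; rewrite !in_itv/= => -[/andP[_ x0] [_ /andP[x0' _]]]; lra.
by move: null_neg => /= ->; rewrite add0e.
Qed.


Let finM := moment_measure_fin.

Let bray t : bounded_measurable (\1_(`]-oo, t]%classic : set T) : R -> R).
Proof. by apply: bounded_measurable_indic; exact: measurable_itv. Qed.

Lemma normrX_lipschitz k (x y : R) : 0 <= x <= 1 -> 0 <= y <= 1 ->
  `|x ^+ k - y ^+ k| <= k%:R * `|x - y|.
Proof.
move=> /andP[x0 x1] /andP[y0 y1]; rewrite subrXX normrM mulrC ler_wpM2r//.
apply: (le_trans (ler_norm_sum _ _ _)).
rewrite -[X in X%:R]card_ord -[leRHS]mulr_natr mul1r -sumr_const; apply: ler_sum => i _.
by rewrite ger0_norm ?mulr_ge0 ?exprn_ge0// mulr_ile1 ?exprn_ge0// exprn_ile1.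
Qed.

Lemma moment_measure_total : integral01 moment_measure (fun=> 1) = L 1.
Proof.
rewrite -(@moment_cdf_ge1 1)// -moment_measure_ray ?ler01 ?lexx//.
by apply: eq_integral01 => x /andP[_ x1]; rewrite indicE mem_set//=.
Qed.

Let steps (N : nat) (c : nat -> R) (t : nat -> R) : (forall i, (i < N)%N -> 0 <= t i <= 1) ->
  bounded_measurable (fun s => \sum_(i < N) c i * (s <= t i)%R%:R) /\
  integral01 moment_measure (fun s => \sum_(i < N) c i * (s <= t i)%R%:R) =
  \sum_(i < N) c i * moment_cdf (t i).
Proof.
move=> t01.
have e i : (fun s => c i * (s <= t i)%R%:R) =
    (fun s => c i * (\1_(`]-oo, t i]%classic : set T) : R -> R) s).
  by apply/funext => s; rewrite indicE mem_setE in_itv.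
have bi (i : 'I_N) : bounded_measurable (fun s => c i * (s <= t i)%R%:R).
  by rewrite e; exact: bounded_measurableZ.
have [b1 e1] := @integral01_sum R _ finM N (fun i s => c i * (s <= t i)%R%:R) bi.
split=> //; rewrite e1; apply: eq_bigr => i _.
by rewrite e integral01Z// moment_measure_ray// t01.
Qed.

(** The function [1 - x ^ k] decreases, so it lies between combinations of indicators of rays whose
    coefficients are nonnegative and sum to at most [1]. Integrals of these are sums of values of
    [moment_cdf], which are compared with [L] through majorants. *)
Lemma moment_measureX k : integral01 moment_measure (fun x => x ^+ k) = L 'X^k.
Proof.
pose f x : R := 1 - x ^+ k.
have bf : bounded_measurable f.
  rewrite (_ : f = horner (1 - 'X^k)); first exact: bounded_measurable_horner.
  by apply/funext => x; rewrite !hornerE.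
have bX := @bounded_measurableX R k.
have f1 : f 1 = 0 by rewrite /f expr1n subrr.
have fni x y : 0 <= x -> x <= y -> y <= 1 -> f y <= f x.
  by move=> x0 xy y1; rewrite lerD2l lerN2 lerXn2r// nnegrE (le_trans x0).
suff key : forall e, 0 < e -> `|integral01 moment_measure f - L (1 - 'X^k)| <= 3 * L 1 * e.
  have : integral01 moment_measure f = L (1 - 'X^k).
    apply/eqP; rewrite -subr_eq0 -normr_le0; apply: (@ler_addgt0_scaled _ (3 * L 1)).
      by rewrite mulr_ge0.
    by move=> e e0; rewrite add0r key.
  rewrite linearB/= -moment_measure_total.
  have -> : f = (fun x => (fun=> 1) x + -1 * x ^+ k) by apply/funext => x; rewrite mulN1r.
  rewrite integral01D ?integral01Z//; last 2 first.
  - exact: bounded_measurable_cst.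
  - exact: bounded_measurableZ.
  by rewrite mulN1r => /addrI/oppr_inj.
move=> e e0.
have k0 : 0 < k%:R + 1 :> R by rewrite ltr_wpDl.
have [N N0 Ne] := archi_inv_lt (divr_gt0 e0 k0).
have N0' : 0 < N%:R :> R by rewrite ltr0n.
pose t i : R := i%:R / N%:R; pose c i := f (t i) - f (t i.+1).
have t01 i : (i <= N)%N -> 0 <= t i <= 1.
  by move=> iN; rewrite divr_ge0//= ler_pdivrMr// mul1r ler_nat.
have cm i : (i < N)%N -> c i <= e.
  move=> iN; have -> : c i = t i.+1 ^+ k - t i ^+ k by rewrite /c /f; ring.
  apply: (le_trans (ler_norm _)); apply: (le_trans (normrX_lipschitz _ (t01 _ iN) (t01 _ (ltnW iN)))).
  rewrite /t -mulrBl -natr1 addrAC subrr add0r mul1r ger0_norm ?invr_ge0 ?ltW//.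
  move/ltW: Ne; rewrite ler_pdivlMr// => h; have : 0 <= N%:R^-1 :> R by rewrite invr_ge0 ltW.
  nra.
have c0 i : (i < N)%N -> 0 <= c i.
  move=> iN; rewrite subr_ge0; apply: fni; [by case/andP: (t01 _ (ltnW iN))| |by case/andP: (t01 _ iN)].
  by rewrite ler_pM2r ?invr_gt0// ler_nat.
have [bU eU] := @steps N c (fun i => t i.+1) (fun i iN => t01 _ iN).
have [bL eL] := @steps N c t (fun i iN => t01 _ (ltnW iN)).
have sc : \sum_(i < N) c i <= 1.
  have -> : \sum_(i < N) c i = f 0 - f 1.
    have -> : f 0 = f (t 0) by rewrite /t mul0r.
    have -> : f 1 = f (t N) by rewrite /t divff ?gt_eqF.
    elim: (N) => [|n IH]; first by rewrite big_ord0 subrr.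
    by rewrite big_ord_recr/= IH /c; ring.
  by rewrite f1 subr0 gerBl exprn_ge0.
have Jc d : integral01 moment_measure (fun x => f x + d) = integral01 moment_measure f + d * L 1.
  rewrite integral01D//; last exact: bounded_measurable_cst.
  have -> : (fun=> d) = (fun x : R => d * (fun=> 1) x) by apply/funext => x; rewrite mulr1.
  by rewrite integral01Z ?moment_measure_total//; exact: bounded_measurable_cst.
have bfc d : bounded_measurable (fun x => f x + d).
  by apply: bounded_measurableD => //; exact: bounded_measurable_cst.
have Le : L e%:P = e * L 1 by exact: LC.
have eL1 : 0 <= e * L 1 by rewrite mulr_ge0// ltW.
rewrite ler_norml; apply/andP; split.
- have : L (1 - 'X^k) <= integral01 moment_measure (fun s => \sum_(i < N) c i * (s <= t i.+1)%R%:R) + e * L 1.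
    (* [e'] is the slack of majorants chosen nearly optimal at each node; their combination
       dominates [1 - x ^ k]. *)
    rewrite eU; apply: (@ler_addgt0_scaled _ 1) => // e' e'0.
    have H i : exists2 p, majorants (t i.+1) p & L p < moment_cdf (t i.+1) + e'.
      exact: moment_cdf_approx.
    pose q i := sval (cid2 (H i)).
    have q1 i : majorants (t i.+1) (q i) by rewrite /q; case: (cid2 _).
    have q2 i : L (q i) < moment_cdf (t i.+1) + e' by rewrite /q; case: (cid2 _).
    apply: (@le_trans _ _ (L (\sum_(i < N) c i *: q i))).
      apply: leL => s s01; rewrite horner_sum hornerD hornerN hornerC hornerXn.
      have := step_upper_ge N0 fni s01; rewrite f1 subr0 => /le_trans; apply.
      apply: ler_sum => i _; rewrite hornerZ ler_wpM2l ?c0//.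
      have [h1 h2] := q1 i s s01.
      by case: (boolP (s <= t i.+1)%R) => [/h2|_].
    rewrite linear_sum/=.
    apply: (@le_trans _ _ (\sum_(i < N) (c i * moment_cdf (t i.+1) + c i * e'))).
      apply: ler_sum => i _; rewrite linearZ/= -mulrDr ler_wpM2l ?c0//; exact: ltW.
    rewrite big_split/= -mulr_suml.
    have : (\sum_(i < N) c i) * e' <= 1 * e' by rewrite ler_wpM2r// ltW.
    have : 0 <= e * L 1 by rewrite mulr_ge0// ltW.
    lra.
  have : integral01 moment_measure (fun s => \sum_(i < N) c i * (s <= t i.+1)%R%:R) <=
     integral01 moment_measure (fun x => f x + e).
    apply: le_integral01 => // s s01.
    by have := step_upper_le N0 fni cm s01; rewrite f1 subr0.
  rewrite Jc; lra.
- have : integral01 moment_measure (fun x => f x + - e) <=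
     integral01 moment_measure (fun s => \sum_(i < N) c i * (s <= t i)%R%:R).
    apply: le_integral01 => // s s01.
    by have := step_lower_ge N0 fni cm s01; rewrite f1 subr0.
  rewrite Jc eL.
  (* Here [L] has to be bounded below by [moment_cdf], so a majorant is needed that is not much
     larger than an indicator. The ramp of slope [- N] falls from [1] at [t i] to [0] at [t i.+1];
     it is approximated within [e / 2] and then raised by [e / 2]. *)
  have [q Hq] : exists q : nat -> {poly R}, forall i x, 0 <= x <= 1 ->
      (x <= t i)%R%:R <= (q i).[x] <= (x <= t i.+1)%R%:R + e.
    have H i : exists q : {poly R}, forall x, 0 <= x <= 1 ->
        (x <= t i)%R%:R <= q.[x] <= (x <= t i.+1)%R%:R + e.
      have e20 : 0 < e / 2 by rewrite divr_gt0.
      have [p Hp] := @ramp_approx R (t i) N _ e20.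
      exists (p + (e / 2)%:P) => x x01; rewrite !hornerE.
      have := Hp x x01; set r := Num.max _ _ => Hr.
      have r0 : 0 <= r by rewrite /r le_max lexx.
      have r1 : r <= 1 by have := clamp01_le1 (1 - N%:R * (x - t i)); rewrite -/r ger0_norm.
      have : (x <= t i)%R%:R <= r <= (x <= t i.+1)%R%:R.
        apply/andP; split.
          have [xt|_] := leP x (t i); last by [].
          rewrite /r clamp01_ge1//.
          by rewrite lerBrDl gerDr mulr_ge0_le0// subr_le0.
        have [xt|xt] := leP x (t i.+1); first by [].
        rewrite /r clamp01_le0//.
        rewrite subr_le0 mulrBr /t mulrCA divff ?gt_eqF// mulr1.
        move: xt; rewrite /t ltr_pdivrMr// -natr1; lra.
      by move: Hr; rewrite ler_norml; lra.
    by exists (fun i => sval (cid (H i))) => i; exact: (svalP (cid (H i))).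
  have : \sum_(i < N) c i * moment_cdf (t i) <= L (\sum_(i < N) c i *: q i).
    rewrite linear_sum; apply: ler_sum => i _; rewrite linearZ/= ler_wpM2l ?c0//.
    apply: moment_cdf_le => x x01; have /andP[h1 _] := Hq i x x01; split.
      by apply: le_trans h1.
    by move=> xt; move: h1; rewrite xt.
  have : L (\sum_(i < N) c i *: q i) <= L (1 - 'X^k + (2 * e)%:P).
    apply: leL => s s01; rewrite horner_sum !hornerE.
    apply: (@le_trans _ _ (\sum_(i < N) (c i * (s <= t i.+1)%R%:R + c i * e))).
      apply: ler_sum => i _; rewrite hornerZ -mulrDr ler_wpM2l ?c0//.
      by case/andP: (Hq i s s01).
    rewrite big_split/= -mulr_suml.
    have := step_upper_le N0 fni cm s01; rewrite f1 subr0 -/(t _) /f => h.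
    have : (\sum_(i < N) c i) * e <= 1 * e by rewrite ler_wpM2r// ltW.
    by move: h; rewrite -/c; lra.
  rewrite linearD/= LC; lra.
Qed.
End Hausdorff.

Lemma hausdorff_moment (R : realType) (L : {scalar {poly R}}) : completely_monotone L ->
  exists mu : {measure set (measurableTypeR R) -> \bar R},
    (mu setT < +oo)%E /\ forall k, integral01 mu (fun x => x ^+ k) = L 'X^k.
Proof.
move=> HL; pose mu := moment_measure HL.
exists mu; split; first exact: moment_measure_fin.
by move=> k; exact: moment_measureX.
Qed.

(** * The spectral theorem *)

Section SigmaFunctional.
Variable R : realType.
Implicit Types (F G : (R -> R) -> R) (h g : R -> R).

(** The properties of integration against a finite signed measure, which polarization makes
    necessary, without building such measures. *)
Definition sigma_functional F :=
  (forall c h g, bounded_measurable h -> bounded_measurable g ->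
    F (fun x => c * h x + g x) = c * F h + F g) /\
  (forall (h : nat -> R -> R) g C,
     (forall n, measurable_fun [set: measurableTypeR R] (h n)) ->
     (forall n x, 0 <= x <= 1 -> `|h n x| <= C) ->
     (forall x, 0 <= x <= 1 -> h ^~ x @ \oo --> g x) ->
     bounded_measurable g -> (fun n => F (h n)) @ \oo --> F g).

Lemma sigma_functional_integral01 (mu : {measure set (measurableTypeR R) -> \bar R}) :
  (mu setT < +oo)%E -> sigma_functional (integral01 mu).
Proof.
move=> fmu; split; last by move=> h g C *; exact: (integral01_cvg fmu (C := C)).
by move=> c h g bh bg; rewrite integral01D ?integral01Z//; exact: bounded_measurableZ.
Qed.

Lemma sigma_functional_lin c F G : sigma_functional F -> sigma_functional G ->
  sigma_functional (fun h => c * F h + G h).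
Proof.
move=> [lF cF] [lG cG]; split.
  by move=> a h g bh bg; rewrite lF// lG//; ring.
move=> h g C mh hC hg bg; apply: cvgD; last exact: (cG _ _ C).
by apply: cvgM; [exact: cvg_cst|exact: (cF _ _ C)].
Qed.

Lemma sigma_functional_weight F g : sigma_functional F -> bounded_measurable g ->
  sigma_functional (fun h => F (fun x => h x * g x)).
Proof.
move=> [lF cF] bg; split.
  move=> c h k bh bk; rewrite -lF; try exact: bounded_measurableM.
  by congr F; apply/funext => x; rewrite mulrDl mulrA.
have [mg [D HD]] := bg.
move=> h k C mh hC hk bk; apply: (cF (fun n x => h n x * g x) _ (C * D)).
- by move=> n; exact: measurable_funM.
- by move=> n x x01; rewrite normrM ler_pM ?hC ?HD.
- by move=> x x01; apply: cvgM; [exact: hk|exact: cvg_cst].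
- exact: bounded_measurableM.
Qed.

(** Reduces an identity between spectral forms to powers, where it becomes one about iterates of the
    operator; [bounded_class_indic] does the rest. *)
Lemma sigma_functional_eq F G : sigma_functional F -> sigma_functional G ->
  (forall k, F (fun x => x ^+ k) = G (fun x => x ^+ k)) ->
  forall B : set (measurableTypeR R), measurable B -> F \1_B = G \1_B.
Proof.
move=> [lF cF] [lG cG] FG; apply: (bounded_class_indic (V := fun h => F h = G h)) => //.
  by move=> c h g bh bg Fh Fg; rewrite lF// lG// Fh Fg.
move=> h g C mh hC hg bg Fh; have := cF h g C mh hC hg bg; have := cG h g C mh hC hg bg.
rewrite (_ : (fun n => F (h n)) = (fun n => G (h n))); last exact/funext.
by move=> h1 h2; apply: (cvg_unique _ h2 h1); exact: norm_hausdorff.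
Qed.

End SigmaFunctional.

Section CauchySchwarz.
Variables (R : realFieldType) (V : lmodType R) (b : V -> V -> R).
Hypothesis bC : forall x y, b x y = b y x.
Hypothesis blin : forall c x y z, b (c *: x + y) z = c * b x z + b y z.
Hypothesis b0 : forall x, 0 <= b x x.

(** The form is only semidefinite, so [b x x = 0] is a separate case: then an affine function of [t]
    is nonnegative everywhere, which forces its slope [2 * b x y] to vanish. *)
Lemma cauchy_schwarz x y : b x y ^+ 2 <= b x x * b y y.
Proof.
have E t : 0 <= t ^+ 2 * b x x + 2 * t * b x y + b y y.
  have := b0 (t *: x + y); rewrite blin (bC x (_ + _)) (bC y (_ + _)) !blin (bC y x).
  by congr (_ <= _); ring.
have [x0|xn0] := eqVneq (b x x) 0; last first.
  have xp : 0 < b x x by rewrite lt_def xn0 b0.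
  have := mulr_ge0 (ltW xp) (E (- b x y / b x x)).
  suff -> : b x x * ((- b x y / b x x) ^+ 2 * b x x + 2 * (- b x y / b x x) * b x y + b y y) =
      b x x * b y y - b x y ^+ 2 by rewrite subr_ge0.
  by field; rewrite xn0.
rewrite x0 mul0r; have [->|yn0] := eqVneq (b x y) 0; first by rewrite expr0n.
(* At this [t] the affine function takes the value [-1]. *)
have := E (- (b y y + 1) / (2 * b x y)); rewrite x0 mulr0 add0r.
have -> : 2 * (- (b y y + 1) / (2 * b x y)) * b x y = - (b y y + 1).
  by field; exact: yn0.
by move=> ?; exfalso; lra.
Qed.
End CauchySchwarz.

(** * Spectral projections of a symmetric operator between 0 and 1 *)

Section SpectralTheorem.
Variables (R : realType) (V : lmodType R) (dot : V -> V -> R) (A : V -> V).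
Implicit Types (x y z : V) (p : {poly R}) (h g : R -> R) (B C : set (measurableTypeR R)).
Hypothesis dotC : forall x y, dot x y = dot y x.
Hypothesis dot_lin : forall c x y z, dot (c *: x + y) z = c * dot x z + dot y z.
Hypothesis dot_ge0 : forall x, 0 <= dot x x.
Hypothesis dot_eq0 : forall x, dot x x = 0 -> x = 0.
Hypothesis riesz : forall f : V -> R,
  (forall c x y, f (c *: x + y) = c * f x + f y) ->
  (exists D, forall x, f x ^+ 2 <= D * dot x x) -> exists u, forall x, dot u x = f x.
Hypothesis A_lin : forall c x y, A (c *: x + y) = c *: A x + A y.
Hypothesis A_sym : forall x y, dot (A x) y = dot x (A y).
Hypothesis A_ge0 : forall x, 0 <= dot (A x) x.
Hypothesis A_le1 : forall x, dot (A x) x <= dot x x.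

Let dotD x y z : dot (x + y) z = dot x z + dot y z.
Proof. by rewrite -[x]scale1r dot_lin mul1r scale1r. Qed.

Let dot0 z : dot 0 z = 0.
Proof. by have := dotD 0 0 z; rewrite addr0 => /eqP; rewrite -subr_eq0 opprD addNKr oppr_eq0 => /eqP. Qed.

Let dotZ c x z : dot (c *: x) z = c * dot x z.
Proof. by rewrite -[c *: x]addr0 dot_lin dot0 addr0. Qed.

Let dotN x z : dot (- x) z = - dot x z.
Proof. by rewrite -scaleN1r dotZ mulN1r. Qed.

Let dotrD x y z : dot z (x + y) = dot z x + dot z y.
Proof. by rewrite dotC dotD !(dotC z). Qed.

Let dotrZ c x z : dot z (c *: x) = c * dot z x.
Proof. by rewrite dotC dotZ (dotC z). Qed.

Let dotrN x z : dot z (- x) = - dot z x.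
Proof. by rewrite dotC dotN (dotC z). Qed.

Let dot_ext x y : (forall z, dot x z = dot y z) -> x = y.
Proof.
move=> H; apply/eqP; rewrite -subr_eq0; apply/eqP/dot_eq0.
by rewrite dotD dotN H subrr.
Qed.

Let AB x : V := x - A x.

Let iterA_lin n c x y : iter n A (c *: x + y) = c *: iter n A x + iter n A y.
Proof. by elim: n => // n IH; rewrite !iterS IH A_lin. Qed.

Let iterA_sym n x y : dot (iter n A x) y = dot x (iter n A y).
Proof. by elim: n x y => // n IH x y; rewrite iterSr IH A_sym -iterS. Qed.

Let ABA x : AB (A x) = A (AB x).
Proof. by apply: dot_ext => z; rewrite /AB (A_sym (x - A x)) !(dotD, dotN) !A_sym. Qed.

Let AB_sym x y : dot (AB x) y = dot x (AB y).
Proof. by rewrite /AB dotD dotN A_sym dotrD dotrN. Qed.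

Let iterAB l x : iter l AB (A x) = A (iter l AB x).
Proof. by elim: l => // l IH; rewrite !iterS IH ABA. Qed.

(** Symmetry moves one of two factors [A], or one of two factors [1 - A], to the other side of the
    product, which lowers an exponent by two. There remain exponents at most [1]. *)
Lemma iter_complement_ge0 k l x : 0 <= dot (iter k A (iter l AB x)) x.
Proof.
have [n nkl] := ubnP (k + l); elim: n k l x nkl => // n IH k l x nkl.
have [k2|k2] := leqP 2 k.
  case: k k2 nkl => [|[|k]]// _ nkl.
  by rewrite iterS A_sym iterSr -!iterAB; apply: IH; lia.
have [l2|l2] := leqP 2 l.
  case: l l2 nkl => [|[|l]]// _ nkl.
  rewrite iterS iterSr.
  have -> : iter k A (AB (iter l AB (AB x))) = AB (iter k A (iter l AB (AB x))).
    by elim: (k) => // m IHm; rewrite !iterS IHm ABA.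
  by rewrite AB_sym; apply: IH; lia.
case: k k2 {nkl} => [|[|]]// _; case: l l2 => [|[|]]// _ /=.
- by rewrite /AB dotD dotN subr_ge0.
(* [A (1 - A) = (1 - A) A (1 - A) + A (1 - A) A] *)
have -> : dot (A (AB x)) x = dot (A (AB x)) (AB x) + dot (AB (A x)) (A x).
  by rewrite ABA -dotrD subrK.
by rewrite addr_ge0// /AB dotD dotN subr_ge0.
Qed.

Definition moment_form x y p : R := \sum_(i < size p) p`_i * dot (iter i A x) y.

Let moment_formE n x y p : (size p <= n)%N ->
  moment_form x y p = \sum_(i < n) p`_i * dot (iter i A x) y.
Proof.
move=> pn; rewrite /moment_form (big_ord_widen n (fun i => p`_i * dot (iter i A x) y))//.
rewrite big_mkcond; apply: eq_bigr => i _; case: ifP => // /negbT; rewrite -leqNgt => pi.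
by rewrite nth_default// mul0r.
Qed.

Let moment_form_linear x y : linear_for *%R (moment_form x y).
Proof.
move=> c p q; have sn := size_polyD (c *: p) q.
pose n := maxn (size p) (size q).
rewrite (@moment_formE n) ?(@moment_formE n _ _ p) ?(@moment_formE n _ _ q) ?leq_maxl ?leq_maxr//.
  rewrite mulr_sumr -big_split/=; apply: eq_bigr => i _.
  by rewrite coefD coefZ mulrDl mulrA.
apply: (leq_trans sn); rewrite geq_max leq_maxr andbT.
by apply: (leq_trans (size_scale_leq _ _)); exact: leq_maxl.
Qed.

HB.instance Definition _ x y :=
  GRing.isLinear.Build R {poly R} R *%R (moment_form x y) (moment_form_linear x y).

Lemma moment_formX k x y : moment_form x y 'X^k = dot (iter k A x) y.
Proof.
rewrite (@moment_formE k.+1) ?size_polyXn// big_ord_recr/= coefXn eqxx mul1r.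
by rewrite big1 ?add0r// => i _; rewrite coefXn ltn_eqF// mul0r.
Qed.

Let moment_form_mulX x y p : moment_form x y ('X * p) = moment_form (A x) y p.
Proof.
rewrite (@moment_formE (size p).+1); last first.
  by rewrite (leq_trans (size_polyMleq _ _))// size_polyX.
rewrite big_ord_recl/= coefXM mul0r add0r; apply: eq_bigr => i _.
by rewrite coefXM/= -iterS iterSr.
Qed.

Let moment_form_AB x y p : moment_form (AB x) y p = moment_form x y ((1 - 'X) * p).
Proof.
rewrite mulrBl mul1r linearB/= moment_form_mulX /moment_form -sumrB.
apply: eq_bigr => i _; rewrite -mulrBr -dotN -dotD; congr (_ * dot _ _).
by rewrite /AB addrC -scaleN1r iterA_lin scaleN1r addrC.
Qed.

Lemma moment_form_monotone x : completely_monotone (moment_form x x).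
Proof.
suff E k l y : moment_form y x ('X^k * (1 - 'X) ^+ l) = dot (iter k A (iter l AB y)) x.
  by move=> k l; have := iter_complement_ge0 k l x; rewrite -E.
elim: l y => [|l IH] y; first by rewrite expr0 mulr1 moment_formX.
by rewrite exprS mulrCA -moment_form_AB IH [in RHS]iterSr.
Qed.

Definition spectral_mu x := projT1 (cid (hausdorff_moment (moment_form_monotone x))).

Lemma spectral_mu_fin x : (spectral_mu x setT < +oo)%E.
Proof. by rewrite /spectral_mu; case: cid => mu []. Qed.

Lemma spectral_muX x k : integral01 (spectral_mu x) (fun s => s ^+ k) = dot (iter k A x) x.
Proof. by rewrite -moment_formX /spectral_mu; case: cid => mu []. Qed.

(** Polarization of the quadratic form [x |-> spectral_mu x]; over the reals two terms suffice. *)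
Definition mixed x y h : R :=
  4^-1 * integral01 (spectral_mu (x + y)) h + - 4^-1 * integral01 (spectral_mu (x - y)) h.

Let sigma_mu x : sigma_functional (integral01 (spectral_mu x)).
Proof. exact/sigma_functional_integral01/spectral_mu_fin. Qed.

Let sigma_zero : sigma_functional (fun=> 0 : R).
Proof. by split=> [c h g _ _|h g C *]; [rewrite mulr0 addr0|exact: cvg_cst]. Qed.

Lemma sigma_mixed x y : sigma_functional (mixed x y).
Proof.
apply: sigma_functional_lin => //.
have := sigma_functional_lin (- 4^-1) (sigma_mu (x - y)) sigma_zero.
by congr sigma_functional; apply/funext => h; rewrite addr0.
Qed.

Lemma mixedX x y k : mixed x y (fun s => s ^+ k) = dot (iter k A x) y.
Proof.
rewrite /mixed !spectral_muX -[x in x + y]scale1r -[x - y]addrC -(scaleN1r y) !iterA_lin.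
rewrite -[y in dot _ (_ + y)]scale1r.
rewrite !dotD !dotZ !dotrD !dotrZ (dotC (iter k A y) x) -iterA_sym; by field.
Qed.

Definition spectral_form B x y := mixed x y \1_B.

Section Fixed.
Variable B : set (measurableTypeR R).
Hypothesis mB : measurable B.

Lemma spectral_formC x y : spectral_form B x y = spectral_form B y x.
Proof.
apply: sigma_functional_eq => //; try exact: sigma_mixed.
by move=> k; rewrite !mixedX iterA_sym dotC.
Qed.

Lemma spectral_form_lin c x y z :
  spectral_form B (c *: x + y) z = c * spectral_form B x z + spectral_form B y z.
Proof.
apply: (@sigma_functional_eq _ (mixed (c *: x + y) z) (fun h => c * mixed x z h + mixed y z h)) => //.
- exact: sigma_mixed.
- by apply: sigma_functional_lin; exact: sigma_mixed.
- by move=> k; rewrite !mixedX iterA_lin dotD dotZ.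
Qed.

Lemma spectral_form_diag x : spectral_form B x x = integral01 (spectral_mu x) \1_B.
Proof.
apply: sigma_functional_eq => //; first exact: sigma_mixed.
by move=> k; rewrite mixedX spectral_muX.
Qed.

Lemma spectral_form_ge0 x : 0 <= spectral_form B x x.
Proof. by rewrite spectral_form_diag integral01_indic// fine_ge0. Qed.

Lemma spectral_form_le x : spectral_form B x x <= dot x x.
Proof.
rewrite spectral_form_diag -(spectral_muX x 0).
apply: (le_integral01 (spectral_mu_fin x)).
- exact: bounded_measurable_indic.
- exact: bounded_measurable_cst.
- by move=> s _; rewrite indicE expr0; case: (_ \in _).
Qed.

Lemma spectral_form_bounded x y : spectral_form B x y ^+ 2 <= dot x x * dot y y.
Proof.
apply: (le_trans (cauchy_schwarz spectral_formC spectral_form_lin spectral_form_ge0 x y)).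
by rewrite ler_pM ?spectral_form_ge0 ?spectral_form_le.
Qed.

Lemma spectral_form_riesz x : exists u, forall y, dot u y = spectral_form B x y.
Proof.
apply: riesz.
  by move=> c y z; rewrite spectral_formC spectral_form_lin !(spectral_formC x).
by exists (dot x x) => y; exact: spectral_form_bounded.
Qed.

(** With [\1_B] replaced by a variable function, both sides are sigma functionals, and their moments
    are [dot (iter (k + m) A x) y]. *)
Lemma spectral_form_iter x y k :
  spectral_form B x (iter k A y) = mixed x y (fun s => s ^+ k * \1_B s).
Proof.
rewrite (_ : (fun s => _) = (fun s => \1_B s * s ^+ k)); last first.
  by apply/funext => s; rewrite mulrC.
have bX := @bounded_measurableX R k.
apply: (@sigma_functional_eq _ (mixed x (iter k A y)) (fun h => mixed x y (fun s => h s * s ^+ k))) => //.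
- exact: sigma_mixed.
- by apply: sigma_functional_weight => //; exact: sigma_mixed.
move=> m; rewrite mixedX -iterA_sym -iterD.
rewrite (_ : (fun s => _) = (fun s => s ^+ (k + m))) ?mixedX//.
by apply/funext => s; rewrite mulrC exprD.
Qed.

End Fixed.

(* junk [0] when [B] is not measurable *)
Definition spectral_proj B x : V :=
  if pselect (measurable B) is left mB then projT1 (cid (spectral_form_riesz mB x)) else 0.

Lemma spectral_projE B x y : measurable B -> dot (spectral_proj B x) y = spectral_form B x y.
Proof.
by move=> mB; rewrite /spectral_proj; case: pselect => // mB'; case: cid => u /= ->.
Qed.

Lemma spectral_proj_diag B x : measurable B ->
  dot (spectral_proj B x) x = integral01 (spectral_mu x) \1_B.
Proof. by move=> mB; rewrite spectral_projE// spectral_form_diag. Qed.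

Lemma spectral_proj_lin B c x y :
  measurable B -> spectral_proj B (c *: x + y) = c *: spectral_proj B x + spectral_proj B y.
Proof.
move=> mB; apply: dot_ext => z.
by rewrite dot_lin !spectral_projE// spectral_form_lin.
Qed.

Lemma spectral_proj_sym B x y : measurable B ->
  dot (spectral_proj B x) y = dot x (spectral_proj B y).
Proof. by move=> mB; rewrite spectral_projE// (dotC x) spectral_projE// spectral_formC. Qed.

(** With [C] fixed both sides are sigma functionals in the indicator of [B]; [spectral_form_iter]
    for [C] identifies their moments. *)
Lemma spectral_projI B C x : measurable B -> measurable C ->
  spectral_proj (B `&` C) x = spectral_proj B (spectral_proj C x).
Proof.
move=> mB mC; have mBC : measurable (B `&` C) by exact: measurableI.
apply: dot_ext => y; rewrite !spectral_projE// /spectral_form.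
rewrite (_ : \1_(B `&` C) = fun s => \1_B s * \1_C s); last first.
  by apply/funext => s; rewrite -[RHS]/((\1_B \* \1_C) s) -indicI.
apply: (@sigma_functional_eq _ (fun h => mixed x y (fun s => h s * \1_C s))) => //.
- by apply: sigma_functional_weight; [exact: sigma_mixed|exact: bounded_measurable_indic].
- exact: sigma_mixed.
by move=> k; rewrite mixedX -spectral_form_iter// iterA_sym spectral_projE.
Qed.

Lemma spectral_proj_full B x : measurable B -> `[0, 1]%classic `<=` B -> spectral_proj B x = x.
Proof.
move=> mB IB; apply: dot_ext => y; rewrite spectral_projE//.
rewrite -[x in RHS]/(iter 0 A x) -mixedX /spectral_form /mixed.
by congr (_ * _ + _ * _); apply: eq_integral01 => s s01;
  rewrite indicE mem_set//; apply: IB; rewrite /= in_itv.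
Qed.

Lemma spectral_proj0 x : spectral_proj set0 x = 0.
Proof.
apply: dot_ext => y; rewrite spectral_projE// dot0 /spectral_form.
by rewrite /mixed indic0 /integral01 !Rintegral_cst// !mul0r !mulr0 addr0.
Qed.

(** The functions [s] and [l] agree on the point [l]. This turns an atom of a spectral measure into
    an eigenvector. *)
Lemma spectral_proj_eigen l x : A (spectral_proj [set l] x) = l *: spectral_proj [set l] x.
Proof.
have ml : measurable ([set l] : set (measurableTypeR R)) by exact: measurable_set1.
apply: dot_ext => y; rewrite A_sym dotZ !spectral_projE//.
rewrite -[A y]/(iter 1 A y) spectral_form_iter//.
have [lin _] := sigma_mixed x y; rewrite -[RHS]addr0.
have z : mixed x y (fun=> 0) = 0 by rewrite /mixed /integral01 !Rintegral_cst// !mul0r !mulr0 addr0.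
rewrite -z -lin//; last 2 first.
- exact: bounded_measurable_indic.
- exact: bounded_measurable_cst.
congr mixed; apply/funext => s; rewrite addr0 expr1 indicE.
have [|] := boolP (s \in [set l]); last by rewrite !mulr0.
by rewrite inE/= => ->.
Qed.

End SpectralTheorem.

(** * Unconditional sums and square summable functions *)

Section RealSums.
Variables (R : realType) (T : choiceType).
Implicit Types (f g h : T -> R) (t : T) (s : seq T).

Local Notation esumR f := (\esum_(t in [set: T]) (f t)%:E).

Definition abs_summable f : Prop := (esumR (fun t => `|f t|) < +oo)%E.

Lemma esumR_ge0 f : (forall t, 0 <= f t) -> (0 <= esumR f)%E.
Proof. by move=> f0; apply: esum_ge0 => t _; rewrite lee_fin. Qed.

Lemma esumR_fineK f : (forall t, 0 <= f t) -> (esumR f < +oo)%E ->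
  (fine (esumR f))%:E = esumR f.
Proof. by move=> f0 foo; rewrite fineK// ge0_fin_numE// esumR_ge0. Qed.

Lemma le_esumR f g : (forall t, f t <= g t) -> (esumR f <= esumR g)%E.
Proof. by move=> fg; apply: le_esum => t _; rewrite lee_fin. Qed.

Lemma esumRD f g : (forall t, 0 <= f t) -> (forall t, 0 <= g t) ->
  esumR (fun t => f t + g t) = (esumR f + esumR g)%E.
Proof.
move=> f0 g0; rewrite -esumD; try by move=> t _; rewrite lee_fin.
by apply: eq_esum => t _; rewrite EFinD.
Qed.

Lemma esumRZ_le (c : R) f : 0 <= c -> (forall t, 0 <= f t) ->
  (esumR (fun t => (c * f t)) <= c%:E * esumR f)%E.
Proof.
move=> c0 f0; apply: ge_ereal_sup => /= _ [X [finX _] <-].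
rewrite (_ : (fun t => (c * f t)%:E) = (fun t => c%:E * (f t)%:E)%E); last first.
  by apply/funext => t; rewrite EFinM.
rewrite -ge0_mule_fsumr; last by move=> t; rewrite lee_fin.
apply: lee_wpmul2l; first by rewrite lee_fin.
by apply: ereal_sup_ubound; exists X.
Qed.

Lemma esumRZ (c : R) f : 0 <= c -> (forall t, 0 <= f t) ->
  esumR (fun t => (c * f t)) = (c%:E * esumR f)%E.
Proof.
move=> c0 f0; apply/eqP; rewrite eq_le esumRZ_le//=.
have [->|cn0] := eqVneq c 0.
  by rewrite mul0e esumR_ge0// => t; rewrite mul0r.
have cp : 0 < c by rewrite lt_def cn0.
rewrite -lee_pdivlMl//.
have -> : esumR f = esumR (fun t => c^-1 * (c * f t)).
  by apply: eq_esum => t _; rewrite mulKf.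
by apply: esumRZ_le => [|t]; rewrite ?invr_ge0// mulr_ge0.
Qed.

Lemma abs_summable_le f g : (forall t, `|f t| <= g t) -> (esumR g < +oo)%E -> abs_summable f.
Proof. by move=> fg; apply: le_lt_trans; exact: le_esumR. Qed.

Lemma abs_summable_lin (c : R) f g : abs_summable f -> abs_summable g ->
  abs_summable (fun t => c * f t + g t).
Proof.
move=> sf sg; apply: (@abs_summable_le _ (fun t => `|c| * `|f t| + `|g t|)).
  by move=> t; rewrite -normrM; exact: ler_normD.
rewrite (esumRD (f := fun t => `|c| * `|f t|))//.
by rewrite (esumRZ (f := fun t => `|f t|))// lte_add_pinfty// lte_mul_pinfty// lee_fin.
Qed.

(** With [p] and [n] the positive and negative parts of [f - g] one has [p + g = n + f], so every
    decomposition into summable nonnegative parts gives the same value. Linearity of [rsum] thus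
    reduces to nonnegative sums. *)
Lemma rsumB f g : (forall t, 0 <= f t) -> (forall t, 0 <= g t) ->
  (esumR f < +oo)%E -> (esumR g < +oo)%E ->
  rsum (fun t => f t - g t) = fine (esumR f) - fine (esumR g).
Proof.
move=> f0 g0 foo goo; rewrite /rsum.
set p := fun t => Num.max (f t - g t) 0; set n := fun t => Num.max (- (f t - g t)) 0.
have p0 t : 0 <= p t by rewrite le_max lexx orbT.
have n0 t : 0 <= n t by rewrite le_max lexx orbT.
have poo : (esumR p < +oo)%E.
  apply: le_lt_trans foo; apply: le_esumR => t; rewrite ge_max f0 andbT.
  by rewrite gerBl.
have noo : (esumR n < +oo)%E.
  apply: le_lt_trans goo; apply: le_esumR => t; rewrite ge_max g0 andbT.
  by rewrite opprB gerBl.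
have : (esumR p + esumR g = esumR n + esumR f)%E.
  rewrite -!esumRD//; apply: eq_esum => t _; congr EFin.
  by rewrite /p /n; have [h|h] := leP (f t - g t) 0; have [h'|h'] := leP (- (f t - g t)) 0; lra.
rewrite -(esumR_fineK p0 poo) -(esumR_fineK g0 goo) -(esumR_fineK n0 noo) -(esumR_fineK f0 foo).
by rewrite -!EFinD => -[]; rewrite /=; lra.
Qed.

Lemma rsum_ge0E f : (forall t, 0 <= f t) -> (esumR f < +oo)%E -> rsum f = fine (esumR f).
Proof.
move=> f0 foo; have := @rsumB f (fun=> 0) f0 (fun=> lexx _) foo.
rewrite (_ : (fun t => f t - 0) = f); last by apply/funext => t; rewrite subr0.
by rewrite esum1// => ->//; rewrite ?subr0.
Qed.

Let pos_part f t : R := Num.max (f t) 0.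
Let neg_part f t : R := Num.max (- f t) 0.

Let pos0 f t : 0 <= pos_part f t. Proof. by rewrite le_max lexx orbT. Qed.
Let neg0 f t : 0 <= neg_part f t. Proof. by rewrite le_max lexx orbT. Qed.

Let pos_negE f t : f t = pos_part f t - neg_part f t.
Proof. by rewrite /pos_part/neg_part; have [h|h] := leP (f t) 0; have [h'|h'] := leP (- f t) 0; lra. Qed.

Let pos_fin f : abs_summable f -> (esumR (pos_part f) < +oo)%E.
Proof. by apply: le_lt_trans; apply: le_esumR => t; rewrite ge_max ler_norm normr_ge0. Qed.
Let neg_fin f : abs_summable f -> (esumR (neg_part f) < +oo)%E.
Proof. by apply: le_lt_trans; apply: le_esumR => t; rewrite ge_max -normrN ler_norm normr_ge0. Qed.

Let fineZ (c : R) f : 0 <= c -> (forall t, 0 <= f t) -> fine (esumR (fun t => c * f t)) = c * fine (esumR f).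
Proof.
move=> c0 f0; rewrite esumRZ//; case: (esumR f) (esumR_ge0 f0) => [r _|_|//]//=.
have [->|cn0] := eqVneq c 0; first by rewrite mul0e mulr0.
by rewrite gt0_muley/= ?mulr0// lte_fin lt_def cn0.
Qed.

Let finD f g : (forall t, 0 <= f t) -> (forall t, 0 <= g t) ->
  (esumR f < +oo)%E -> (esumR g < +oo)%E ->
  (esumR (fun t => (f t + g t)%R) < +oo)%E /\
  fine (esumR (fun t => (f t + g t)%R)) = fine (esumR f) + fine (esumR g).
Proof.
move=> f0 g0 foo goo; rewrite esumRD//; split; first exact: lte_add_pinfty.
by rewrite fineD// ge0_fin_numE// esumR_ge0.
Qed.

Lemma rsum_lin (c : R) f g : abs_summable f -> abs_summable g ->
  rsum (fun t => c * f t + g t) = c * rsum f + rsum g.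
Proof.
move=> sf sg.
have E k : abs_summable k -> rsum k = fine (esumR (pos_part k)) - fine (esumR (neg_part k)) by [].
have Z k (a : R) : 0 <= a -> (forall t, 0 <= k t) -> (esumR k < +oo)%E -> (esumR (fun t => (a * k t)%R) < +oo)%E.
  by move=> a0 k0 koo; rewrite esumRZ// lte_mul_pinfty// lee_fin.
rewrite (E f)// (E g)//; have [c0|c0] := leP 0 c.
  rewrite (_ : (fun t => _) = (fun t => (c * pos_part f t + pos_part g t) -
     (c * neg_part f t + neg_part g t))); last first.
    by apply/funext => t; rewrite [in LHS](pos_negE f) [in LHS](pos_negE g); ring.
  have cp t : 0 <= c * pos_part f t by rewrite mulr_ge0.
  have cn t : 0 <= c * neg_part f t by rewrite mulr_ge0.
  have [F1 E1] := finD cp (pos0 g) (Z _ _ c0 (pos0 f) (pos_fin sf)) (pos_fin sg).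
  have [F2 E2] := finD cn (neg0 g) (Z _ _ c0 (neg0 f) (neg_fin sf)) (neg_fin sg).
  rewrite rsumB//; try by move=> t; rewrite addr_ge0.
  by rewrite E1 E2 (fineZ c0 (pos0 f)) (fineZ c0 (neg0 f)); ring.
have c0' : 0 <= - c by rewrite oppr_ge0 ltW.
rewrite (_ : (fun t => _) = (fun t => (- c * neg_part f t + pos_part g t) -
   (- c * pos_part f t + neg_part g t))); last first.
  by apply/funext => t; rewrite [in LHS](pos_negE f) [in LHS](pos_negE g); ring.
have cp t : 0 <= - c * pos_part f t by rewrite mulr_ge0.
have cn t : 0 <= - c * neg_part f t by rewrite mulr_ge0.
have [F1 E1] := finD cn (pos0 g) (Z _ _ c0' (neg0 f) (neg_fin sf)) (pos_fin sg).
have [F2 E2] := finD cp (neg0 g) (Z _ _ c0' (pos0 f) (pos_fin sf)) (neg_fin sg).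
rewrite rsumB//; try by move=> t; rewrite addr_ge0.
by rewrite E1 E2 (fineZ c0' (pos0 f)) (fineZ c0' (neg0 f)); ring.
Qed.

Lemma abs_summable0 : abs_summable (fun=> 0).
Proof. by rewrite /abs_summable esum1// => t _; rewrite normr0. Qed.

Lemma rsum0 : rsum (fun _ : T => 0 : R) = 0.
Proof. by rewrite /rsum !esum1 ?subr0// => t _; rewrite ?oppr0 maxxx. Qed.

Lemma abs_summableD f g : abs_summable f -> abs_summable g -> abs_summable (fun t => f t + g t).
Proof.
by move=> sf sg; have := abs_summable_lin 1 sf sg; congr abs_summable; apply/funext => t; rewrite mul1r.
Qed.

Lemma abs_summableZ c f : abs_summable f -> abs_summable (fun t => c * f t).
Proof.
move=> sf; have := abs_summable_lin c sf abs_summable0.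
by congr abs_summable; apply/funext => t; rewrite addr0.
Qed.

Lemma rsumD f g : abs_summable f -> abs_summable g -> rsum (fun t => f t + g t) = rsum f + rsum g.
Proof.
move=> sf sg; rewrite -[rsum f]mul1r -rsum_lin//; congr rsum.
by apply/funext => t; rewrite mul1r.
Qed.

Lemma rsumZ c f : abs_summable f -> rsum (fun t => c * f t) = c * rsum f.
Proof.
move=> sf; rewrite -[RHS]addr0 -rsum0 -rsum_lin//; last exact: abs_summable0.
by congr rsum; apply/funext => t; rewrite addr0.
Qed.

Lemma rsum_ge0 f : (forall t, 0 <= f t) -> abs_summable f -> 0 <= rsum f.
Proof.
move=> f0 sf; rewrite rsum_ge0E//; first by rewrite fine_ge0// esumR_ge0.
by move: sf; congr (_ < _)%E; apply: eq_esum => t _; rewrite ger0_norm.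
Qed.

Lemma le_rsum f g : abs_summable f -> abs_summable g -> (forall t, f t <= g t) -> rsum f <= rsum g.
Proof.
move=> sf sg fg; rewrite -subr_ge0 addrC -mulN1r -rsum_lin//.
apply: rsum_ge0; last exact: abs_summable_lin.
by move=> t; rewrite mulN1r addrC subr_ge0.
Qed.

Lemma ler_norm_rsum f g : (forall t, `|f t| <= g t) -> abs_summable g -> `|rsum f| <= rsum g.
Proof.
move=> fg sg.
have sf : abs_summable f.
  apply: (abs_summable_le fg); move: sg; congr (_ < _)%E; apply: eq_esum => t _.
  by rewrite ger0_norm// (le_trans _ (fg t)).
rewrite ler_norml; apply/andP; split; last first.
  by apply: le_rsum => // t; rewrite (le_trans (ler_norm _)).
rewrite -mulN1r -rsumZ//; apply: le_rsum => //; first exact: abs_summableZ.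
by move=> t; rewrite mulN1r lerNl (le_trans _ (fg t))// -normrN ler_norm.
Qed.

Lemma rsum_seq s h : uniq s ->
  abs_summable (fun t => if t \in s then h t else 0) /\
  rsum (fun t => if t \in s then h t else 0) = \sum_(t <- s) h t.
Proof.
have single u (c : R) : abs_summable (fun t => if t == u then c else 0) /\
    rsum (fun t => if t == u then c else 0) = c.
  have E (a : R) : 0 <= a -> esumR (fun t => if t == u then a else 0) = a%:E.
    move=> a0; rewrite -(@esum_set1 R T u (fun=> a%:E)) ?lee_fin// [RHS]esum_mkcond.
    apply: eq_esum => t _; have [->|tu] := eqVneq t u; first by rewrite mem_set.
    by rewrite memNset//= => /eqP; rewrite (negbTE tu).
  have sc (a : R) : abs_summable (fun t => if t == u then a else 0).
    rewrite /abs_summable.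
    have -> : esumR (fun t => `|if t == u then a else 0|) = `|a|%:E; last exact: ltry.
    by rewrite -E//; apply: eq_esum => t _; case: ifP; rewrite ?normr0.
  have r0 (a : R) : 0 <= a -> rsum (fun t => if t == u then a else 0) = a.
    move=> a0; rewrite rsum_ge0E ?E ?ltry//.
    by move=> t; case: ifP.
  split=> //; have [c0|c0] := leP 0 c; first exact: r0.
  rewrite (_ : (fun t => _) = fun t => -1 * (if t == u then - c else 0)); last first.
    by apply/funext => t; case: ifP; rewrite mulN1r ?opprK ?oppr0.
  by rewrite rsumZ// r0 ?mulN1r ?opprK// oppr_ge0 ltW.
elim: s => [|u s IH] /=.
  by move=> _; rewrite big_nil; split; [exact: abs_summable0|exact: rsum0].
move=> /andP[us /IH[IH1 IH2]]; rewrite big_cons -IH2.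
have [S1 S2] := single u (h u).
rewrite (_ : (fun t => if t \in u :: s then h t else 0) =
  fun t => (if t == u then h u else 0) + (if t \in s then h t else 0)); last first.
  apply/funext => t; rewrite in_cons; have [->|tu] := eqVneq t u; last by rewrite add0r.
  by rewrite (negbTE us) addr0.
by split; [exact: abs_summableD|rewrite rsumD// S2].
Qed.

(** The finite set carries all but [e] of the sum of [g], hence it serves all functions dominated by
    [g] at once. *)
Lemma esumR_tail g (e : R) : (forall t, 0 <= g t) -> (esumR g < +oo)%E -> 0 < e ->
  exists2 s, uniq s & forall h, (forall t, `|h t| <= g t) -> {in s, forall t, h t = 0} ->
    `|rsum h| <= e.
Proof.
move=> g0 goo e0.
have : ((fine (esumR g) - e)%:E < esumR g)%E.
  by rewrite -[X in (_ < X)%E](esumR_fineK g0 goo) lte_fin gtrBl.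
move=> /ereal_sup_gt[_ [X [finX _] <-] HX].
exists (finmap.enum_fset (fset_set X)); first exact: finmap.fset_uniq.
move=> h hg h0.
pose k t := if t \in finmap.enum_fset (fset_set X) then 0 else g t.
have kX t : t \in finmap.enum_fset (fset_set X) = (t \in X) by rewrite -in_fset_set.
have k0 t : 0 <= k t by rewrite /k; case: ifP.
have koo : (esumR k < +oo)%E by apply: le_lt_trans goo; apply: le_esumR => t; rewrite /k; case: ifP.
have sk : abs_summable k by apply: abs_summable_le koo => t; rewrite ger0_norm.
apply: (@le_trans _ _ (rsum k)).
  apply: ler_norm_rsum => // t; rewrite /k; case: ifPn => [/h0->|_//].
  by rewrite normr0.
rewrite rsum_ge0E//.
have := @esumID R T X setT (fun t => (g t)%:E) (fun t _ => ltac:(by rewrite lee_fin)).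
rewrite !setTI (esum_fset finX); last by move=> t _; rewrite lee_fin.
rewrite (_ : \esum_(i in ~` X) _ = esumR k); last first.
  rewrite esum_mkcond; apply: eq_esum => t _; rewrite /k kX in_setC.
  by case: (t \in X).
rewrite -(esumR_fineK g0 goo) -(esumR_fineK k0 koo).
have : \sum_(i \in X) (g i)%:E \is a fin_num.
  by rewrite fsbig_finite//= sumEFin.
case: (\sum_(i \in X) (g i)%:E) HX => [r| |]// HX _.
by rewrite -EFinD => -[]; move: HX; rewrite lte_fin; lra.
Qed.

(** Dominated convergence: on a finite set there are finitely many limits, and off it the
    differences, dominated by [2 * g], sum to little. *)
Lemma rsum_cvg (f : nat -> T -> R) k g : (forall n t, `|f n t| <= g t) -> (esumR g < +oo)%E ->
  (forall t, (fun n => f n t) @ \oo --> k t) -> (fun n => rsum (f n)) @ \oo --> rsum k.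
Proof.
move=> fg goo fk.
have g0 t : 0 <= g t by apply: le_trans (fg 0 t).
have kg t : `|k t| <= g t.
  have : (fun n => `|f n t|) @ \oo --> `|k t| by apply: cvg_norm; exact: fk.
  by move=> /cvgr_to_le; apply; exact: nearW.
have sf n : abs_summable (f n) by exact: abs_summable_le (fg n) goo.
have sk : abs_summable k by exact: abs_summable_le kg goo.
have g20 t : 0 <= 2 * g t by rewrite mulr_ge0.
have g2oo : (esumR (fun t => (2 * g t)%R) < +oo)%E by rewrite esumRZ// lte_mul_pinfty.
apply/cvgrPdist_le => e e0.
have e20 : 0 < e / 2 by rewrite divr_gt0.
have [s us Hs] := esumR_tail g20 g2oo e20.
have lim0 : (fun n => \sum_(t <- s) (k t - f n t)) @ \oo --> (0 : R).
  elim: s {us Hs} => [|t s IH].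
    by under eq_fun do rewrite big_nil; exact: cvg_cst.
  under eq_fun do rewrite big_cons.
  have h1 : (fun n => k t - f n t) @ \oo --> (0 : R).
    by rewrite -(subrr (k t)); apply: cvgB => //; exact: cvg_cst.
  by have H := cvgD h1 IH; rewrite addr0 in H; exact: H.
have /cvgrPdist_le/(_ _ e20) := lim0; apply: filterS => n; rewrite sub0r normrN => Hn.
have [S1 S2] := rsum_seq (fun t => k t - f n t) us.
have -> : rsum k - rsum (f n) = rsum (fun t => if t \in s then k t - f n t else 0) +
    rsum (fun t => if t \in s then 0 else k t - f n t).
  rewrite -rsumD//; last first.
    apply: (@abs_summable_le _ (fun t => 2 * g t)) => // t; case: ifP => _; first by rewrite normr0.
    by rewrite (le_trans (ler_normB _ _))// -[2]/(1 + 1) mulrDl !mul1r lerD.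
  rewrite addrC -mulN1r -rsum_lin//; congr rsum; apply/funext => t.
  by case: ifP => _; rewrite mulN1r ?addr0 ?add0r addrC.
apply: (le_trans (ler_normD _ _)); rewrite [leRHS](splitr e) lerD// ?S2//.
apply: Hs => [t|t ts]; last by rewrite ts.
case: ifP => _; first by rewrite normr0.
by rewrite (le_trans (ler_normB _ _))// -[2]/(1 + 1) mulrDl !mul1r lerD.
Qed.

Lemma abs_summable_reindex (S : choiceType) (e : S -> T) f : injective e ->
  (forall t, (forall u, t <> e u) -> f t = 0) ->
  (esumR f = \esum_(u in [set: S]) (f (e u))%:E).
Proof.
move=> ie f0; rewrite -(esum_image setT e (fun t => (f t)%:E)); last by move=> u v _ _; exact: ie.
rewrite [RHS]esum_mkcond; apply: eq_esum => t _.
have [//|te] := boolP (t \in _); rewrite f0// => u tu; move: te; rewrite notin_setE; apply.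
by exists u.
Qed.

End RealSums.

Lemma rsum_reindex (R : realType) (T S : choiceType) (e : S -> T) (f : T -> R) : injective e ->
  (forall t, (forall u, t <> e u) -> f t = 0) -> rsum f = rsum (fun u => f (e u)).
Proof.
move=> ie f0; rewrite /rsum; congr (fine _ - fine _).
  apply: (@abs_summable_reindex R T S e (fun t => Num.max (f t) 0)) => // t /f0 ->.
  by rewrite maxxx.
apply: (@abs_summable_reindex R T S e (fun t => Num.max (- f t) 0)) => // t /f0 ->.
by rewrite oppr0 maxxx.
Qed.

(** * The real Hilbert space of square summable functions *)

Section SquareSummable.
Variables (R : realType) (T : choiceType).
Implicit Types (f g h : T -> R) (t : T) (s : seq T).

Local Notation esumR f := (\esum_(t in [set: T]) (f t)%:E).

Definition sq_summable f : Prop := (esumR (fun t => f t ^+ 2) < +oo)%E.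

Lemma abs_summable_mul f g : sq_summable f -> sq_summable g -> abs_summable (fun t => f t * g t).
Proof.
move=> sf sg; apply: (@abs_summable_le _ _ _ (fun t => f t ^+ 2 + g t ^+ 2)).
  move=> t; rewrite normrM -[f t ^+ 2]real_normK ?num_real// -[g t ^+ 2]real_normK ?num_real//.
  by have := normr_ge0 (f t); have := normr_ge0 (g t); set a := `|f t|; set b := `|g t|; nra.
by rewrite esumRD ?lte_add_pinfty// => t; exact: sqr_ge0.
Qed.

Lemma sq_summable_lin (c : R) f g : sq_summable f -> sq_summable g ->
  sq_summable (fun t => c * f t + g t).
Proof.
move=> sf sg; apply: (@le_lt_trans _ _ (esumR (fun t => (2 * c ^+ 2) * f t ^+ 2 + 2 * g t ^+ 2))).
  apply: le_esumR => t; have := sqr_ge0 (c * f t - g t); set a := f t; set b := g t; nra.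
have c2 : 0 <= 2 * c ^+ 2 by rewrite mulr_ge0// sqr_ge0.
rewrite (esumRD (f := fun t => (2 * c ^+ 2) * f t ^+ 2) (g := fun t => 2 * g t ^+ 2)); last 2 first.
- by move=> t; rewrite mulr_ge0// sqr_ge0.
- by move=> t; rewrite mulr_ge0// sqr_ge0.
rewrite (esumRZ (f := fun t => f t ^+ 2))// ?(esumRZ (f := fun t => g t ^+ 2))//; try by move=> t; exact: sqr_ge0.
by rewrite lte_add_pinfty// lte_mul_pinfty// lee_fin.
Qed.

Lemma sq_summable0 : sq_summable (fun=> 0).
Proof. by rewrite /sq_summable esum1// => t _; rewrite expr0n. Qed.

Definition l2pred : {pred (T -> R)} := fun f => `[< sq_summable f >].

Lemma l2pred_closed : submod_closed l2pred.
Proof.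
split; first by apply/asboolP; exact: sq_summable0.
by move=> c f g /asboolP sf /asboolP sg; apply/asboolP; exact: sq_summable_lin.
Qed.

HB.instance Definition _ := GRing.isSubmodClosed.Build R (T -> R) l2pred l2pred_closed.

(** A module type, as the abstract spectral theorem requires. Functions are real valued; complex
    ones are treated later as pairs. *)
Record l2space := L2Space { l2val :> T -> R; l2valP : l2val \in l2pred }.

HB.instance Definition _ := [isSub for l2val].
HB.instance Definition _ := [Choice of l2space by <:].
HB.instance Definition _ := [SubChoice_isSubLmodule of l2space by <:].

Lemma l2space_sq (x : l2space) : sq_summable x.
Proof. by apply/asboolP; exact: l2valP. Qed.

Definition to_l2 f (sf : sq_summable f) : l2space := L2Space (introT (asboolP _) sf).

Definition l2dot (x y : l2space) : R := rsum (fun t => x t * y t).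

Lemma l2dotC x y : l2dot x y = l2dot y x.
Proof. by congr rsum; apply/funext => t; rewrite mulrC. Qed.

Lemma l2dot_lin c (x y z : l2space) : l2dot (c *: x + y) z = c * l2dot x z + l2dot y z.
Proof.
rewrite -rsum_lin; try by apply: abs_summable_mul; exact: l2space_sq.
by congr rsum; apply/funext => t; rewrite /= mulrDl mulrA.
Qed.

Lemma l2dotE (x : l2space) : l2dot x x = fine (esumR (fun t => x t ^+ 2)).
Proof.
rewrite /l2dot -rsum_ge0E//; last exact: l2space_sq.
by move=> t; exact: sqr_ge0.
Qed.

Lemma l2dot_ge0 x : 0 <= l2dot x x.
Proof. by rewrite l2dotE fine_ge0// esumR_ge0// => t; exact: sqr_ge0. Qed.

Lemma l2_ext (x y : l2space) : (forall t, x t = y t) -> x = y.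
Proof. by move=> xy; apply: val_inj; exact/funext. Qed.

Lemma sq_summable_delta s : uniq s -> forall h, sq_summable (fun t => if t \in s then h t else 0).
Proof.
move=> us h; have [+ _] := rsum_seq (fun t => h t ^+ 2) us; rewrite /abs_summable /sq_summable.
congr (_ < _)%E; apply: eq_esum => t _; case: ifP => _; last by rewrite normr0 expr0n.
by rewrite ger0_norm// sqr_ge0.
Qed.

Definition l2trunc s (us : uniq s) h : l2space := to_l2 (sq_summable_delta us h).

Lemma l2dot_trunc s (us : uniq s) h (x : l2space) :
  l2dot (l2trunc us h) x = \sum_(t <- s) h t * x t.
Proof.
have [_ <-] := rsum_seq (fun t => h t * x t) us.
by congr rsum; apply/funext => t /=; case: ifP => _; rewrite ?mul0r.
Qed.

Definition l2delta t : l2space := l2trunc (s := [:: t]) isT (fun=> 1).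

Lemma l2deltaE t u : l2delta t u = (u == t)%:R.
Proof. by rewrite /= in_cons in_nil orbF; case: eqP. Qed.

Lemma l2dot_delta t (x : l2space) : l2dot (l2delta t) x = x t.
Proof. by rewrite l2dot_trunc big_seq1 mul1r. Qed.

Lemma l2dot_eq0 (x : l2space) : l2dot x x = 0 -> x = 0.
Proof.
move=> x0; apply: l2_ext => t; rewrite -l2dot_delta.
have := cauchy_schwarz l2dotC l2dot_lin l2dot_ge0 (l2delta t) x.
by rewrite x0 mulr0 real_exprn_even_le0 ?num_real//= => /eqP ->.
Qed.

Lemma l2trunc_sum s (us : uniq s) h : l2trunc us h = \sum_(t <- s) h t *: l2delta t.
Proof.
apply: l2_ext => u.
have -> : l2val (\sum_(t <- s) h t *: l2delta t) u = \sum_(t <- s) h t * (u == t)%:R.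
  elim: (s) => [|t r IH]; first by rewrite !big_nil.
  by rewrite !big_cons -IH -l2deltaE.
rewrite /=; have [us'|us'] := boolP (u \in s).
  rewrite (big_rem u)//= eqxx mulr1 big1_seq ?addr0// => t /=.
  by rewrite mem_rem_uniq// inE => /andP[tu _]; rewrite eq_sym (negbTE tu) mulr0.
rewrite big1_seq// => t /= ts; have [ut|_] := eqVneq u t; last by rewrite mulr0.
by rewrite ut ts in us'.
Qed.

(* Coordinates of the representing vector are its values on the basis vectors. *)
Lemma l2_riesz (F : l2space -> R) :
  (forall c x y, F (c *: x + y) = c * F x + F y) ->
  (exists D, forall x, F x ^+ 2 <= D * l2dot x x) -> exists u, forall x, l2dot u x = F x.
Proof.
move=> Flin [D HD].
have F0 : F 0 = 0.
  have := HD 0; have -> : l2dot 0 0 = 0.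
    by have := l2dot_lin 0 0 0 0; rewrite scale0r add0r mul0r add0r => e; rewrite /l2dot; under eq_fun do rewrite mul0r; exact: rsum0.
  by rewrite mulr0 real_exprn_even_le0 ?num_real// => /eqP.
have FD x y : F (x + y) = F x + F y by rewrite -[x in LHS]scale1r Flin mul1r.
have FZ c x : F (c *: x) = c * F x by rewrite -[_ *: _]addr0 Flin F0 addr0.
pose u t := F (l2delta t).
have Ftrunc s (us : uniq s) h : F (l2trunc us h) = \sum_(t <- s) h t * u t.
  rewrite l2trunc_sum; elim: (s) => [|t r IH]; first by rewrite !big_nil F0.
  by rewrite !big_cons FD FZ IH.
have dtrunc s (us : uniq s) h : l2dot (l2trunc us h) (l2trunc us h) = \sum_(t <- s) h t ^+ 2.
  rewrite l2dot_trunc; apply: eq_big_seq => t /= ->; by rewrite expr2.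
have su : sq_summable u.
  have D0 : (esumR (fun t => u t ^+ 2) <= (Num.max D 0)%:E)%E.
    apply: ge_ereal_sup => _ [X [finX _] <-].
    rewrite fsbig_finite//= sumEFin lee_fin.
    (* Testing [F] on the truncation of [u] itself gives [S ^ 2 <= D * S], which bounds every finite
       partial sum [S]. *)
    have := HD (l2trunc (finmap.fset_uniq (fset_set X)) u).
    rewrite Ftrunc dtrunc; under eq_bigr do rewrite -expr2.
    set S := \sum_(i <- _) _; have S0 : 0 <= S by apply: sumr_ge0 => t _; exact: sqr_ge0.
    rewrite le_max; have [->|Sn0] := eqVneq S 0; first by rewrite lexx orbT.
    by rewrite expr2 ler_pM2r ?lt_def ?Sn0// => ->.
  by apply: le_lt_trans D0 _; exact: ltry.
exists (to_l2 su) => x.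
apply/eqP; rewrite -subr_eq0 -normr_le0; apply/ler_addgt0Pr => e e0; rewrite add0r.
(* [g] dominates both the squares and the products, so that one finite set makes both tails small;
   [e2] is chosen so that the bound on [F] turns it into [e1 ^ 2]. *)
pose g t := x t ^+ 2 + `|u t * x t|.
have g0 t : 0 <= g t by rewrite addr_ge0// sqr_ge0.
have goo : (esumR g < +oo)%E.
  rewrite (esumRD (f := fun t => x t ^+ 2) (g := fun t => `|u t * x t|))//; last by move=> t; exact: sqr_ge0.
  by apply: lte_add_pinfty; [exact: l2space_sq|apply: abs_summable_mul => //; exact: l2space_sq].
pose D' := Num.max D 0 + 1.
have D'0 : 0 < D' by rewrite ltr_wpDl// le_max lexx orbT.
pose e1 := e / 2; have e10 : 0 < e1 by rewrite divr_gt0.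
pose e2 := e1 ^+ 2 / D'; have e20 : 0 < e2 by rewrite divr_gt0// exprn_gt0.
pose e3 := Num.min e1 e2; have e30 : 0 < e3 by rewrite lt_min e10 e20.
have [s us Hs] := esumR_tail g0 goo e30.
pose xs := l2trunc us x.
have xsE t : (x - xs) t = if t \in s then 0 else x t.
  rewrite -[LHS]/(x t - (if t \in s then x t else 0)).
  by case: ifP; rewrite ?subrr ?subr0.
have F2 : `|F (x - xs)| <= e1.
  rewrite -(@ler_pXn2r _ 2)// ?nnegrE ?(ltW e10)// real_normK ?num_real//.
  apply: (le_trans (HD _)).
  have : `|l2dot (x - xs) (x - xs)| <= e3.
    apply: Hs => t.
      rewrite xsE /g; case: ifP => _; last by rewrite -expr2 ger0_norm ?sqr_ge0// lerDl.
      by rewrite mul0r normr0 addr_ge0// sqr_ge0.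
    by move=> ts; rewrite xsE ts mul0r.
  rewrite ger0_norm ?l2dot_ge0// => h.
  have h2 : l2dot (x - xs) (x - xs) <= e2 by rewrite (le_trans h)// ge_min lexx orbT.
  apply: (@le_trans _ _ (D' * l2dot (x - xs) (x - xs))).
    by rewrite ler_wpM2r ?l2dot_ge0// /D' -[leLHS]addr0 lerD// le_max lexx.
  by rewrite mulrC -ler_pdivlMr.
have E1 : F x = F (x - xs) + \sum_(t <- s) x t * u t by rewrite -Ftrunc -FD subrK.
have E2 : l2dot (to_l2 su) x = l2dot (to_l2 su) (x - xs) + \sum_(t <- s) x t * u t.
  have -> : \sum_(t <- s) x t * u t = l2dot (to_l2 su) xs by rewrite l2dotC l2dot_trunc.
  by rewrite l2dotC -[x in LHS](subrK xs) -[x - xs in LHS]scale1r l2dot_lin mul1r !(l2dotC (to_l2 su)).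
rewrite E1 E2 [X in `|X|](_ : _ = l2dot (to_l2 su) (x - xs) - F (x - xs)); last by ring.
apply: (le_trans (ler_normB _ _)); rewrite [leRHS](splitr e) lerD//.
have le3 : e3 <= e1 by rewrite ge_min lexx.
apply: le_trans le3; apply: Hs => t.
  rewrite xsE /g; case: ifP => _; last by rewrite lerDr sqr_ge0.
  by rewrite mulr0 normr0 addr_ge0// sqr_ge0.
by move=> ts; rewrite xsE ts mulr0.
Qed.

End SquareSummable.

(** * The hopping operator of a crystal *)

Local Open Scope complex_scope.

Section CrystalOperator.
Variables (R : realType) (d nu : nat) (G : crystal R d nu).
Local Notation T := (vertices G).
Local Notation Z := 'rV[int]_d.
Implicit Types (v : T) (k l m : Z) (y z : T -> R).

Local Notation esumR f := (\esum_(t in [set: _]) (f t)%:E).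

Lemma translationD k l : translation (Defs.basis G) (k + l) = translation (Defs.basis G) k + translation (Defs.basis G) l.
Proof.
rewrite /translation -big_split/=; apply: eq_bigr => i _.
by rewrite mxE intrD scalerDl.
Qed.

Lemma translation0 : translation (Defs.basis G) 0 = 0.
Proof. by rewrite /translation big1// => i _; rewrite mxE scale0r. Qed.

Lemma vertices_mem (i : 'I_nu) k : (cell G i + translation (Defs.basis G) k) \in vertices G.
Proof. by apply/mem_set; rewrite vertices_cell; exists (i, k). Qed.

Definition vertex (ik : 'I_nu * Z) : T := SigSub (vertices_mem ik.1 ik.2).

Lemma vertex_inj : injective vertex.
Proof.
by move=> [i k] [j l] /(congr1 val) /= /vertices_uniq [-> ->].
Qed.

Lemma vertex_surj v : exists ik, v = vertex ik.
Proof.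
have : vertices G (val v) by apply: set_mem; exact: valP.
rewrite {1}vertices_cell => -[[i k] _ e]; exists (i, k); apply: val_inj.
by rewrite /= -e.
Qed.

Definition vcoord v : 'I_nu * Z := projT1 (cid (vertex_surj v)).

Lemma vcoordK v : vertex (vcoord v) = v.
Proof. by rewrite /vcoord; case: cid => ik /= ->. Qed.

Lemma vertexK ik : vcoord (vertex ik) = ik.
Proof. by apply: vertex_inj; rewrite vcoordK. Qed.

Definition vshift l v : T := vertex ((vcoord v).1, (vcoord v).2 + l).

Lemma vshift_vertex l i k : vshift l (vertex (i, k)) = vertex (i, k + l).
Proof. by rewrite /vshift vertexK. Qed.

Lemma val_vshift l v : val (vshift l v) = val v + translation (Defs.basis G) l.
Proof. by rewrite -{2}(vcoordK v) /= translationD addrA. Qed.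

Lemma vshiftD l m v : vshift l (vshift m v) = vshift (m + l) v.
Proof. by rewrite -(vcoordK v); case: (vcoord v) => i k; rewrite !vshift_vertex addrA. Qed.

Lemma vshift0 v : vshift 0 v = v.
Proof. by rewrite /vshift addr0 -surjective_pairing vcoordK. Qed.

Lemma vshiftK l : cancel (vshift l) (vshift (- l)).
Proof. by move=> v; rewrite vshiftD subrr vshift0. Qed.

Lemma vshiftNK l : cancel (vshift (- l)) (vshift l).
Proof. by move=> v; rewrite vshiftD addNr vshift0. Qed.

Lemma vshift_bij l : set_bij [set: T] [set: T] (vshift l).
Proof.
split=> //; first by move=> x y _ _; exact: (can_inj (vshiftK l)).
by move=> x _; exists (vshift (- l) x) => //; rewrite vshiftNK.
Qed.

Lemma vval v : vertices G (val v).
Proof. by apply: set_mem; exact: valP. Qed.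

Definition wt v v' : R := weight G (val v) (val v').
Definition pot v : R := potential G (val v).

Lemma wt_ge0 v v' : 0 <= wt v v'. Proof. by apply: weight_ge0; exact: vval. Qed.
Lemma wt_sym v v' : wt v v' = wt v' v. Proof. by apply: weight_sym; exact: vval. Qed.

Lemma wt_shift l v v' : wt (vshift l v) (vshift l v') = wt v v'.
Proof. by rewrite /wt !val_vshift weight_periodic//; exact: vval. Qed.

Lemma pot_shift l v : pot (vshift l v) = pot v.
Proof. by rewrite /pot val_vshift potential_periodic//; exact: vval. Qed.

Lemma wt_summable v : (esumR (wt v) < +oo)%E.
Proof.
have := weight_summable (vval v); congr (_ < _)%E.
rewrite (reindex_esum [set: T] (vertices G) val)//; split.
- by move=> x _; exact: vval.
- by move=> x y _ _; exact: val_inj.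
- by move=> x /mem_set xV; exists (SigSub xV).
Qed.

Lemma esum_wt_shift l v : esumR (wt (vshift l v)) = esumR (wt v).
Proof.
rewrite (reindex_esum _ _ _ _ (vshift_bij l)).
by apply: eq_esum => v' _; rewrite wt_shift.
Qed.

(** Every vertex is a translate of one in the cell, so the sum over the cell bounds the total weight
    at any vertex. *)
Definition wbound : R := \sum_(i < nu) fine (esumR (wt (vertex (i, 0)))).
Definition pbound : R := \sum_(i < nu) `|pot (vertex (i, 0))|.

Lemma vertex_vshift v : v = vshift (vcoord v).2 (vertex ((vcoord v).1, 0)).
Proof. by rewrite vshift_vertex add0r -surjective_pairing vcoordK. Qed.

Lemma wbound_ge0 : 0 <= wbound.
Proof. by apply: sumr_ge0 => i _; rewrite fine_ge0// esumR_ge0// => v; exact: wt_ge0. Qed.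

Lemma pbound_ge0 : 0 <= pbound.
Proof. by apply: sumr_ge0. Qed.

Lemma esum_wt_le v : (esumR (wt v) <= wbound%:E)%E.
Proof.
rewrite (vertex_vshift v) esum_wt_shift -esumR_fineK; [|exact: wt_ge0|exact: wt_summable].
rewrite lee_fin /wbound (bigD1 (vcoord v).1)//= lerDl.
by apply: sumr_ge0 => i _; rewrite fine_ge0// esumR_ge0// => v'; exact: wt_ge0.
Qed.

Lemma pot_le v : `|pot v| <= pbound.
Proof.
rewrite (vertex_vshift v) pot_shift /pbound (bigD1 (vcoord v).1)//= lerDl.
exact: sumr_ge0.
Qed.

Lemma abs_summable_wt v : abs_summable (wt v).
Proof.
by apply: abs_summable_le (wt_summable v) => v'; rewrite ger0_norm ?wt_ge0.
Qed.

Definition bounded_fun y := exists C, forall v, `|y v| <= C.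

Lemma bounded_fun_lin (c : R) y z : bounded_fun y -> bounded_fun z ->
  bounded_fun (fun v => c * y v + z v).
Proof.
move=> [C HC] [D HD]; exists (`|c| * C + D) => v.
by rewrite (le_trans (ler_normD _ _))// lerD// normrM ler_wpM2l.
Qed.

Lemma abs_summable_wt_bounded v y : bounded_fun y -> abs_summable (fun v' => wt v v' * y v').
Proof.
move=> [C HC]; apply: (@abs_summable_le _ _ _ (fun v' => `|C| * wt v v')).
  move=> v'; rewrite normrM ger0_norm ?wt_ge0// mulrC ler_wpM2r ?wt_ge0//.
  by rewrite (le_trans (HC v'))// ler_norm.
rewrite (esumRZ (f := wt v))//; last exact: wt_ge0.
by rewrite lte_mul_pinfty ?lee_fin// wt_summable.
Qed.

(** The real operator, defined on all functions because it is applied both to square summable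
    functions and to parts of Bloch waves, which are merely bounded. *)
Definition hop y v : R := rsum (fun v' => wt v v' * y v') + pot v * y v.

Lemma hop_lin (c : R) y z : bounded_fun y -> bounded_fun z ->
  hop (fun v => c * y v + z v) = (fun v => c * hop y v + hop z v).
Proof.
move=> by_ bz; apply/funext => v; rewrite /hop.
have := rsum_lin c (abs_summable_wt_bounded v by_) (abs_summable_wt_bounded v bz).
have -> : (fun t => c * (wt v t * y t) + wt v t * z t) = (fun v' => wt v v' * (c * y v' + z v')).
  by apply/funext => v'; ring.
by move=> ->; ring.
Qed.

Lemma hop_bound C y : (forall v, `|y v| <= C) ->
  forall v, `|hop y v| <= (wbound + pbound) * C.
Proof.
move=> HC v; have C0 : 0 <= C by apply: le_trans (HC v).
rewrite mulrDl (le_trans (ler_normD _ _))// lerD//; last first.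
  by rewrite normrM ler_pM ?pot_le.
apply: (@le_trans _ _ (rsum (fun v' => C * wt v v'))).
  apply: ler_norm_rsum; last exact/abs_summableZ/abs_summable_wt.
  by move=> v'; rewrite normrM ger0_norm ?wt_ge0// mulrC ler_wpM2r ?wt_ge0.
rewrite rsumZ; last exact: abs_summable_wt.
rewrite mulrC ler_wpM2r// rsum_ge0E; [|exact: wt_ge0|exact: wt_summable].
rewrite -lee_fin esumR_fineK; [exact: esum_wt_le|exact: wt_ge0|exact: wt_summable].
Qed.

Lemma hop_cvg (y_ : nat -> T -> R) y C : (forall n v, `|y_ n v| <= C) ->
  (forall v, (fun n => y_ n v) @ \oo --> y v) ->
  forall v, (fun n => hop (y_ n) v) @ \oo --> hop y v.
Proof.
move=> HC yy v; have C0 : 0 <= C by apply: le_trans (HC 0 v).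
apply: cvgD; last by apply: cvgM; [exact: cvg_cst|exact: yy].
apply: (@rsum_cvg _ _ _ _ (fun v' => C * wt v v')).
- by move=> n v'; rewrite normrM ger0_norm ?wt_ge0// mulrC ler_wpM2r ?wt_ge0.
- rewrite (esumRZ (f := wt v))//; last exact: wt_ge0.
  by rewrite lte_mul_pinfty ?lee_fin// wt_summable.
- by move=> v'; apply: cvgM; [exact: cvg_cst|exact: yy].
Qed.

Lemma hop_shift l y v : hop (fun u => y (vshift l u)) v = hop y (vshift l v).
Proof.
rewrite /hop pot_shift; congr (_ + _).
rewrite [RHS](@rsum_reindex _ _ _ (vshift l)).
- by congr rsum; apply/funext => v'; rewrite wt_shift.
- exact: (can_inj (vshiftK l)).
- by move=> t H; have := H (vshift (- l) t); rewrite vshiftNK.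
Qed.

Lemma sq_summable_bounded y : sq_summable y -> bounded_fun y.
Proof.
move=> sy; exists (fine (esumR (fun v => y v ^+ 2)) + 1) => v.
have y20 u : 0 <= y u ^+ 2 by exact: sqr_ge0.
have : ((y v ^+ 2)%:E <= esumR (fun v => y v ^+ 2))%E.
  rewrite -(@esum_set1 R T v (fun u => (y u ^+ 2)%:E)) ?lee_fin//.
  rewrite (@esumID R T [set v] setT) ?setTI ?leeDl//; last by move=> u _; rewrite lee_fin.
  by apply: esum_ge0 => u _; rewrite lee_fin.
rewrite -(esumR_fineK y20 sy) lee_fin -[y v ^+ 2]real_normK ?num_real//.
by set a := `|y v|; move=> h; nra.
Qed.

(* Schur test: Cauchy-Schwarz with respect to the weights [wt v]. *)
Lemma hop_sq y : sq_summable y ->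
  (esumR (fun v => hop y v ^+ 2) <=
   (2 * (wbound ^+ 2 + pbound ^+ 2))%:E * esumR (fun v => y v ^+ 2))%E.
Proof.
move=> sy; have by_ := sq_summable_bounded sy.
have by2 : bounded_fun (fun v => y v ^+ 2).
  by have [C HC] := by_; exists (C ^+ 2) => v; rewrite normrX lerXn2r ?nnegrE// (le_trans _ (HC v)).
have y20 v : 0 <= y v ^+ 2 by exact: sqr_ge0.
pose Y v := rsum (fun v' => wt v v' * y v' ^+ 2).
have wy0 v v' : 0 <= wt v v' * y v' ^+ 2 by rewrite mulr_ge0 ?wt_ge0.
have Y0 v : 0 <= Y v by apply: rsum_ge0 => //; exact: abs_summable_wt_bounded.
have S v : rsum (wt v) <= wbound.
  rewrite rsum_ge0E; [|exact: wt_ge0|exact: wt_summable].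
  by rewrite -lee_fin esumR_fineK; [exact: esum_wt_le|exact: wt_ge0|exact: wt_summable].
have CS v : rsum (fun v' => wt v v' * y v') ^+ 2 <= wbound * Y v.
  set a := rsum _.
  (* Sum [wt v v' * (t - y v') ^ 2 >= 0] over [v']. Below, [t = a / wbound] gives the inequality,
     and for [wbound = 0] the bound for all [t] forces [a = 0]. *)
  have H t : 2 * t * a <= t ^+ 2 * wbound + Y v.
    apply: (@le_trans _ _ (t ^+ 2 * rsum (wt v) + Y v)); last first.
      by rewrite lerD2r ler_wpM2l ?sqr_ge0.
    rewrite /a /Y -rsumZ; last exact: abs_summable_wt_bounded.
    rewrite -rsum_lin; [|exact: abs_summable_wt|exact: abs_summable_wt_bounded].
    apply: le_rsum => [||v'].
    - exact/abs_summableZ/abs_summable_wt_bounded.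
    - by apply: abs_summable_lin; [exact: abs_summable_wt|exact: abs_summable_wt_bounded].
    - have := sqr_ge0 (t - y v'); have := wt_ge0 v v'; set b := wt v v'; set c := y v' => b0 s0.
      have := mulr_ge0 b0 s0; lra.
  have [w0|wn0] := eqVneq wbound 0.
    have [->|an0] := eqVneq a 0; first by rewrite expr0n mulr_ge0 ?wbound_ge0.
    have := H ((Y v + 1) / a); rewrite w0 mulr0 add0r -mulrA divfK//.
    by have := Y0 v; lra.
  have wp : 0 < wbound by rewrite lt_def wn0 wbound_ge0.
  have := H (a / wbound); rewrite -(ler_pM2r wp) => h.
  have -> : a ^+ 2 = 2 * (a / wbound) * a * wbound - (a / wbound) ^+ 2 * wbound * wbound.
    by field; rewrite wn0.
  by lra.
(* After exchanging the two sums, symmetry of the weights makes the inner one the total weight at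
   [v']. *)
have EY : (esumR Y <= wbound%:E * esumR (fun v => y v ^+ 2))%E.
  apply: (@le_trans _ _ (\esum_(v in [set: T]) \esum_(v' in [set: T]) (wt v v' * y v' ^+ 2)%:E)).
    apply: le_esum => v _; have wyoo : (esumR (fun v' => wt v v' * y v' ^+ 2) < +oo)%E.
      have := abs_summable_wt_bounded v by2; congr (_ < _)%E; apply: eq_esum => v' _.
      by rewrite ger0_norm.
    by rewrite /Y rsum_ge0E// esumR_fineK.
  rewrite esum_esum; last by move=> i j _ _; rewrite lee_fin.
  rewrite (reindex_esum ([set: T] `*`` (fun=> [set: T])) _ (fun x => (x.2, x.1))); last first.
    split=> //; first by move=> [a b] [a' b'] _ _ [-> ->].
    by move=> [a b] _; exists (b, a).
  rewrite -(@esum_esum _ _ _ _ _ (fun a b => (wt b a * y a ^+ 2)%:E)); last by move=> i j _ _; rewrite lee_fin.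
  rewrite -esumRZ ?wbound_ge0//.
  apply: le_esum => v' _; rewrite (_ : \esum_(j in _) _ = (y v' ^+ 2)%:E * esumR (wt v'))%E.
    rewrite (_ : (wbound * y v' ^+ 2)%:E = (y v' ^+ 2)%:E * wbound%:E)%E; last by rewrite -EFinM mulrC.
    by apply: lee_wpmul2l; [rewrite lee_fin|exact: esum_wt_le].
  rewrite -esumRZ//; last exact: wt_ge0.
  by apply: eq_esum => v _; rewrite mulrC wt_sym.
apply: (@le_trans _ _ (esumR (fun v => 2 * wbound * Y v + 2 * pbound ^+ 2 * y v ^+ 2))).
  apply: le_esumR => v; rewrite /hop.
  have := CS v; set a := rsum _; have := pot_le v; have := sqr_ge0 (a - pot v * y v).
  have : (pot v * y v) ^+ 2 <= pbound ^+ 2 * y v ^+ 2.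
    rewrite exprMn ler_wpM2r// -[leLHS]real_normK ?num_real//.
    by rewrite lerXn2r ?nnegrE ?pbound_ge0 ?pot_le.
  by move: (pot v * y v) => b; lra.
have w20 : 0 <= 2 * wbound by rewrite mulr_ge0 ?wbound_ge0.
have p20 : 0 <= 2 * pbound ^+ 2 by rewrite mulr_ge0 ?sqr_ge0.
rewrite (esumRD (f := fun v => 2 * wbound * Y v) (g := fun v => 2 * pbound ^+ 2 * y v ^+ 2)); last 2 first.
- by move=> v; rewrite mulr_ge0.
- by move=> v; rewrite mulr_ge0.
rewrite !esumRZ// mulrDr EFinD muleDl//; last first.
  by rewrite ge0_fin_numE// esumR_ge0.
rewrite leeD2r// (_ : (2 * wbound ^+ 2)%:E = (2 * wbound)%:E * wbound%:E)%E; last by rewrite -EFinM -mulrA.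
by rewrite -muleA lee_wpmul2l// lee_fin.
Qed.

Lemma sq_summable_hop y : sq_summable y -> sq_summable (hop y).
Proof.
move=> sy; apply: (le_lt_trans (hop_sq sy)); rewrite lte_mul_pinfty//.
by rewrite lee_fin mulr_ge0// addr_ge0// sqr_ge0.
Qed.

Definition hop2 (x : l2space R T) : l2space R T := to_l2 (sq_summable_hop (l2space_sq x)).

Lemma hop2_lin c (x y : l2space R T) : hop2 (c *: x + y) = c *: hop2 x + hop2 y.
Proof.
apply: l2_ext => v; rewrite -[LHS]/(hop (fun u => c * x u + y u) v) hop_lin//;
by apply: sq_summable_bounded; exact: l2space_sq.
Qed.

Definition hnorm2 : R := 2 * (wbound ^+ 2 + pbound ^+ 2).

Lemma hop2_bound x : l2dot (hop2 x) (hop2 x) <= hnorm2 * l2dot x x.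
Proof.
have x20 (z : l2space R T) v : 0 <= z v ^+ 2 by exact: sqr_ge0.
rewrite !l2dotE -lee_fin EFinM !esumR_fineK ?l2space_sq//.
exact/hop_sq/l2space_sq.
Qed.

Let hnorm2_ge0 : 0 <= hnorm2. Proof. by rewrite mulr_ge0// addr_ge0// sqr_ge0. Qed.

(** The bounded functional [x |-> l2dot (hop2 x) y] has a Riesz representative. Testing it on delta
    functions identifies its coordinates with those of [hop2 y], so no double sum has to be
    exchanged. *)
Lemma hop2_sym (x y : l2space R T) : l2dot (hop2 x) y = l2dot x (hop2 y).
Proof.
have cs := cauchy_schwarz (@l2dotC R T) (@l2dot_lin R T) (@l2dot_ge0 R T).
have [||u Hu] := @l2_riesz R T (fun x => l2dot (hop2 x) y).
- by move=> c x1 x2; rewrite hop2_lin l2dot_lin.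
- exists (hnorm2 * l2dot y y) => z; apply: (le_trans (cs _ _)).
  by rewrite mulrAC ler_wpM2r ?l2dot_ge0 ?hop2_bound.
rewrite -Hu (l2dotC x); suff -> : u = hop2 y by [].
apply: l2_ext => t.
rewrite -!l2dot_delta (l2dotC _ u) Hu l2dot_delta.
have -> : hop2 y t = rsum (fun v => wt t v * y v) + pot t * l2dot (l2delta R t) y.
  by rewrite l2dot_delta.
rewrite {2}/l2dot -rsumZ; last by apply: abs_summable_mul; exact: l2space_sq.
rewrite -rsumD; last 2 first.
- by apply: abs_summable_wt_bounded; apply: sq_summable_bounded; exact: l2space_sq.
- by apply: abs_summableZ; apply: abs_summable_mul; exact: l2space_sq.
congr rsum; apply/funext => v.
have -> : hop2 (l2delta R t) v = wt v t + pot v * (v == t)%:R.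
  rewrite -l2deltaE; congr (_ + _).
  have [_ E] := @rsum_seq R T [:: t] (wt v) isT; rewrite big_seq1 in E; rewrite -[RHS]E.
  by congr rsum; apply/funext => v' /=; case: ifP => _; rewrite ?mulr1 ?mulr0.
rewrite l2deltaE mulrDl wt_sym; congr (_ + _).
by have [->|_] := eqVneq v t; rewrite ?mulr1 ?mul1r ?mulr0 ?mul0r ?mulr0.
Qed.

End CrystalOperator.

(** * Bloch waves *)

Section ComplexSums.
Variable R : realType.
Local Notation Re := complex.Re.
Local Notation Im := complex.Im.

Lemma complexReM (x y : R[i]) : Re (x * y) = Re x * Re y - Im x * Im y.
Proof. by case: x y => [a b] [c e]. Qed.

Lemma complexImM (x y : R[i]) : Im (x * y) = Re x * Im y + Im x * Re y.
Proof. by case: x y => [a b] [c e]. Qed.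

Lemma complexReD (x y : R[i]) : Re (x + y) = Re x + Re y.
Proof. by case: x y => [a b] [c e]. Qed.

Lemma complexImD (x y : R[i]) : Im (x + y) = Im x + Im y.
Proof. by case: x y => [a b] [c e]. Qed.

Lemma complex_eq (x y : R[i]) : Re x = Re y -> Im x = Im y -> x = y.
Proof. by case: x y => [a b] [c e] /= -> ->. Qed.

Lemma Re_sum (I : Type) (r : seq I) (F : I -> R[i]) : Re (\sum_(i <- r) F i) = \sum_(i <- r) Re (F i).
Proof. by elim: r => [|i r IH]; rewrite ?big_nil// !big_cons complexReD IH. Qed.

Lemma Im_sum (I : Type) (r : seq I) (F : I -> R[i]) : Im (\sum_(i <- r) F i) = \sum_(i <- r) Im (F i).
Proof. by elim: r => [|i r IH]; rewrite ?big_nil// !big_cons complexImD IH. Qed.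

Variable T : choiceType.
Implicit Types f g : T -> R[i].

Definition csummable f := abs_summable (fun t => Re (f t)) /\ abs_summable (fun t => Im (f t)).

Lemma csumZ (c : R[i]) f : csummable f -> csum (fun t => c * f t) = c * csum f.
Proof.
move=> [sr si]; apply: complex_eq; rewrite ?complexReM ?complexImM /=.
  rewrite (_ : (fun t => _) = fun t => Re c * Re (f t) + (- Im c) * Im (f t)); last first.
    by apply/funext => t; rewrite complexReM mulNr.
  by rewrite rsum_lin ?rsumZ ?mulNr//; exact: abs_summableZ.
rewrite (_ : (fun t => _) = fun t => Re c * Im (f t) + Im c * Re (f t)); last first.
  by apply/funext => t; rewrite complexImM.
by rewrite rsum_lin ?rsumZ//; exact: abs_summableZ.
Qed.

Lemma csum_reindex (S : choiceType) (e : S -> T) f : injective e ->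
  (forall t, (forall u, t <> e u) -> f t = 0) -> csum f = csum (fun u => f (e u)).
Proof.
by move=> ie f0; rewrite /csum; congr (_ +i* _); apply: rsum_reindex => // t /f0 ->.
Qed.

End ComplexSums.

Lemma rsum_sum (R : realType) (T : choiceType) (I : Type) (r : seq I) (F : I -> T -> R) :
  (forall i, abs_summable (F i)) ->
  abs_summable (fun t => \sum_(i <- r) F i t) /\
  rsum (fun t => \sum_(i <- r) F i t) = \sum_(i <- r) rsum (F i).
Proof.
move=> sF; elim: r => [|i r [IH1 IH2]].
  by under eq_fun do rewrite big_nil; rewrite big_nil; split; [exact: abs_summable0|exact: rsum0].
by under eq_fun do rewrite big_cons; rewrite big_cons -IH2 rsumD//; split => //; exact: abs_summableD.
Qed.

(** * The operator scaled to the unit interval *)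

Section ScaledOperator.
Variables (R : realType) (d nu : nat) (G : crystal R d nu).
Local Notation T := (vertices G).
Local Notation Z := 'rV[int]_d.
Local Notation Re := complex.Re.
Local Notation Im := complex.Im.
Implicit Types (v : T) (y z : T -> R) (psi phi : T -> R[i]).

(** One scale for two norms: [hnorm2 G] bounds the square of the operator norm, so [hnorm2 G + 1]
    bounds the norm itself, and [wbound G + pbound G] bounds the operator in the supremum norm. *)
Definition hscale : R := hnorm2 G + 1 + wbound G + pbound G.

Lemma hnorm2_ge0 : 0 <= hnorm2 G.
Proof. by rewrite mulr_ge0// addr_ge0// sqr_ge0. Qed.

Lemma hscale_ge1 : 1 <= hscale.
Proof. have := hnorm2_ge0; have := wbound_ge0 G; have := pbound_ge0 G; rewrite /hscale; lra. Qed.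

Lemma hscale_gt0 : 0 < hscale. Proof. exact: lt_le_trans hscale_ge1. Qed.

Let M := hscale.
Let M0 : 0 < M := hscale_gt0.

(* [(H + M) / 2M], whose spectrum lies in the unit interval *)
Definition sop2 (x : l2space R T) : l2space R T := (2 * M)^-1 *: (hop2 x + M *: x).

Definition sop y v : R := (2 * M)^-1 * (hop y v + M * y v).

Lemma sop2E (x : l2space R T) : (sop2 x : T -> R) = sop x.
Proof. by []. Qed.

Lemma sop_lin (c : R) y z : bounded_fun y -> bounded_fun z ->
  sop (fun v => c * y v + z v) = (fun v => c * sop y v + sop z v).
Proof. by move=> by_ bz; apply/funext => v; rewrite /sop hop_lin//; ring. Qed.

Lemma sop2_lin c (x y : l2space R T) : sop2 (c *: x + y) = c *: sop2 x + sop2 y.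
Proof.
apply: l2_ext => v; rewrite -[LHS]/(sop (fun u => c * x u + y u) v) sop_lin//;
by apply: sq_summable_bounded; exact: l2space_sq.
Qed.

Lemma sop2_sym (x y : l2space R T) : l2dot (sop2 x) y = l2dot x (sop2 y).
Proof.
rewrite /sop2 -[_ *: _]addr0 l2dot_lin (l2dotC x) -[in RHS](addr0 (_ *: _)) l2dot_lin.
have z u : l2dot (0 : l2space R T) u = 0.
  by have := l2dot_lin 1 0 0 u; rewrite scaler0 addr0 mul1r; lra.
rewrite !z !addr0; congr (_ * _).
by rewrite !(addrC (hop2 _)) !l2dot_lin hop2_sym (l2dotC y x) (l2dotC (hop2 y)).
Qed.

Let hop2_form (x : l2space R T) : `|l2dot (hop2 x) x| <= M * l2dot x x.
Proof.
have x0 := l2dot_ge0 x.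
rewrite -(@ler_pXn2r _ 2)// ?nnegrE ?mulr_ge0 ?(ltW M0)// real_normK ?num_real//.
apply: (le_trans (cauchy_schwarz (@l2dotC R T) (@l2dot_lin R T) (@l2dot_ge0 R T) _ _)).
apply: (@le_trans _ _ (hnorm2 G * l2dot x x * l2dot x x)); first by rewrite ler_wpM2r ?hop2_bound.
rewrite (_ : (M * _) ^+ 2 = M ^+ 2 * l2dot x x * l2dot x x); last by ring.
do 2 (apply: ler_wpM2r; first by []).
have := hscale_ge1; have := wbound_ge0 G; have := pbound_ge0 G; have := hnorm2_ge0.
rewrite -/M /M /hscale; move: (hnorm2 G) (wbound G) (pbound G) => a b c *; nra.
Qed.

Let sop2_form (x : l2space R T) : l2dot (sop2 x) x = (2 * M)^-1 * (l2dot (hop2 x) x + M * l2dot x x).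
Proof.
rewrite /sop2 -[_ *: _]addr0 l2dot_lin (addrC (hop2 x)) l2dot_lin.
have z u : l2dot (0 : l2space R T) u = 0.
  by have := l2dot_lin 1 0 0 u; rewrite scaler0 addr0 mul1r; lra.
by rewrite z addr0 addrC [X in _ * X]addrC.
Qed.

Lemma sop2_ge0 (x : l2space R T) : 0 <= l2dot (sop2 x) x.
Proof.
rewrite sop2_form; apply: mulr_ge0; first by rewrite invr_ge0 mulr_ge0// ltW.
by have := hop2_form x; rewrite ler_norml; lra.
Qed.

Lemma sop2_le1 (x : l2space R T) : l2dot (sop2 x) x <= l2dot x x.
Proof.
rewrite sop2_form mulrC ler_pdivrMr ?mulr_gt0//.
by have := hop2_form x; rewrite ler_norml; lra.
Qed.

(** As [wbound G + pbound G <= M], the scaled operator is also a contraction in the supremum norm.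
    This keeps all iterates of a comb bounded by [1]. *)
Lemma sop_bound C y : (forall v, `|y v| <= C) -> forall v, `|sop y v| <= C.
Proof.
move=> HC v; have C0 : 0 <= C by apply: le_trans (HC v).
rewrite /sop normrM gtr0_norm ?invr_gt0 ?mulr_gt0// mulrC ler_pdivrMr ?mulr_gt0//.
apply: (le_trans (ler_normD _ _)); rewrite normrM gtr0_norm//.
have h1 := hop_bound HC v; have := HC v => h2.
have wM : wbound G + pbound G <= M by have := hnorm2_ge0; rewrite /M /hscale; lra.
have := ler_wpM2r C0 wM; have := ler_wpM2l (ltW M0) h2; lra.
Qed.

Lemma bounded_sop y : bounded_fun y -> bounded_fun (sop y).
Proof. by move=> [C HC]; exists C; exact: sop_bound. Qed.

Lemma sop_cvg (y_ : nat -> T -> R) y C : (forall n v, `|y_ n v| <= C) ->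
  (forall v, (fun n => y_ n v) @ \oo --> y v) ->
  forall v, (fun n => sop (y_ n) v) @ \oo --> sop y v.
Proof.
move=> HC yy v; apply: cvgM; first exact: cvg_cst.
by apply: cvgD; [exact: (hop_cvg HC)|apply: cvgM; [exact: cvg_cst|exact: yy]].
Qed.

Definition cbounded psi := bounded_fun (fun v => Re (psi v)) /\ bounded_fun (fun v => Im (psi v)).

Definition csop psi v : R[i] := sop (fun v => Re (psi v)) v +i* sop (fun v => Im (psi v)) v.

Lemma cbounded_csop psi : cbounded psi -> cbounded (csop psi).
Proof. by move=> [br bi]; split; exact: bounded_sop. Qed.

Lemma bounded_fun0 : bounded_fun (fun _ : T => 0 : R).
Proof. by exists 0 => v; rewrite normr0. Qed.

Lemma cbounded_lin c psi phi : cbounded psi -> cbounded phi -> cbounded (fun v => c * psi v + phi v).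
Proof.
move=> [br bi] [br' bi']; split.
  rewrite (_ : (fun v => _) = fun v => Re c * Re (psi v) + (- Im c * Im (psi v) + Re (phi v))).
    by do 2 apply: bounded_fun_lin => //.
  by apply/funext => v; rewrite complexReD complexReM; ring.
rewrite (_ : (fun v => _) = fun v => Re c * Im (psi v) + (Im c * Re (psi v) + Im (phi v))).
  by do 2 apply: bounded_fun_lin => //.
by apply/funext => v; rewrite complexImD complexImM; ring.
Qed.

Lemma csop_lin c psi phi : cbounded psi -> cbounded phi ->
  csop (fun v => c * psi v + phi v) = (fun v => c * csop psi v + csop phi v).
Proof.
move=> [br bi] [br' bi']; apply/funext => v; apply: complex_eq; rewrite ?complexReD ?complexImD ?complexReM ?complexImM /=.
  rewrite (_ : (fun v => _) = fun v => Re c * Re (psi v) + (- Im c * Im (psi v) + Re (phi v))).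
    rewrite sop_lin// ?sop_lin//; [ring|exact: bounded_fun_lin].
  by apply/funext => u; rewrite complexReD complexReM; ring.
rewrite (_ : (fun v => _) = fun v => Re c * Im (psi v) + (Im c * Re (psi v) + Im (phi v))).
  rewrite sop_lin// ?sop_lin//; [ring|exact: bounded_fun_lin].
by apply/funext => u; rewrite complexImD complexImM; ring.
Qed.

Lemma schrodingerE psi v : schrodinger psi v =
  hop (fun v => Re (psi v)) v +i* hop (fun v => Im (psi v)) v.
Proof.
rewrite /schrodinger /csum; apply: complex_eq; rewrite ?complexReD ?complexImD ?complexReM ?complexImM /= /hop ?mul0r ?subr0 ?addr0.
  by congr (rsum _ + _); apply/funext => u; rewrite complexReM/= mul0r subr0.
by congr (rsum _ + _); apply/funext => u; rewrite complexImM/= mul0r addr0.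
Qed.

Lemma csopE psi v : csop psi v = (2 * M)^-1%:C * (schrodinger psi v + M%:C * psi v).
Proof.
rewrite schrodingerE; apply: complex_eq; rewrite ?complexReM ?complexImM ?complexReD ?complexImD ?complexReM ?complexImM /= /sop;
  by rewrite ?mul0r ?subr0 ?addr0.
Qed.

End ScaledOperator.

(** * Reduction of the operator to the Floquet matrix *)

Section Bloch.
Variables (R : realType) (d nu : nat) (G : crystal R d nu).
Local Notation T := (vertices G).
Local Notation Z := 'rV[int]_d.
Local Notation Re := complex.Re.
Local Notation Im := complex.Im.
Implicit Types (v : T) (k l m : Z) (theta : 'rV[R]_d) (psi phi : T -> R[i]) (u : 'cV[R[i]]_nu).

Lemma expiD (x y : R) : expi (x + y) = expi x * expi y.
Proof.
by apply: complex_eq; rewrite ?complexReM ?complexImM/= ?cosD ?sinD//; rewrite addrC mulrC.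
Qed.

Lemma expi0 : expi (0 : R) = 1.
Proof. by rewrite /expi cos0 sin0. Qed.

Definition phase theta k : R[i] := expi (2 * pi * \sum_l theta 0 l * (k 0 l)%:~R).

Lemma phaseD theta k l : phase theta (k + l) = phase theta k * phase theta l.
Proof.
rewrite /phase -expiD -mulrDr -big_split/=; congr (expi (_ * _)).
by apply: eq_bigr => i _; rewrite mxE intrD mulrDr.
Qed.

Lemma phase0 theta : phase theta 0 = 1.
Proof. by rewrite /phase big1 ?mulr0 ?expi0// => i _; rewrite mxE mulr0. Qed.

Lemma Re_expi_le1 (x : R) : `|Re (expi x)| <= 1.
Proof. by rewrite ler_norml cos_geN1 cos_le1. Qed.

Lemma Im_expi_le1 (x : R) : `|Im (expi x)| <= 1.
Proof. by rewrite ler_norml sin_geN1 sin_le1. Qed.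

Definition bloch theta u v : R[i] := u (vcoord v).1 0 * phase theta (vcoord v).2.

Lemma bloch_vertex theta u i k : bloch theta u (vertex G (i, k)) = u i 0 * phase theta k.
Proof. by rewrite /bloch vertexK. Qed.

Lemma cbounded_bloch theta u : cbounded (bloch theta u).
Proof.
have H (f : 'I_nu -> R) (x : 'I_nu) : `|f x| <= \sum_i `|f i|.
  by rewrite (bigD1 x)//= lerDl sumr_ge0.
split; exists (\sum_i `|Re (u i 0)| + \sum_i `|Im (u i 0)|) => v; rewrite /bloch ?complexReM ?complexImM.
  apply: (le_trans (ler_normB _ _)); rewrite !normrM lerD//.
    rewrite -[leRHS]mulr1 ler_pM ?Re_expi_le1//; exact: (H (fun i => Re (u i 0))).
  rewrite -[leRHS]mulr1 ler_pM ?Im_expi_le1//; exact: (H (fun i => Im (u i 0))).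
apply: (le_trans (ler_normD _ _)); rewrite !normrM lerD//.
  rewrite -[leRHS]mulr1 ler_pM ?Im_expi_le1//; exact: (H (fun i => Re (u i 0))).
rewrite -[leRHS]mulr1 ler_pM ?Re_expi_le1//; exact: (H (fun i => Im (u i 0))).
Qed.

Lemma vertex_row_inj (j : 'I_nu) : injective (fun k : Z => vertex G (j, k)).
Proof. by move=> k l /vertex_inj[]. Qed.

Lemma rsum_vertex (f : T -> R) : abs_summable f ->
  rsum f = \sum_j rsum (fun k => f (vertex G (j, k))).
Proof.
move=> sf.
pose F (j : 'I_nu) v := if (vcoord v).1 == j then f v else 0.
have sF j : abs_summable (F j).
  apply: (@abs_summable_le _ _ _ (fun v => `|f v|)) => // v.
  by rewrite /F; case: ifP => _; rewrite ?normr0.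
have -> : f = (fun v => \sum_j F j v).
  apply/funext => v; rewrite (bigD1 (vcoord v).1)//= {1}/F eqxx big1 ?addr0// => j jv.
  by rewrite /F eq_sym (negbTE jv).
have [_ ->] := rsum_sum (index_enum 'I_nu) sF; apply: eq_bigr => j _.
rewrite (rsum_reindex (@vertex_row_inj j)).
  congr rsum; apply/funext => k; rewrite {1}/F vertexK/= eqxx.
  by rewrite (bigD1 j)//= /F vertexK/= eqxx big1 ?addr0// => i ij; rewrite eq_sym (negbTE ij).
move=> v H; rewrite /F; case: eqP => // vj; exfalso; apply: (H (vcoord v).2).
by rewrite -vj -surjective_pairing vcoordK.
Qed.

Lemma csum_vertex (f : T -> R[i]) : csummable f ->
  csum f = \sum_j csum (fun k => f (vertex G (j, k))).
Proof.
by move=> [sr si]; apply: complex_eq; rewrite ?Re_sum ?Im_sum/= rsum_vertex.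
Qed.

Lemma wt_vertex i j k l : wt (vertex G (i, k)) (vertex G (j, k + l)) = cell_weight G i j l.
Proof.
rewrite -(add0r k) -(addrC l) addrA addr0 -[vertex G (i, 0 + k)]vshift_vertex.
rewrite -[vertex G (j, l + k)]vshift_vertex wt_shift.
by rewrite /wt /cell_weight /= translation0 addr0.
Qed.

Lemma csummable_wt v psi : cbounded psi -> csummable (fun v' => (wt v v')%:C * psi v').
Proof.
move=> [br bi]; split.
  have := abs_summable_wt_bounded v br; congr abs_summable; apply/funext => u.
  by rewrite complexReM/= mul0r subr0.
have := abs_summable_wt_bounded v bi; congr abs_summable; apply/funext => u.
by rewrite complexImM/= mul0r addr0.
Qed.

Lemma csummable_cell_weight theta i j :
  csummable (fun k => (cell_weight G i j k)%:C * phase theta k).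
Proof.
have sw : (\esum_(k in [set: Z]) (`|cell_weight G i j k|)%:E < +oo)%E.
  have := abs_summable_wt (vertex G (i, 0)); rewrite /abs_summable; apply: le_lt_trans.
  have -> : \esum_(k in [set: Z]) (`|cell_weight G i j k|)%:E =
      \esum_(v in [set vertex G (j, k) | k in [set: Z]]) (`|wt (vertex G (i, 0)) v|)%:E.
    rewrite esum_image; last by move=> k l _ _; exact: vertex_row_inj.
    by apply: eq_esum => k _; rewrite -[k in RHS]add0r wt_vertex.
  by rewrite esum_mkcond; apply: le_esum => v _; case: ifP => // _.
split; apply: abs_summable_le sw => k; rewrite ?complexReM ?complexImM /= mul0r ?subr0 ?addr0 normrM.
  by rewrite -[leRHS]mulr1 ler_wpM2l// Re_expi_le1.
by rewrite -[leRHS]mulr1 ler_wpM2l// Im_expi_le1.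
Qed.

(** Periodicity of the weights: substituting [m + k] for the summation index pulls the phase at [m]
    out of the sum and leaves a Floquet entry. The potential is spread over [j] as the diagonal part
    of the matrix. *)
Lemma schrodinger_bloch theta u :
  schrodinger (bloch theta u) = bloch theta (floquet G theta *m u).
Proof.
apply/funext => v; rewrite -(vcoordK v); case: (vcoord v) => i m.
rewrite [LHS]/schrodinger csum_vertex; last first.
  by apply: csummable_wt; exact: cbounded_bloch.
rewrite !bloch_vertex mxE mulr_suml.
rewrite (_ : (potential G _)%:C * _ = \sum_j ((potential G (cell G i))%:C *+ (i == j)) * u j 0 * phase theta m); last first.
  rewrite (bigD1 i)//= eqxx mulr1n big1 ?addr0 => [|j ij]; last by rewrite eq_sym (negbTE ij) mulr0n !mul0r.
  rewrite mulrA; congr (_%:C * _ * _).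
  by have := pot_shift m (vertex G (i, 0)); rewrite vshift_vertex add0r /pot/= translation0 addr0.
rewrite -big_split/=; apply: eq_bigr => j _.
rewrite mxE; set S := csum (fun k : Z => _ * expi _).
rewrite (mulrDl S) (mulrDl (S * _)); congr (_ + _).
rewrite (csum_reindex (e := fun k => m + k)); last 2 first.
- exact: addrI.
- by move=> t H; exfalso; apply: (H (t - m)); rewrite addrC subrK.
transitivity (csum (fun k => (phase theta m * u j 0) * ((cell_weight G i j k)%:C * phase theta k))).
  congr csum; apply/funext => k.
  rewrite bloch_vertex phaseD -[weight _ _ _]/(wt (vertex G (i, m)) (vertex G (j, m + k))) wt_vertex.
  ring.
rewrite csumZ; last exact: csummable_cell_weight.
rewrite -[csum _]/S; ring.
Qed.

End Bloch.

(** * The trace formula *)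

Section TracePower.
Variables (C : numClosedFieldType) (n : nat).
Hypothesis n0 : (0 < n)%N.
Implicit Types (A B : 'M[C]_n).

Definition mxpow A p : 'M[C]_n := iter p (mulmx A) 1%:M.

Lemma trig_mul A B : is_trig_mx A -> is_trig_mx B ->
  is_trig_mx (A *m B) /\ forall i, (A *m B) i i = A i i * B i i.
Proof.
move=> /is_trig_mxP tA /is_trig_mxP tB; split.
  apply/is_trig_mxP => i j ij; rewrite mxE big1// => k _.
  have [ik|ki] := ltnP i k; first by rewrite tA ?mul0r.
  by rewrite (tB k j) ?mulr0// (leq_ltn_trans ki).
move=> i; rewrite mxE (bigD1 i)//= big1 ?addr0// => k ki.
have [ik|ik] := ltnP i k; first by rewrite tA ?mul0r.
by rewrite (tB k i) ?mulr0// ltn_neqAle ki.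
Qed.

Lemma trig_pow A p : is_trig_mx A ->
  is_trig_mx (mxpow A p) /\ forall i, mxpow A p i i = A i i ^+ p.
Proof.
move=> tA; elim: p => [|p [IH1 IH2]].
  by split; [exact: scalar_mx_is_trig|move=> i; rewrite /= mxE eqxx].
have [h1 h2] := trig_mul tA IH1; split=> // i.
by rewrite -[mxpow A p.+1]/(A *m mxpow A p) h2 IH2 exprS.
Qed.

(** By Schur's theorem [A] is similar to a triangular matrix [T]. The diagonal of [T] is a
    permutation of [E], by unique factorization of the characteristic polynomial, and powers of a
    triangular matrix have the powered diagonal. *)
Lemma trace_mxpow A (E : 'I_n -> C) (a b : C) p :
  char_poly A = \prod_j ('X - (E j)%:P) ->
  \tr (mxpow (a *: (A + b%:M)) p) = \sum_j (a * (E j + b)) ^+ p.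
Proof.
move=> cA; have [P Pu] := Schur A n0; rewrite /similar_to => tT.
have uP : P \in unitmx by exact: unitarymx_unit.
set T := conjmx P A in tT.
have PT : P *m A = T *m P by rewrite /T conjumx// mulmxKV.
have cT : char_poly T = char_poly A.
  have e : map_mx polyC P *m char_poly_mx A = char_poly_mx T *m map_mx polyC P.
    rewrite /char_poly_mx mulmxBr mulmxBl -!map_mxM PT; congr (_ - _).
    by rewrite scalar_mxC.
  have nz : \det (map_mx polyC P) != 0 by rewrite det_map_mx polyC_eq0 -unitfE -unitmxE.
  have := congr1 determinant e; rewrite !det_mulmx mulrC => e'.
  by apply/esym; exact: (mulIf nz e').
have Tp : perm_eq [seq T i i | i <- index_enum 'I_n] [seq E i | i <- index_enum 'I_n].
  by apply: prod_XsubC_eq; rewrite !big_map -cA -cT char_poly_trig.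
have tT' : is_trig_mx (a *: (T + b%:M)).
  apply/is_trig_mxP => i j ij; rewrite mxE mxE ((is_trig_mxP tT) i j ij) add0r mxE.
  by case: eqP => [e|_]; [rewrite e ltnn in ij|rewrite mulr0n mulr0].
have PS : P *m (a *: (A + b%:M)) = a *: (T + b%:M) *m P.
  by rewrite -scalemxAr -scalemxAl mulmxDr mulmxDl PT scalar_mxC.
have Pp : P *m mxpow (a *: (A + b%:M)) p = mxpow (a *: (T + b%:M)) p *m P.
  elim: p => [|p IH]; first by rewrite /= mulmx1 mul1mx.
  by rewrite -[mxpow _ _.+1]/(_ *m mxpow _ p) mulmxA PS -mulmxA IH mulmxA.
have -> : mxpow (a *: (A + b%:M)) p = invmx P *m (mxpow (a *: (T + b%:M)) p *m P).
  by rewrite -Pp mulKmx.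
rewrite mxtrace_mulC -mulmxA mulmxV// mulmx1 /mxtrace.
have [_ dT] := trig_pow p tT'.
transitivity (\sum_(t <- [seq T i i | i <- index_enum 'I_n]) (a * (t + b)) ^+ p).
  by rewrite big_map; apply: eq_bigr => i _; rewrite dT !mxE eqxx mulr1n.
by rewrite (perm_big _ Tp)/= big_map.
Qed.

End TracePower.

Lemma cvg_fsum (R : realType) (I : Type) (r : seq I) (F : I -> nat -> R) (L : I -> R) :
  (forall i, F i @ \oo --> L i) ->
  (fun n => \sum_(i <- r) F i n) @ \oo --> \sum_(i <- r) L i.
Proof.
move=> FL; elim: r => [|i r IH].
  by under eq_fun do rewrite big_nil; rewrite big_nil; exact: cvg_cst.
by under eq_fun do rewrite big_cons; rewrite big_cons; exact: cvgD.
Qed.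

(** * Grid averages and spectral moments *)

Section TraceFormula.
Variables (R : realType) (d nu : nat) (G : crystal R d nu).
Hypothesis nu0 : (0 < nu)%N.
Local Notation T := (vertices G).
Local Notation Z := 'rV[int]_d.
Local Notation Re := complex.Re.
Local Notation Im := complex.Im.
Implicit Types (v : T) (k l m : Z) (theta : 'rV[R]_d) (psi phi : T -> R[i]) (u : 'cV[R[i]]_nu).

Local Notation M := (hscale G).

Definition sfloquet theta : 'M[R[i]]_nu := (2 * M)^-1%:C *: (floquet G theta + (M%:C)%:M).

Lemma csop_bloch theta u : csop (bloch (G := G) theta u) = bloch theta (sfloquet theta *m u).
Proof.
apply/funext => v; rewrite csopE schrodinger_bloch /bloch /sfloquet.
rewrite -scalemxAl mulmxDl mul_scalar_mx [in RHS]mxE [in RHS]mxE [X in _ = _ * (_ + X) * _]mxE.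
ring.
Qed.

Lemma iter_csop_bloch theta u p :
  iter p (@csop R d nu G) (bloch (G := G) theta u) = bloch theta (mxpow (sfloquet theta) p *m u).
Proof.
elim: p => [|p IH]; first by rewrite /= mul1mx.
by rewrite iterS IH csop_bloch mulmxA.
Qed.

(** The iterate of the Bloch wave of the unit vector [j], read at the vertex [j] of the cell at the
    origin, is the diagonal entry [j]. *)
Lemma trace_bloch theta p :
  \tr (mxpow (sfloquet theta) p) =
  \sum_j iter p (@csop R d nu G) (bloch (G := G) theta (delta_mx j 0)) (vertex G (j, 0)).
Proof.
apply: eq_bigr => j _; rewrite iter_csop_bloch bloch_vertex phase0 mulr1.
by rewrite -colE mxE.
Qed.

(** The offset [theta0] is [0] for the absolutely continuous case; for a flat band it is the corner
    of the flat cube. *)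
Definition gridpt (theta0 : 'rV[R]_d) N (n : {ffun 'I_d -> 'I_N}) : 'rV[R]_d :=
  \row_l (theta0 0 l + (n l)%:R / N%:R).

(* A Dirac comb: it equals [cdelta (vertex G (j, 0))] on the cells [k] with all [`|k 0 l| < N]. *)
Definition comb theta0 N j v : R[i] :=
  ((N ^ d)%:R : R)^-1%:C * \sum_n bloch (G := G) (gridpt theta0 (N := N) n) (delta_mx j 0) v.

Lemma csop_sum (I : Type) (r : seq I) (F : I -> T -> R[i]) : (forall i, cbounded (F i)) ->
  cbounded (fun v => \sum_(i <- r) F i v) /\
  csop (fun v => \sum_(i <- r) F i v) = (fun v => \sum_(i <- r) csop (F i) v).
Proof.
have c0 : cbounded (fun _ : T => 0 : R[i]) by split; exact: bounded_fun0.
move=> cF; elim: r => [|i r [IH1 IH2]].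
  under eq_fun do rewrite big_nil; under [in RHS]eq_fun do rewrite big_nil; split=> //.
  have := csop_lin (-1) c0 c0; under eq_fun do rewrite mulr0 addr0.
  by move=> ->; apply/funext => v; rewrite mulN1r addNr.
have E (f : I -> T -> R[i]) : (fun v => \sum_(j <- i :: r) f j v) = (fun v => 1 * f i v + \sum_(j <- r) f j v).
  by apply/funext => v; rewrite big_cons mul1r.
rewrite E [in RHS](E (fun i => csop (F i))); split; first exact: cbounded_lin.
by rewrite csop_lin// IH2.
Qed.

Lemma iter_csop_comb theta0 N j p :
  cbounded (iter p (@csop R d nu G) (comb theta0 N j)) /\
  iter p (@csop R d nu G) (comb theta0 N j) = fun v =>
  ((N ^ d)%:R : R)^-1%:C *
    \sum_n iter p (@csop R d nu G) (bloch (G := G) (gridpt theta0 (N := N) n) (delta_mx j 0)) v.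
Proof.
have c0 : cbounded (fun _ : T => 0 : R[i]) by split; exact: bounded_fun0.
have cZ (c : R[i]) psi : cbounded psi -> cbounded (fun v => c * psi v).
  by move=> b; have := cbounded_lin c b c0; under eq_fun do rewrite addr0.
have cb n q : cbounded (iter q (@csop R d nu G) (bloch (G := G) (gridpt theta0 (N := N) n) (delta_mx j 0))).
  by rewrite iter_csop_bloch; exact: cbounded_bloch.
have cs q := csop_sum (index_enum {ffun 'I_d -> 'I_N}) (cb ^~ q).
elim: p => [|p [IH1 IH2]].
  by split=> //; apply: cZ; case: (cs 0).
split; first by rewrite iterS; exact: cbounded_csop.
have [s1 s2] := cs p.
rewrite iterS IH2; have := csop_lin (((N ^ d)%:R : R)^-1%:C) s1 c0.
under eq_fun do rewrite addr0; move=> ->; rewrite s2; apply/funext => v.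
have -> : csop (fun _ : T => 0 : R[i]) v = 0.
  have := csop_lin (-1) c0 c0; under eq_fun do rewrite mulr0 addr0.
  by move=> ->; rewrite mulN1r addNr.
by rewrite addr0.
Qed.

Lemma expi_sum (I : Type) (r : seq I) (F : I -> R) :
  expi (\sum_(i <- r) F i) = \prod_(i <- r) expi (F i).
Proof. by elim: r => [|i r IH]; rewrite ?big_nil ?expi0// !big_cons expiD IH. Qed.

Lemma expiMn (x : R) n : expi (x * n%:R) = expi x ^+ n.
Proof. by elim: n => [|n IH]; rewrite ?mulr0 ?expi0// -natr1 mulrDr mulr1 expiD IH exprSr. Qed.

Lemma expi_2pi_int (z : int) : expi (2 * pi * z%:~R : R) = 1.
Proof.
have e1 : expi (2 * pi : R) = 1.
  have -> : (2 * pi : R) = pi + pi by ring.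
  by rewrite expiD /expi cospi sinpi; apply: complex_eq; rewrite ?complexReM ?complexImM/=; ring.
have nat_case n : expi (2 * pi * n%:R : R) = 1 by rewrite expiMn e1 expr1n.
case: z => n; first exact: nat_case.
rewrite NegzE mulrNz mulrN.
have := @expiD R (- (2 * pi * n.+1%:R)) (2 * pi * n.+1%:R).
by rewrite [X in expi X]addNr expi0 nat_case mulr1 => <-.
Qed.

(** [cos x = 1 - 2 * sin (x / 2) ^ 2], and the sine is positive on []0, pi[]. *)
Lemma expi_neq1 (x : R) : 0 < x < 2 * pi -> expi x != 1.
Proof.
move=> /andP[x0 x1]; apply/eqP => /(congr1 (@complex.Re R)) /= c1.
have s : 0 < sin (x / 2).
  by apply: sin_gt0_pi; rewrite divr_gt0//= ltr_pdivrMr// mulrC.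
have := cosD (x / 2) (x / 2); rewrite -splitr c1; have := cos2Dsin2 (x / 2); nra.
Qed.

(** A geometric sum of an [N]-th root of unity [w]; the condition [0 < |z| < N] ensures [w != 1]. *)
Lemma sum_expi_root N (z : int) : (0 < N)%N -> z != 0 -> (`|z| < N)%N ->
  \sum_(n < N) expi (2 * pi * ((n%:R / N%:R) * z%:~R) : R) = 0.
Proof.
move=> N0 z0 zN; have N0' : 0 < N%:R :> R by rewrite ltr0n.
pose w := expi (2 * pi * (z%:~R / N%:R) : R).
have -> : \sum_(n < N) expi (2 * pi * ((n%:R / N%:R) * z%:~R) : R) = \sum_(n < N) w ^+ n.
  apply: eq_bigr => n _; rewrite -expiMn; congr expi.
  by rewrite -!mulrA; congr (_ * (_ * _)); rewrite mulrC -mulrA [in RHS]mulrC; ring.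
have wN : w ^+ N = 1.
  by rewrite -expiMn -!mulrA mulVf ?gt_eqF// mulr1 mulrA expi_2pi_int.
have w1 : w != 1.
  have p0 : 0 < pi :> R := pi_gt0 R.
  case: z z0 zN @w wN => n z0 zN w wN.
    have n0 : 0 < n%:R :> R by rewrite ltr0n lt0n; apply: contraNneq z0 => ->.
    have i0 : 0 < (N%:R)^-1 :> R by rewrite invr_gt0.
    apply: expi_neq1; apply/andP; split; first by rewrite !mulr_gt0.
    by rewrite gtr_pMr ?mulr_gt0// ltr_pdivrMr// mul1r ltr_nat.
  have : expi (2 * pi * (n.+1%:R / N%:R) : R) != 1.
    have i0 : 0 < (N%:R)^-1 :> R by rewrite invr_gt0.
    apply: expi_neq1; apply/andP; split; first by rewrite !mulr_gt0 ?ltr0n.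
    by rewrite gtr_pMr ?mulr_gt0// ltr_pdivrMr// mul1r ltr_nat.
  apply: contraNneq => wE; rewrite /w NegzE mulrNz mulNr mulrN in wE.
  by have := expiD (- (2 * pi * (n.+1%:R / N%:R))) (2 * pi * (n.+1%:R / N%:R) : R);
    rewrite addNr expi0 wE mul1r => <-.
by apply/eqP; rewrite -(mulrI_eq0 _ (@mulfI _ (w - 1) _)) ?subr_eq0// -subrX1 wN subrr eqxx.
Qed.

(** The sum factors over the coordinates, where the offset contributes constant factors; a
    coordinate with [k 0 l != 0] gives a vanishing sum over roots of unity. *)
Lemma sum_phase_grid theta0 N k : (0 < N)%N -> k != 0 -> (forall l : 'I_d, (`|(k 0%R l)%R|%N < N)%N) ->
  \sum_n phase (gridpt theta0 (N := N) n) k = 0.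
Proof.
move=> N0 k0 kN.
have -> : \sum_n phase (gridpt theta0 (N := N) n) k =
    \prod_(l < d) \sum_(n < N) expi (2 * pi * ((theta0 0 l + n%:R / N%:R) * (k 0 l)%:~R)).
  rewrite bigA_distr_bigA/=; apply: eq_bigr => n _; rewrite /phase mulr_sumr expi_sum.
  by apply: eq_bigr => l _; rewrite mxE.
have [l kl] : exists l : 'I_d, k 0 l != 0.
  apply: contrapT => H; move/eqP: k0; apply; apply/rowP => l; rewrite mxE.
  by apply: contrapT => /eqP kl; apply: H; exists l.
rewrite (bigD1 l)//=.
under eq_bigr do rewrite (mulrDl (theta0 0 l)) mulrDr expiD.
by rewrite -mulr_sumr sum_expi_root ?mulr0 ?mul0r.
Qed.

Lemma comb_vertex theta0 N j i k : (0 < N)%N -> (forall l : 'I_d, (`|(k 0%R l)%R|%N < N)%N) ->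
  comb theta0 N j (vertex G (i, k)) = ((i == j) && (k == 0))%:R.
Proof.
move=> N0 kN; rewrite /comb.
under eq_bigr do rewrite bloch_vertex mxE eqxx andbT.
rewrite -mulr_sumr; have [->|k0] := eqVneq k 0; last by rewrite sum_phase_grid// !mulr0 andbF.
under eq_bigr do rewrite phase0.
rewrite sumr_const card_ffun !card_ord andbT mulrCA.
have Nd : ((N ^ d)%:R : R) != 0 by rewrite pnatr_eq0 expn_eq0 negb_and -lt0n N0.
suff -> : ((N ^ d)%:R : R)^-1%:C * (1 *+ (N ^ d)) = 1 :> R[i] by rewrite mulr1.
have -> : (1 : R[i]) *+ (N ^ d) = ((N ^ d)%:R : R)%:C by rewrite raddfMn.
by rewrite -rmorphM/= mulVf.
Qed.

Lemma comb_bound theta0 N j v : (0 < N)%N ->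
  `|Re (comb theta0 N j v)| <= 1 /\ `|Im (comb theta0 N j v)| <= 1.
Proof.
move=> N0; have Nd : 0 < ((N ^ d)%:R : R) by rewrite ltr0n expn_gt0 N0.
have H (F : {ffun 'I_d -> 'I_N} -> R) : (forall n, `|F n| <= 1) ->
    `|((N ^ d)%:R : R)^-1 * \sum_n F n| <= 1.
  move=> HF; rewrite normrM gtr0_norm ?invr_gt0// mulrC ler_pdivrMr// mul1r.
  apply: (le_trans (ler_norm_sum _ _ _)).
  apply: (@le_trans _ _ (\sum_(n : {ffun 'I_d -> 'I_N}) 1)); first exact: ler_sum.
  by rewrite sumr_const card_ffun !card_ord.
rewrite /comb.
rewrite complexReM complexImM /= !mul0r subr0 addr0 Re_sum Im_sum.
by split; apply: H => n; rewrite /bloch mxE eqxx andbT; case: (_ == j);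
  rewrite ?mul1r ?mul0r/= ?normr0// ?Re_expi_le1 ?Im_expi_le1.
Qed.

Definition cdelta (v0 v : T) : R[i] := (v == v0)%:R.

(** At each vertex the comb is eventually equal to the delta function, its other teeth having moved
    away. *)
Lemma comb_cvg theta0 j v :
  (fun N => Re (comb theta0 N.+1 j v)) @ \oo --> Re (cdelta (vertex G (j, 0)) v) /\
  (fun N => Im (comb theta0 N.+1 j v)) @ \oo --> Im (cdelta (vertex G (j, 0)) v).
Proof.
have E : \forall N \near \oo, comb theta0 N.+1 j v = cdelta (vertex G (j, 0)) v.
  rewrite -(vcoordK v); case: (vcoord v) => i k.
  exists (\max_l `|(k 0%R l)%R|%N) => // N /= HN; rewrite comb_vertex//; last first.
    by move=> l; rewrite ltnS (leq_trans _ HN)// leq_bigmax.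
  rewrite /cdelta; congr (nat_of_bool _)%:R.
  by apply/andP/eqP => [[/eqP-> /eqP->]//|/vertex_inj[-> ->]].
split; apply: cvg_near_cst; near=> N; rewrite (_ : comb _ _ _ _ = cdelta (vertex G (j, 0)) v)//;
  near: N; exact: E.
Unshelve. all: by end_near. Qed.

(** The induction carries the uniform bound [1] along with convergence of both parts, since [sop]
    preserves pointwise limits only under a uniform bound. *)
Lemma iter_csop_cvg theta0 j p v :
  (fun N => Re (iter p (@csop R d nu G) (comb theta0 N.+1 j) v)) @ \oo -->
    Re (iter p (@csop R d nu G) (cdelta (vertex G (j, 0))) v).
Proof.
suff : (forall N v, `|Re (iter p (@csop R d nu G) (comb theta0 N.+1 j) v)| <= 1 /\
          `|Im (iter p (@csop R d nu G) (comb theta0 N.+1 j) v)| <= 1) /\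
   forall v, (fun N => Re (iter p (@csop R d nu G) (comb theta0 N.+1 j) v)) @ \oo -->
    Re (iter p (@csop R d nu G) (cdelta (vertex G (j, 0))) v) /\
   (fun N => Im (iter p (@csop R d nu G) (comb theta0 N.+1 j) v)) @ \oo -->
    Im (iter p (@csop R d nu G) (cdelta (vertex G (j, 0))) v).
  by move=> [_ /(_ v)[]].
elim: p => [|p [IH1 IH2]].
  by split=> [N u|u]; [exact: comb_bound|exact: comb_cvg].
split=> [N u|u].
  by split; apply: sop_bound => w; case: (IH1 N w).
split.
  by apply: (sop_cvg (C := 1)) => [N w|w]; [case: (IH1 N w)|case: (IH2 w)].
by apply: (sop_cvg (C := 1)) => [N w|w]; [case: (IH1 N w)|case: (IH2 w)].
Qed.

Lemma iter_csop_delta p (v0 v : T) :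
  iter p (@csop R d nu G) (cdelta v0) v = (iter p (@sop2 R d nu G) (l2delta R v0) v)%:C.
Proof.
elim: p v => [|p IH] v; first by rewrite -[RHS]/(l2delta R v0 v)%:C l2deltaE /= /cdelta; case: (v == v0).
have e0 : sop (fun _ : T => 0 : R) v = 0.
  have := sop_lin (-1) (bounded_fun0 G) (bounded_fun0 G); under eq_fun do rewrite mulr0 addr0.
  by move=> ->; rewrite mulN1r addNr.
rewrite !iterS sop2E /csop.
have -> : (fun v => Re (iter p (@csop R d nu G) (cdelta v0) v)) = iter p (@sop2 R d nu G) (l2delta R v0).
  by apply/funext => w; rewrite IH.
have -> : (fun v => Im (iter p (@csop R d nu G) (cdelta v0) v)) = fun=> 0.
  by apply/funext => w; rewrite IH.
by rewrite e0.
Qed.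

Variable E : 'I_nu -> 'rV[R]_d -> R.
Hypothesis hE : floquet_eigenvalues G E.

Definition scaled_eigenvalue j theta : R := (2 * M)^-1 * (E j theta + M).

Lemma trace_sfloquet theta p : \tr (mxpow (sfloquet theta) p) = (\sum_j scaled_eigenvalue j theta ^+ p)%:C.
Proof.
have [_ cE] := hE theta.
rewrite /sfloquet (trace_mxpow nu0 _ _ p cE).
rewrite -[RHS]/(_%:C) raddf_sum; apply: eq_bigr => j _.
by rewrite -rmorphD -rmorphM -rmorphXn.
Qed.

(* Density of states: the spectral moments per cell are limits of grid averages. *)
Lemma trace_formula theta0 p :
  (fun N => ((N.+1 ^ d)%:R)^-1 * \sum_n \sum_j scaled_eigenvalue j (gridpt theta0 (N := N.+1) n) ^+ p) @ \oo -->
  \sum_j l2dot (iter p (@sop2 R d nu G) (l2delta R (vertex G (j, 0)))) (l2delta R (vertex G (j, 0))).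
Proof.
(* By linearity and [trace_bloch], the grid average of the traces is the iterated operator applied
   to the comb, read on the diagonal of the cell. *)
have -> : (fun N => ((N.+1 ^ d)%:R)^-1 * \sum_n \sum_j scaled_eigenvalue j (gridpt theta0 (N := N.+1) n) ^+ p) =
   (fun N => \sum_j Re (iter p (@csop R d nu G) (comb theta0 N.+1 j) (vertex G (j, 0)))).
  apply/funext => N; rewrite -Re_sum.
  under [in RHS]eq_bigr do rewrite (iter_csop_comb _ _ _ _).2.
  rewrite -mulr_sumr complexReM/= mul0r subr0 Re_sum; congr (_ * _).
  under [RHS]eq_bigr do rewrite Re_sum; rewrite [RHS]exchange_big/=.
  by apply: eq_bigr => n _; rewrite -Re_sum -trace_bloch trace_sfloquet.
apply: cvg_fsum => j.
have := @iter_csop_cvg theta0 j p (vertex G (j, 0)).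
by rewrite iter_csop_delta/= l2dotC l2dot_delta.
Qed.

End TraceFormula.

(** * The density of states *)

Section CrystalSpectrum.
Variables (R : realType) (d nu : nat) (G : crystal R d nu).
Local Notation T := (vertices G).
Local Notation H2 := (l2space R T).

Definition smu (x : H2) : {measure set (measurableTypeR R) -> \bar R} :=
  spectral_mu (@l2dotC R T) (@l2dot_lin R T) (@l2dot_ge0 R T) (@l2dot_eq0 R T)
    (@sop2_lin R d nu G) (@sop2_sym R d nu G) (@sop2_ge0 R d nu G) (@sop2_le1 R d nu G) x.

Definition sproj (B : set (measurableTypeR R)) (x : H2) : H2 :=
  spectral_proj (@l2dotC R T) (@l2dot_lin R T) (@l2dot_ge0 R T) (@l2dot_eq0 R T) (@l2_riesz R T)
    (@sop2_lin R d nu G) (@sop2_sym R d nu G) (@sop2_ge0 R d nu G) (@sop2_le1 R d nu G) B x.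

Lemma smu_fin x : (smu x setT < +oo)%E. Proof. exact: spectral_mu_fin. Qed.

Lemma smuX x k : integral01 (smu x) (fun s => s ^+ k) = l2dot (iter k (@sop2 R d nu G) x) x.
Proof. exact: spectral_muX. Qed.

Lemma sproj_diag B x : measurable B -> l2dot (sproj B x) x = integral01 (smu x) \1_B.
Proof. exact: spectral_proj_diag. Qed.

(** The values of [|y|] come arbitrarily close to the supremum, which is compared with the supremum
    bound on [hop y]. *)
Lemma hop_eigen_bound (y : T -> R) (e : R) : bounded_fun y -> (forall v, hop y v = e * y v) ->
  (exists v, y v != 0) -> `|e| <= wbound G + pbound G.
Proof.
move=> [C0 HC0] He [v0 yv0].
pose S := [set `|y v| | v in [set: T]].
have S0 : S !=set0 by exists `|y v0|; exists v0.
have Sub : has_ubound S by exists C0 => _ [v _ <-].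
have HC v : `|y v| <= sup S by apply: ub_le_sup => //; exists v.
have C_gt0 : 0 < sup S by rewrite (lt_le_trans _ (HC v0))// normr_gt0.
have B0 : 0 <= wbound G + pbound G by rewrite addr_ge0 ?wbound_ge0 ?pbound_ge0.
have [->|e0] := eqVneq e 0; first by rewrite normr0.
have e1 : 0 < `|e| by rewrite normr_gt0.
rewrite -(ler_pM2r C_gt0) mulrC -ler_pdivlMr//.
apply: ge_sup => // _ [v _ <-]; rewrite ler_pdivlMr// mulrC -normrM -He.
exact: hop_bound.
Qed.

Hypothesis nu0 : (0 < nu)%N.
Variable E : 'I_nu -> 'rV[R]_d -> R.
Hypothesis hE : floquet_eigenvalues G E.

Local Notation sE := (@scaled_eigenvalue R d nu G E).

(** [eigenvalueP] yields a row vector, while Bloch waves are built on columns; the determinant of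
    the transpose converts one into the other. *)
Lemma floquet_eigenvector j theta :
  exists2 u : 'cV[R[i]]_nu, u != 0 & floquet G theta *m u = (E j theta)%:C *: u.
Proof.
have [_ cE] := hE theta; set F := floquet G theta; set a := (E j theta)%:C.
have : root (char_poly F) a.
  by rewrite cE rootE horner_prod (bigD1 j)//= !hornerE subrr mul0r.
rewrite -eigenvalue_root_char => /eigenvalueP[v Hv v0].
have : \det (F - a%:M)^T == 0.
  rewrite det_tr; apply/det0P; exists v => //.
  by rewrite mulmxBr Hv mul_mx_scalar subrr.
move=> /det0P[w w0 Hw]; exists w^T; first by rewrite trmx_eq0.
have := congr1 (@trmx _ _ _) Hw; rewrite trmx_mul trmxK trmx0 mulmxBl mul_scalar_mx.
by move=> /eqP; rewrite subr_eq0 => /eqP.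
Qed.

(** The Bloch wave of an eigenvector is a bounded eigenfunction of the operator, and its real or its
    imaginary part is nonzero at a vertex of the cell at the origin. *)
Lemma floquet_eigenvalue_bound j theta : `|E j theta| <= wbound G + pbound G.
Proof.
have [u u0 Hu] := floquet_eigenvector j theta.
have Hb v : schrodinger (bloch (G := G) theta u) v = (E j theta)%:C * bloch theta u v.
  by rewrite schrodinger_bloch Hu /bloch mxE mulrA.
have [br bi] := @cbounded_bloch R d nu G theta u.
have [i ui] : exists i, u i 0 != 0.
  apply: contrapT => H; move/eqP: u0; apply; apply/colP => i; rewrite mxE.
  by apply: contrapT => /eqP ui; apply: H; exists i.
have ub : bloch theta u (vertex G (i, 0)) = u i 0 by rewrite bloch_vertex phase0 mulr1.
have [re0|re0] := eqVneq (complex.Re (u i 0)) 0; last first.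
  apply: (hop_eigen_bound br); last by exists (vertex G (i, 0)); rewrite ub.
  by move=> v; have := congr1 (@complex.Re R) (Hb v); rewrite schrodingerE complexReM/= mul0r subr0.
apply: (hop_eigen_bound bi).
  by move=> v; have := congr1 (@complex.Im R) (Hb v); rewrite schrodingerE complexImM/= mul0r addr0.
exists (vertex G (i, 0)); rewrite ub; apply: contraNneq ui => im0.
by apply/eqP; exact: complex_eq.
Qed.

Lemma sE_itv j theta : 0 <= sE j theta <= 1.
Proof.
have M0 := hscale_gt0 G; have b := floquet_eigenvalue_bound j theta.
have bM : wbound G + pbound G <= hscale G by have := hnorm2_ge0 G; rewrite /hscale; lra.
have := le_trans b bM; rewrite ler_norml => /andP[b1 b2].
rewrite /scaled_eigenvalue; apply/andP; split; first by rewrite mulr_ge0 ?invr_ge0; lra.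
by rewrite mulrC ler_pdivrMr ?mulr_gt0//; lra.
Qed.

Definition grid_avg (theta0 : 'rV[R]_d) (f : R -> R) N : R :=
  ((N.+1 ^ d)%:R)^-1 * \sum_n \sum_j f (sE j (gridpt theta0 (N := N.+1) n)).

Definition cell_state j : H2 := l2delta R (vertex G (j, 0)).

Definition state_density (f : R -> R) : R := \sum_j integral01 (smu (cell_state j)) f.

Lemma grid_avg_lin theta0 (I : Type) (r : seq I) (c : I -> R) (f : I -> R -> R) N :
  grid_avg theta0 (fun x => \sum_(i <- r) c i * f i x) N = \sum_(i <- r) c i * grid_avg theta0 (f i) N.
Proof.
under [RHS]eq_bigr do rewrite /grid_avg mulrCA; rewrite -mulr_sumr; congr (_ * _).
under [RHS]eq_bigr do rewrite mulr_sumr; rewrite [RHS]exchange_big; apply: eq_bigr => n _.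
under [RHS]eq_bigr do rewrite mulr_sumr; rewrite [RHS]exchange_big; apply: eq_bigr => j _.
by [].
Qed.

Lemma grid_avg_poly theta0 (p : {poly R}) :
  grid_avg theta0 (horner p) @ \oo --> state_density (horner p).
Proof.
have -> : horner p = fun x => \sum_(i < size p) p`_i * x ^+ i.
  by apply/funext => x; rewrite horner_coef.
rewrite (_ : grid_avg _ _ = fun N => \sum_(i < size p) p`_i * grid_avg theta0 (fun x => x ^+ i) N); last first.
  by apply/funext => N; rewrite grid_avg_lin.
have -> : state_density (fun x => \sum_(i < size p) p`_i * x ^+ i) =
    \sum_(i < size p) p`_i * state_density (fun x => x ^+ i).
  under [RHS]eq_bigr do rewrite mulr_sumr; rewrite exchange_big; apply: eq_bigr => j _.
  have [_ ->] := @integral01_sum R (smu (cell_state j)) (smu_fin _) _ (fun (i : 'I_(size p)) x => p`_i * x ^+ i)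
    (fun i => bounded_measurableZ _ (bounded_measurableX _ i)).
  by apply: eq_bigr => i _; rewrite (integral01Z (smu_fin _))//; exact: bounded_measurableX.
apply: cvg_fsum => i; apply: cvgM; first exact: cvg_cst.
have := trace_formula nu0 hE theta0 (p := i); rewrite /state_density.
by under eq_bigr do rewrite -smuX.
Qed.

Lemma grid_avg_le theta0 (f g : R -> R) N : (forall x, 0 <= x <= 1 -> f x <= g x) ->
  grid_avg theta0 f N <= grid_avg theta0 g N.
Proof.
move=> fg; rewrite ler_wpM2l ?invr_ge0// ler_sum// => n _; rewrite ler_sum// => j _.
exact/fg/sE_itv.
Qed.

Lemma state_density_le (f g : R -> R) : bounded_measurable f -> bounded_measurable g ->
  (forall x, 0 <= x <= 1 -> f x <= g x) -> state_density f <= state_density g.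
Proof.
by move=> mf mg fg; rewrite ler_sum// => j _; apply: le_integral01 => //; exact: smu_fin.
Qed.

Lemma state_density1 : state_density (fun=> 1) = nu%:R.
Proof.
rewrite /state_density (eq_bigr (fun=> 1)) ?sumr_const ?card_ord// => j _.
have := smuX (cell_state j) 0; rewrite /integral01 => ->.
by rewrite -[iter 0 _ _]/(cell_state j) l2dot_delta l2deltaE eqxx.
Qed.

(** Grid averages and state density are both monotone with total mass [nu], so replacing [f] by a
    polynomial within [e / (3 * nu)] changes each by at most [e / 3]. *)
Lemma grid_avg_lipschitz theta0 (f : R -> R) (K : R) :
  (forall x y, `|f x - f y| <= K * `|x - y|) ->
  grid_avg theta0 f @ \oo --> state_density f.
Proof.
move=> Hf; apply/cvgrPdist_le => e e0.
pose e' := e / (3 * nu%:R); have nuR : 0 < nu%:R :> R by rewrite ltr0n.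
have e'0 : 0 < e' by rewrite divr_gt0// mulr_gt0.
have [p Hp] := @weierstrass_lipschitz R f K e' e'0 (fun x y _ _ => Hf x y).
have bf : bounded_measurable f.
  split; first exact: measurable_fun_lipschitzT Hf.
  exists (`|f 0| + `|K|) => x /andP[x0 x1]; rewrite -(subrK (f 0) (f x)) addrC.
  rewrite (le_trans (ler_normD _ _))// lerD2l (le_trans (Hf _ _))// subr0.
  by rewrite (le_trans (ler_norm _))// normrM normr_id ler_piMr// ger0_norm.
have bp := bounded_measurable_horner p.
have bc c := @bounded_measurable_cst R c.
have sdD g : bounded_measurable g -> state_density (fun x => e' * 1 + g x) = e' * nu%:R + state_density g.
  move=> bg; rewrite -state_density1 /state_density mulr_sumr -big_split/=; apply: eq_bigr => j _.
  by rewrite (integral01D (smu_fin _) (bounded_measurableZ e' (bc 1)) bg) (integral01Z (smu_fin _)).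
have gaD g N : grid_avg theta0 (fun x => e' * 1 + g x) N = e' * nu%:R + grid_avg theta0 g N.
  have -> : (fun x => e' * 1 + g x) = fun x => \sum_(b <- [:: true; false]) (if b then e' else 1) * (if b then fun=> 1 else g) x.
    by apply/funext => x; rewrite !big_cons big_nil mul1r addr0.
  rewrite grid_avg_lin !big_cons big_nil mul1r addr0; congr (_ * _ + _).
  rewrite /grid_avg; under eq_bigr do rewrite sumr_const card_ord.
  rewrite sumr_const card_ffun !card_ord -[X in _ * X]mulr_natl mulKf// pnatr_eq0 expn_eq0/=.
have h1 : state_density f <= e' * nu%:R + state_density (horner p).
  rewrite -sdD//; apply: state_density_le => //; first exact: bounded_measurableD.
  by move=> x /Hp; rewrite ler_norml; lra.
have h2 : state_density (horner p) <= e' * nu%:R + state_density f.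
  rewrite -sdD//; apply: state_density_le => //; first exact: bounded_measurableD.
  by move=> x /Hp; rewrite ler_norml; lra.
have h3 N : grid_avg theta0 f N <= e' * nu%:R + grid_avg theta0 (horner p) N.
  by rewrite -gaD; apply: grid_avg_le => x /Hp; rewrite ler_norml; lra.
have h4 N : grid_avg theta0 (horner p) N <= e' * nu%:R + grid_avg theta0 f N.
  by rewrite -gaD; apply: grid_avg_le => x /Hp; rewrite ler_norml; lra.
have en : e' * nu%:R = e / 3 by rewrite /e'; field; rewrite gt_eqF.
rewrite en in h1 h2 h3 h4.
have e30 : 0 < e / 3 by rewrite divr_gt0.
have /cvgrPdist_le/(_ _ e30) [N0 _ HN] := @grid_avg_poly theta0 p.
exists N0 => // N /HN /=; move: (h3 N) (h4 N) h1 h2.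
by rewrite !ler_norml; lra.
Qed.

End CrystalSpectrum.

(** * Null sets in Euclidean space *)

Section Covers.
Variables (R : realType) (d : nat).
Hypothesis hd : (0 < d)%N.
Implicit Types (a b x y : 'rV[R]_d) (A B : set 'rV[R]_d) (e : R).

Definition box a b : set 'rV[R]_d := [set x | forall i, a 0 i <= x 0 i <= b 0 i].

Definition volume a b : R := \prod_i (b 0 i - a 0 i).

(** Lebesgue outer measure at most [e], with a cover that attains the bound. A set is
    [lebesgue_null] when it is covered for every positive [e]. *)
Definition covered A e := exists a b : nat -> 'rV[R]_d,
  [/\ forall n i, a n 0 i <= b n 0 i, A `<=` \bigcup_n box (a n) (b n)
    & (\sum_(n <oo) (volume (a n) (b n))%:E <= e%:E)%E].

Lemma volume_ge0 a b : (forall i, a 0 i <= b 0 i) -> 0 <= volume a b.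
Proof. by move=> ab; apply: prodr_ge0 => i _; rewrite subr_ge0. Qed.

(** Here [0 < d] matters, for an empty product would be [1]. Degenerate boxes serve as padding for
    finite covers. *)
Lemma volume_point a : volume a a = 0.
Proof. by rewrite /volume; case: d hd a => // k _ a; rewrite big_ord_recl subrr mul0r. Qed.

Lemma covered_ge0 A e : covered A e -> 0 <= e.
Proof.
move=> [a [b [ab _ Hs]]]; rewrite -lee_fin; apply: le_trans Hs.
by apply: nneseries_ge0 => n _ _; rewrite lee_fin volume_ge0.
Qed.

Lemma covered_sub A B e e' : A `<=` B -> e <= e' -> covered B e -> covered A e'.
Proof.
move=> AB ee [a [b [ab cB Hs]]]; exists a, b; split => //; first exact: subset_trans cB.
by rewrite (le_trans Hs)// lee_fin.
Qed.

Lemma covered_box a b : (forall i, a 0 i <= b 0 i) -> covered (box a b) (volume a b).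
Proof.
move=> ab; exists (fun=> a), (fun n => if n is 0%N then b else a); split.
- by case.
- by move=> x xab; exists 0%N.
rewrite (nneseries_split _ 1); last by case=> [|n] _; rewrite lee_fin volume_ge0.
rewrite add0n big_nat1 eseries0 ?adde0// => n; case: n => // n _ _.
by rewrite volume_point.
Qed.

Lemma covered0 e : 0 <= e -> covered set0 e.
Proof.
move=> e0; apply: (@covered_sub _ (box 0 0) 0) => //.
by rewrite -(volume_point 0); apply: covered_box.
Qed.

Lemma covered_bigcup (A : nat -> set 'rV[R]_d) (e : nat -> R) (e' : R) :
  (forall k, covered (A k) (e k)) -> (\sum_(k <oo) (e k)%:E <= e'%:E)%E ->
  covered (\bigcup_k A k) e'.
Proof.
move=> cA He.
have /choice[a Ha] k : exists a : nat -> 'rV[R]_d * 'rV[R]_d,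
    [/\ forall n i, (a n).1 0 i <= (a n).2 0 i, A k `<=` \bigcup_n box (a n).1 (a n).2
    & (\sum_(n <oo) (volume (a n).1 (a n).2)%:E <= (e k)%:E)%E].
  by have [a [b H]] := cA k; exists (fun n => (a n, b n)).
have /card_esym/ppcard_eqP[f] := card_nat2.
pose v (p : nat * nat) := (volume (a p.1 p.2).1 (a p.1 p.2).2)%:E.
have v0 p : (0 <= v p)%E by rewrite lee_fin volume_ge0//; case: (Ha p.1).
exists (fun n => (a (f n).1 (f n).2).1), (fun n => (a (f n).1 (f n).2).2); split.
- by move=> n i; case: (Ha (f n).1).
- move=> x [k _]; have [_ + _] := Ha k; move=> /[apply] -[n _ xb].
  by exists (f^-1%FUN (k, n)) => //=; rewrite invK ?inE.
rewrite -[X in (X <= _)%E]/(\sum_(n <oo) v (f n))%E nneseries_esumT//.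
rewrite -(@reindex_esum R nat (nat * nat)%type [set: nat] [set: nat * nat] f v); last by split.
rewrite (_ : [set: nat * nat] = [set: nat] `*`` (fun=> [set: nat])); last by apply/seteqP.
rewrite -(@esum_esum R nat nat setT (fun=> setT) (fun k n => v (k, n)))//.
apply: le_trans He; rewrite nneseries_esumT => [|k]; last by rewrite lee_fin; exact: covered_ge0 (cA k).
apply: le_esum => k _; rewrite -nneseries_esumT//; by case: (Ha k).
Qed.

Lemma covered_setU A B e e' : covered A e -> covered B e' -> covered (A `|` B) (e + e').
Proof.
move=> cA cB; rewrite -bigcup2E.
apply: (@covered_bigcup (bigcup2 A B) (fun n => if n is 0%N then e else if n is 1%N then e' else 0)).
  by case=> [|[|n]] //=; exact: covered0.
have e0 := covered_ge0 cA; have e'0 := covered_ge0 cB.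
rewrite (nneseries_split _ 2); last by case=> [|[|n]].
rewrite add0n [X in (_ + X)%E]eseries0; last by case=> [|[|n]].
by rewrite adde0 big_nat_recl// big_nat1.
Qed.

Lemma covered_sum (I : Type) (r : seq I) (A : I -> set 'rV[R]_d) (e : I -> R) :
  (forall i, covered (A i) (e i)) -> covered (\big[setU/set0]_(i <- r) A i) (\sum_(i <- r) e i).
Proof.
move=> cA; elim: r => [|i r IH]; rewrite ?big_nil ?big_cons; first exact: covered0.
exact: covered_setU.
Qed.

Lemma lebesgue_null_bigcup (A : nat -> set 'rV[R]_d) :
  (forall k, lebesgue_null (A k)) -> lebesgue_null (\bigcup_k A k).
Proof.
move=> nA e e0; apply: (@covered_bigcup _ (fun k => e / (2 ^ k.+1)%:R)).
  by move=> k; apply: nA; rewrite divr_gt0// ltr0n expn_gt0.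
have := @epsilon_trick R (fun=> 0%E) e xpredT (fun=> lexx _) (ltW e0).
rewrite [X in (_ <= X + _)%E]eseries0// add0e; apply: le_trans; rewrite le_eqVlt; apply/orP; left; apply/eqP.
by apply: eq_eseriesr => i _; rewrite add0e.
Qed.

Lemma lebesgue_null_bigcup_count (I : countType) (A : I -> set 'rV[R]_d) :
  (forall k, lebesgue_null (A k)) -> lebesgue_null (\bigcup_k A k).
Proof.
move=> nA; pose B n := if unpickle n is Some i then A i else set0.
have : lebesgue_null (\bigcup_n B n).
  apply: lebesgue_null_bigcup => n; rewrite /B; case: unpickle => // e e0.
  exact/covered0/ltW.
move=> + e e0 => /(_ e e0); apply: covered_sub => // x [i _ xi].
by exists (pickle i) => //; rewrite /B pickleK.
Qed.

Lemma lebesgue_null_sub A B : A `<=` B -> lebesgue_null B -> lebesgue_null A.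
Proof. by move=> AB nB e /nB; exact: covered_sub. Qed.

Lemma lebesgue_nullU A B : lebesgue_null A -> lebesgue_null B -> lebesgue_null (A `|` B).
Proof.
move=> nA nB e e0; rewrite (splitr e); apply: covered_setU.
  by apply: nA; rewrite divr_gt0.
by apply: nB; rewrite divr_gt0.
Qed.

End Covers.

(** Lebesgue measure is an infimum over covers by half-open intervals. These are closed up, and an
    empty one becomes the point [0]. *)
Lemma null_itv_cover (R : realType) (K : set R) (e : R) :
  (@lebesgue_measure R K = 0)%E -> 0 < e -> exists a b : nat -> R,
  [/\ forall k, a k <= b k, K `<=` \bigcup_k [set x | a k <= x <= b k]
    & (\sum_(k <oo) (b k - a k)%:E <= e%:E)%E].
Proof.
move=> K0 e0; have /ereal_inf_lt[z [/= M [mM KM] sM ze]] : (@lebesgue_measure R K < e%:E)%E.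
  by rewrite K0 lte_fin.
have /choice[p Hp] k : exists p : R * R, [/\ p.1 <= p.2, M k `<=` [set x | p.1 <= x <= p.2]
    & ((p.2 - p.1)%:E <= @lebesgue_measure R (M k))%E].
  have /ocitvP[->|[[a b] /= ab ->]] := mM k.
    by exists (0, 0); split => //=; rewrite subrr measure0.
  exists (a, b); split => /=; first exact: ltW.
    by move=> x; rewrite /= in_itv/= => /andP[/ltW-> ->].
  by rewrite lebesgue_measure_itv/= lte_fin ab EFinB.
exists (fun k => (p k).1), (fun k => (p k).2); split.
- by move=> k; case: (Hp k).
- by move=> x /KM[k _ xk]; exists k => //; case: (Hp k) => _ + _; exact.
apply: le_trans (ltW ze); rewrite -sM; apply: lee_nneseries.
  by move=> k _; rewrite lee_fin subr_ge0; case: (Hp k).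
move=> k _; have [_ _] := Hp k => /le_trans; apply.
have := mM k; move: (M k) => A; case/ocitvP => [->|[[a b] /= ab ->]].
  by rewrite !measure0.
by rewrite lebesgue_measure_itv/= lte_fin ab wlength_itv_bnd ?(ltW ab)//= EFinB.
Qed.

(** * Preimages of null sets under functions expanding along an axis *)

Section NullPreimage.
Variables (R : realType) (d : nat).
Hypothesis hd : (0 < d)%N.
Variables (f : 'rV[R]_d -> R) (L : R).
Hypothesis L0 : 0 <= L.
Hypothesis fL : forall (x y : 'rV[R]_d) (e : R), (forall l : 'I_d, `|x 0 l - y 0 l| <= e) -> `|f x - f y| <= L * e.
Implicit Types (x y : 'rV[R]_d) (i : 'I_d) (n p N : nat).

Definition axis i : 'rV[R]_d := delta_mx 0 i.

(** A quantified nonzero partial derivative: along the axis [i] and up to distance [1 / n.+1], [f]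
    moves away from [f x] at least at speed [1 / n.+1]. Only covers of this set are used, not its
    measurability. *)
Definition expanding i n : set 'rV[R]_d :=
  [set x | forall t, `|t| <= n.+1%:R^-1 -> `|t| <= n.+1%:R * `|f (x + t *: axis i) - f x|].

Definition unit_cube : set 'rV[R]_d := [set x | forall l, 0 <= x 0 l <= 1].

(** Two points of one slab differ in coordinate [i] by at most [1 / n.+1], the range of
    [expanding]. *)
Definition slab i n p : set 'rV[R]_d := [set x | p%:R <= n.+1%:R * x 0 i <= p.+1%:R].

Lemma unit_cell N (t : R) : 0 <= t <= 1 -> exists k : 'I_N.+1, k%:R / N.+1%:R <= t <= k.+1%:R / N.+1%:R.
Proof.
move=> /andP[t0 t1]; have N0 : 0 < N.+1%:R :> R by rewrite ltr0n.
have [tN|tN] := ltP t 1.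
  have /Num.Theory.truncn_itv/andP[h1 h2] : 0 <= t * N.+1%:R by rewrite mulr_ge0// ltW.
  have h3 : (Num.truncn (t * N.+1%:R) < N.+1)%N.
    by rewrite -(ltr_nat R) (le_lt_trans h1)// gtr_pMl.
  by exists (Ordinal h3); rewrite ler_pdivrMr// h1 ler_pdivlMr// ltW.
have -> : t = 1 by apply/eqP; rewrite eq_le t1.
exists ord_max; rewrite divff ?gt_eqF// lexx andbT ler_pdivrMr// mul1r ler_nat.
exact: leqnSn.
Qed.

(* If [x] is in the set and [y] agrees with [x] up to [1 / N.+1] off coordinate
   [i] and in the values of [f], the expansion at [x] bounds [y 0 i - x 0 i] by
   [n.+1 * (L + 1) / N.+1]: a cell of side [1 / N.+1] in the other coordinates
   is thus covered by one box. *)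
Lemma covered_level_cell i n p N (u v : R) : v - u <= N.+1%:R^-1 ->
  covered (expanding i n `&` slab i n p `&` unit_cube `&` [set x | u <= f x <= v])
    (2 * (n.+1%:R * ((L + 1) / N.+1%:R))).
Proof.
move=> uv; set w := n.+1%:R * _; set B := _ `&` _.
have N0 : 0 < N.+1%:R :> R by rewrite ltr0n.
have n0 : 0 < n.+1%:R :> R by rewrite ltr0n.
have w0 : 0 <= w by rewrite mulr_ge0 ?divr_ge0 ?addr_ge0// ltW.
(* Side lengths of a box with index [k] in direction [l]. In direction [i] only the index [ord0] is
   kept, with side [2 * w], and in each other direction the [N.+1] sides sum to [1], so the volumes
   add up to [2 * w]. *)
pose s l (k : 'I_N.+1) : R := if l == i then (if k == ord0 then 2 * w else 0) else N.+1%:R^-1.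
have s0 l k : 0 <= s l k.
  by rewrite /s; case: ifP => _; [case: ifP => _ //; rewrite mulr_ge0|rewrite invr_ge0 ltW].
have -> : 2 * w = \sum_(m : {ffun 'I_d -> 'I_N.+1}) \prod_l s l (m l).
  rewrite -(bigA_distr_bigA s) (bigD1 i)//= [X in _ = _ * X]big1 ?mulr1.
    rewrite (bigD1 ord0)//= big1 ?addr0; first by rewrite /s !eqxx.
    by move=> k k0; rewrite /s eqxx (negbTE k0).
  move=> l li; rewrite /s (negbTE li) sumr_const card_ord -[LHS]mulr_natr mulVf// gt_eqF.
pose P (m : {ffun 'I_d -> 'I_N.+1}) : set 'rV[R]_d :=
  [set x | B x /\ m i = ord0 /\ forall l, l != i -> (m l)%:R / N.+1%:R <= x 0 l <= (m l).+1%:R / N.+1%:R].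
apply: (@covered_sub _ _ _ (\big[setU/set0]_(m : {ffun 'I_d -> 'I_N.+1}) P m) _ _ _ (lexx _)).
  move=> x Bx; rewrite -bigcup_seq/=.
  have /choice[k Hk] l := @unit_cell N (x 0 l) (Bx.1.2 l).
  exists [ffun l => if l == i then ord0 else k l]; first by rewrite /= mem_index_enum.
  by split=> //; split=> [|l li]; rewrite ffunE ?eqxx// (negbTE li).
apply: covered_sum => // m.
have [mi|mi] := eqVneq (m i) ord0; last first.
  rewrite (_ : P m = set0); first by apply: covered0 => //; exact: prodr_ge0.
  by apply/seteqP; split=> // x [_ [/eqP]]; rewrite (negbTE mi).
(* A nonempty piece is boxed around any of its points [y]. *)
have [->|/set0P[y Py]] := eqVneq (P m) set0; first by apply: covered0 => //; exact: prodr_ge0.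
pose a : 'rV[R]_d := \row_l if l == i then y 0 i - w else (m l)%:R / N.+1%:R.
pose b : 'rV[R]_d := \row_l if l == i then y 0 i + w else (m l).+1%:R / N.+1%:R.
have ba l : b 0 l - a 0 l = s l (m l).
  rewrite !mxE /s; case: eqP => [->|_]; first by rewrite mi eqxx; ring.
  by rewrite -mulrBl -natrB// subSnn mul1r.
rewrite (_ : \prod_l _ = volume a b); last by apply: eq_bigr => l _; rewrite ba.
apply: (@covered_sub _ _ _ (box a b) _ _ _ (lexx _)); last first.
  by apply: covered_box => // l; rewrite -subr_ge0 ba.
move=> x [[[[Ax Sx] _] fx] [_ cx]] l; rewrite !mxE; case: eqP => [->|/eqP/cx//].
have [[[[_ Sy] _] fy] [_ cy]] := Py.
(* Moving [x] by [t] along axis [i] reaches the [i]-coordinate of [y]; the new point differs from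
   [y] by at most [1 / N.+1] in the other coordinates, so the Lipschitz bound compares their
   values. *)
pose t := y 0 i - x 0 i.
have t1 : `|t| <= n.+1%:R^-1.
  rewrite -[leRHS]mul1r ler_pdivlMr// -[X in _ * X](gtr0_norm n0) -normrM.
  move: Sx Sy; rewrite /slab/= /t -natr1 ler_norml; lra.
have zy : forall l, `|(x + t *: axis i) 0 l - y 0 l| <= N.+1%:R^-1.
  move=> k; rewrite !mxE eqxx/=; have [->|ki] := eqVneq k i.
    by rewrite (_ : _ - _ = 0) ?normr0 ?invr_ge0 ?ltW// /t mulr1; ring.
  have e1 : (m k).+1%:R / N.+1%:R = (m k)%:R / N.+1%:R + N.+1%:R^-1 :> R by rewrite -natr1 mulrDl mul1r.
  rewrite mulr0 addr0; move: (cx k ki) (cy k ki); rewrite e1 ler_norml.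
  by move: (N.+1%:R^-1) (x 0 k) (y 0 k) ((m k)%:R / N.+1%:R) => ????; lra.
have h1 := fL zy; have h2 := Ax t t1.
have h3 : `|f (x + t *: axis i) - f x| <= (L + 1) / N.+1%:R.
  move: h1 fx fy uv; rewrite /= mulrDl mul1r !ler_norml.
  by move: (N.+1%:R^-1) (L / N.+1%:R) (f x) (f y) (f _) => ?????; lra.
have : `|t| <= w by rewrite (le_trans h2)// ler_pM2l.
by rewrite /t ler_norml; lra.
Qed.

(** Fits the mesh to the length [s] of an interval of values: the volume in [covered_level_cell] is
    proportional to [1 / N.+1], so this must not exceed a multiple of [s]. *)
Lemma dyadic_bracket (s : R) : 0 < s <= 1 -> exists N, s <= N.+1%:R^-1 <= 2 * s.
Proof.
move=> /andP[s0 s1]; have i1 : 1 <= s^-1 by rewrite invr_ge1// unitfE gt_eqF.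
have /Num.Theory.truncn_itv/andP[h1 h2] : 0 <= s^-1 by rewrite invr_ge0 ltW.
case E : (Num.truncn s^-1) h1 h2 => [|N] h1 h2; first by have := le_lt_trans i1 h2; rewrite ltxx.
have N0 : 0 < N.+1%:R :> R by rewrite ltr0n.
exists N; apply/andP; split; first by rewrite -[leLHS]invrK lef_pV2 ?posrE ?invr_gt0.
rewrite -[leLHS]mul1r ler_pdivrMr//.
have : 1 < N.+2%:R * s by rewrite -ltr_pdivrMr// mul1r.
have : 1 <= N.+1%:R :> R by rewrite ler1n.
by rewrite -!natr1; move: (N%:R) => z *; nra.
Qed.

Lemma null_level_slab i n p (K : set R) : (@lebesgue_measure R K = 0)%E ->
  lebesgue_null (expanding i n `&` slab i n p `&` unit_cube `&` [set x | K (f x)]).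
Proof.
move=> K0 e e0; set C := 2 * (n.+1%:R * (L + 1)).
have C0 : 0 < C by rewrite !mulr_gt0// ltr_wpDl.
(* The total volume is at most [2 * C] times the sum of the [s k], which is at most [2 * h]. The
   bound [1 / 2] keeps [s k <= 1], as [dyadic_bracket] requires. *)
pose h := Num.min (e / (4 * C)) 2^-1.
have h0 : 0 < h by rewrite lt_min invr_gt0 ltr0n andbT divr_gt0// mulr_gt0.
have [a [b [ab Kab Sab]]] := null_itv_cover K0 h0.
(* The geometric term makes [s k] positive even for a degenerate interval and adds at most [h] in
   all. *)
pose s k := (b k - a k) + h / (2 ^ k.+1)%:R.
have hk k : 0 < h / (2 ^ k.+1)%:R by rewrite divr_gt0// ltr0n expn_gt0.
have sk1 k : b k - a k <= h.
  rewrite -lee_fin; apply: le_trans Sab.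
  rewrite (nneseries_split _ k.+1); last by move=> j _; rewrite lee_fin subr_ge0.
  rewrite add0n big_nat_recr//= -addeA addeCA leeDl// adde_ge0//.
    by apply: sume_ge0 => j _; rewrite lee_fin subr_ge0.
  by apply: nneseries_ge0 => j _ _; rewrite lee_fin subr_ge0.
have s01 k : 0 < s k <= 1.
  rewrite /s ltr_wpDl ?subr_ge0//=.
  have : h / (2 ^ k.+1)%:R <= h * 2^-1.
    rewrite ler_pM2l// lef_pV2 ?posrE ?ltr0n ?expn_gt0// ler_nat expnS.
    by have := expn_gt0 2 k; lia.
  have := sk1 k; have : h <= 2^-1 by rewrite ge_min lexx orbT.
  by lra.
have /choice[N HN] k := dyadic_bracket (s01 k).
apply: (@covered_sub _ _ _ (\bigcup_k (expanding i n `&` slab i n p `&` unit_cube `&` [set x | a k <= f x <= b k])) _ _ _ (lexx _)).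
  by move=> x [Hx /Kab[k _ fk]]; exists k.
apply: (@covered_bigcup R d _ (fun k => C * (2 * s k))).
  move=> k; have /andP[h1 h2] := HN k.
  have := @covered_level_cell i n p (N k) (a k) (b k); rewrite (le_trans _ h1)//; last first.
    by rewrite /s lerDl ltW.
  move=> /(_ isT); apply: covered_sub => //.
  by rewrite mulrA [in leLHS]mulrA -/C -(mulrA 2) /C -!mulrA !ler_pM2l// ?ltr_wpDl// ltr0n.
have s20 k : (0 <= (s k)%:E)%E by rewrite lee_fin ltW//; case/andP: (s01 k).
have -> : (\sum_(k <oo) (C * (2 * s k))%:E = (2 * C)%:E * \sum_(k <oo) (s k)%:E)%E.
  rewrite -nneseriesZl//.
  by apply: eq_eseriesr => k _; rewrite -EFinM mulrCA mulrA.
have : (\sum_(k <oo) (s k)%:E <= h%:E + h%:E)%E.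
  have := @epsilon_trick R (fun k => (b k - a k)%:E) h xpredT _ (ltW h0).
  under eq_eseriesr do rewrite -EFinD.
  move=> H; apply: (le_trans (H _)); last by rewrite leeD2r.
  by move=> k; rewrite lee_fin subr_ge0.
have c20 : (0 <= (2 * C)%:E)%E by rewrite lee_fin ltW// mulr_gt0.
move=> /(lee_wpmul2l c20)/le_trans; apply; rewrite -EFinD -EFinM lee_fin.
have : h <= e / (4 * C) by rewrite ge_min lexx.
move: C0; generalize C, h => c k c0.
by rewrite ler_pdivlMr ?mulr_gt0//; lra.
Qed.

Lemma null_level (K : set R) (N0 : set 'rV[R]_d) : (@lebesgue_measure R K = 0)%E ->
  lebesgue_null N0 -> (forall x, ~ N0 x -> exists i n, expanding i n x) ->
  lebesgue_null (unit_cube `&` [set x | K (f x)]).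
Proof.
move=> K0 nN HN.
apply: (@lebesgue_null_sub _ _ _ (N0 `|` \bigcup_(q : 'I_d * nat * nat)
   (expanding q.1.1 q.1.2 `&` slab q.1.1 q.1.2 q.2 `&` unit_cube `&` [set x | K (f x)]))); last first.
  by apply: lebesgue_nullU => //; apply: lebesgue_null_bigcup_count => // -[[i n] p]; exact: null_level_slab.
move=> x [cx Kx]; have [|/HN[i [n Ax]]] := pselect (N0 x); [by left|right].
have n0 : 0 <= n.+1%:R * x 0 i by rewrite mulr_ge0//; case/andP: (cx i).
exists (i, n, Num.truncn (n.+1%:R * x 0 i)) => //; split => //; split => //; split => //=.
by rewrite /slab/=; have /andP[-> /ltW->] := Num.Theory.truncn_itv n0.
Qed.

End NullPreimage.

(** * Lipschitz approximations of the indicator of a closed set *)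

Section DistanceTo.
Variables (R : realType) (K : set R).
Hypothesis K0 : K !=set0.
Implicit Types x y : R.

Definition distance_to y : R := inf [set `|y - k| | k in K].

Let nonempty y : [set `|y - k| | k in K] !=set0.
Proof. by have [k Kk] := K0; exists `|y - k|; exists k. Qed.

Let bounded y : has_lbound [set `|y - k| | k in K].
Proof. by exists 0 => _ [k _ <-]. Qed.

Lemma distance_to_ge0 y : 0 <= distance_to y.
Proof. by apply: lb_le_inf => // _ [k _ <-]. Qed.

Lemma distance_to_le y k : K k -> distance_to y <= `|y - k|.
Proof. by move=> Kk; apply: ge_inf => //; exists k. Qed.

Lemma distance_to_lt y e : distance_to y < e -> exists2 k, K k & `|y - k| < e.
Proof. by move=> /inf_lt[]// _ [k Kk <-] ke; exists k. Qed.

Lemma distance_to_mem y : K y -> distance_to y = 0.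
Proof.
move=> Ky; apply/eqP; rewrite eq_le distance_to_ge0 andbT.
by have := distance_to_le y Ky; rewrite subrr normr0.
Qed.

Lemma distance_to_lipschitz x y : `|distance_to x - distance_to y| <= `|x - y|.
Proof.
suff H a b : distance_to a - distance_to b <= `|a - b|.
  by rewrite ler_norml H andbT lerNl opprB distrC H.
rewrite lerBlDl -lerBlDr; apply: lb_le_inf => // _ [k Kk <-].
rewrite lerBlDr (le_trans (distance_to_le a Kk))//.
by rewrite -(subrKA b) addrC ler_normD.
Qed.

Lemma distance_to_closed y : closed K -> distance_to y = 0 -> K y.
Proof.
move=> cK y0; rewrite (closure_id K).1// => B /nbhs_ballP[e /= e0 eB].
have /distance_to_lt[k Kk yk] : distance_to y < e by rewrite y0.
by exists k; split => //; apply: eB.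
Qed.

Definition tent n y : R := Num.max 0 (1 - n.+1%:R * distance_to y).

Lemma tent_itv n y : 0 <= tent n y <= 1.
Proof.
rewrite /tent le_max lexx/= ge_max ler01/= gerBl mulr_ge0//; exact: distance_to_ge0.
Qed.

Lemma tent_mem n y : K y -> tent n y = 1.
Proof. by move=> /distance_to_mem E; rewrite /tent E mulr0 subr0; apply/max_idPr. Qed.

Lemma tent_lipschitz n x y : `|tent n x - tent n y| <= n.+1%:R * `|x - y|.
Proof.
have n0 : 0 < n.+1%:R :> R by rewrite ltr0n.
have := distance_to_lipschitz x y; rewrite -(ler_pM2l n0); apply: le_trans.
rewrite -[X in X * _](gtr0_norm n0) -normrM mulrBr /tent.
move: (_ * distance_to x) (_ * distance_to y) => a b.
rewrite !maxEle; case: (leP 0 (1 - a)) => ?; case: (leP 0 (1 - b)) => ?;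
  rewrite ?subrr ?normr0 ?sub0r ?subr0 ?normrN//.
- by rewrite (_ : 1 - a - (1 - b) = b - a) ?(distrC b)//; ring.
- by rewrite [leLHS]ger0_norm// distrC; have := ler_norm (b - a); lra.
- by rewrite [leLHS]ger0_norm//; have := ler_norm (a - b); lra.
Qed.

End DistanceTo.

(** * Grid points near a compact null set *)

Section CompactNull.
Import finmap.
Variables (R : realType) (d : nat).
Hypothesis hd : (0 < d)%N.
Implicit Types (a b x y : 'rV[R]_d) (N : nat).

Lemma count_open_itv (u v : R) n : u <= v ->
  \sum_(k < n) (u < k%:R < v)%R%:R <= v - u + 1 :> R.
Proof.
move=> uv.
(* The second conjunct strengthens the induction: the first integer counted exceeds [u], so the
   count is [0] or at most [n - u]. *)
suff [] : \sum_(k < n) (u < k%:R < v)%R%:R <= v - u + 1 :> R /\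
   (\sum_(k < n) (u < k%:R < v)%R%:R = 0 :> R \/ \sum_(k < n) (u < k%:R < v)%R%:R <= n%:R - u :> R) by [].
elim: n => [|n [IH1 IH2]]; first by rewrite big_ord0; split; [lra|left].
have e1 : n.+1%:R = n%:R + 1 :> R by rewrite natr1.
rewrite big_ord_recr/= e1; have [/andP[un nv]|_] := boolP (_ && _); last first.
  by rewrite addr0; split => //; case: IH2 => H; [left|right; lra].
by rewrite (_ : true%:R = 1 :> R)//; case: IH2 => H; split; [lra|right; lra|lra|right; lra].
Qed.

Definition open_box a b : set 'rV[R]_d := [set x | forall l, a 0 l < x 0 l < b 0 l].

Lemma open_open_box a b : open (open_box a b).
Proof.
rewrite openE => x xab; rewrite /interior.
apply: (@filter_forall _ _ (fun l (y : 'rV[R]_d) => a 0 l < y 0 l < b 0 l) (nbhs x) (nbhs_filter x)) => l; have /andP[ax xb] := xab l.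
have cl := @coord_continuous R 1 d 0 l x.
near=> y; apply/andP; split; near: y.
  by apply: (cl [set t | a 0 l < t]); exact: lt_nbhsr.
by apply: (cl [set t | t < b 0 l]); exact: lt_nbhsl.
Unshelve. all: by end_near. Qed.

Definition zero_grid N (n : {ffun 'I_d -> 'I_N}) : 'rV[R]_d := gridpt 0 n.

Lemma count_grid_box N a b : (forall l, a 0 l <= b 0 l) ->
  \sum_n (zero_grid (N := N.+1) n \in open_box a b)%:R <= \prod_l (N.+1%:R * (b 0 l - a 0 l) + 1).
Proof.
move=> ab; have N0 : 0 < N.+1%:R :> R by rewrite ltr0n.
pose c l (k : 'I_N.+1) : R := (N.+1%:R * a 0 l < k%:R < N.+1%:R * b 0 l)%R%:R.
have -> : \sum_n (zero_grid (N := N.+1) n \in open_box a b)%:R = \sum_(n : {ffun 'I_d -> 'I_N.+1}) \prod_l c l (n l).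
  apply: eq_bigr => n _; have E l : (a 0 l < zero_grid n 0 l < b 0 l) = (N.+1%:R * a 0 l < (n l)%:R < N.+1%:R * b 0 l).
    by rewrite !mxE add0r ltr_pdivlMr// ltr_pdivrMr// !(mulrC N.+1%:R).
  have [|] := boolP (_ \in _).
    by move=> /set_mem H; rewrite big1// => l _; rewrite /c -E H.
  move=> /negP H; have [l Hl] : exists l, ~~ (a 0 l < zero_grid n 0 l < b 0 l).
    by apply: contrapT => Hn; apply: H; apply/mem_set => l; apply: contrapT => /negP Hl; apply: Hn; exists l.
  by rewrite (bigD1 l)//= /c -E (negbTE Hl) mul0r.
rewrite -(bigA_distr_bigA c); apply: ler_prod => l _; rewrite sumr_ge0//=.
by rewrite mulrBr; apply: count_open_itv; rewrite ler_pM2l.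
Qed.

(** Boxes of a small cover are opened up at small cost, and compactness leaves finitely many, which
    contain asymptotically no more than their volume's share of the grid. The budget is [e / 4] for
    the cover, [e / 4] for the enlargement and [e / 2] for the counting error. *)
Lemma null_compact_grid (Z : set 'rV[R]_d) (e : R) : compact Z -> lebesgue_null Z -> 0 < e ->
  exists2 U, open U /\ Z `<=` U & \forall N \near \oo,
    \sum_n (zero_grid (N := N.+1) n \in U)%:R <= e * (N.+1 ^ d)%:R.
Proof.
move=> cZ nZ e0; have e4 : 0 < e / 4 by rewrite divr_gt0.
have [a [b [ab Zab Sab]]] := nZ _ e4.
(* At [0] this is the volume of the box, at [2 * s] the volume after every face has moved out by
   [s], and at [1 / N.+1] a bound for the proportion of grid points in the open box. *)
pose q (u v : 'rV[R]_d) : {poly R} := \prod_l ((v 0 l - u 0 l)%:P + 'X).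
have qE u v t : (q u v).[t] = \prod_l (v 0 l - u 0 l + t).
  by rewrite horner_prod; apply: eq_bigr => l _; rewrite !hornerE.
have q_cvg (p : {poly R}) : (fun N => p.[N.+1%:R^-1]) @ \oo --> p.[0].
  apply: (@cvg_comp _ _ _ (fun N => N.+1%:R^-1) (horner p) _ (nbhs (0 : R))); first exact: cvg_harmonic.
  exact: continuous_horner.
have /choice[s Hs] k : exists s : R, 0 < s /\ (q (a k) (b k)).[2 * s] <= volume (a k) (b k) + e / 4 / (2 ^ k.+1)%:R.
  have ek : 0 < e / 4 / (2 ^ k.+1)%:R by rewrite divr_gt0// ltr0n expn_gt0.
  have /cvgrPdist_le/(_ _ ek)[N0 _ HN] := q_cvg (q (a k) (b k)).
  exists (N0.+1%:R^-1 / 2); split; first by rewrite divr_gt0// invr_gt0.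
  have := HN N0 (leqnn _); rewrite /= (_ : 2 * (_ / 2) = N0.+1%:R^-1); last by rewrite mulrC divfK.
  rewrite (qE _ _ 0).
  have -> : \prod_l (b k 0 l - a k 0 l + 0) = volume (a k) (b k) by apply: eq_bigr => l _; rewrite addr0.
  by rewrite ler_norml; lra.
pose a' k : 'rV[R]_d := \row_l (a k 0 l - s k).
pose b' k : 'rV[R]_d := \row_l (b k 0 l + s k).
have ab' k l : a' k 0 l <= b' k 0 l.
  by rewrite !mxE; have := ab k l; have [+ _] := Hs k; lra.
have cc : cover_compact Z by rewrite -compact_cover.
have [||D _ ZD] := cc nat setT (fun k => open_box (a' k) (b' k)).
- by move=> k _; exact: open_open_box.
- move=> x /Zab[k _ xk]; exists k => // l; rewrite !mxE.
  by have := xk l; have [+ _] := Hs k; lra.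
exists (cover [set` D] (fun k => open_box (a' k) (b' k))).
  by split => //; apply: bigcup_open => k _; exact: open_open_box.
pose Q := \sum_(k <- D) q (a' k) (b' k).
have Q0 : Q.[0] <= e / 4 + e / 4.
  have vE k : (q (a' k) (b' k)).[0] = (q (a k) (b k)).[2 * s k].
    by rewrite !qE; apply: eq_bigr => l _; rewrite !mxE; ring.
  rewrite /Q horner_sum; apply: (@le_trans _ _ (\sum_(k <- D) (volume (a k) (b k) + e / 4 / (2 ^ k.+1)%:R))).
    by apply: ler_sum => k _; rewrite vE; case: (Hs k).
  have w0 k : 0 <= volume (a k) (b k) + e / 4 / (2 ^ k.+1)%:R.
    by rewrite addr_ge0 ?volume_ge0 ?divr_ge0// ltW.
  rewrite -lee_fin -sumEFin; apply: (@le_trans _ _ (\sum_(k <oo) (volume (a k) (b k) + e / 4 / (2 ^ k.+1)%:R)%:E)%E).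
    rewrite nneseries_esumT; last by move=> k; rewrite lee_fin.
    apply: esum_ge; exists [set` D]; first by split.
    by rewrite -fsbig_seq.
  have := @epsilon_trick R (fun k => (volume (a k) (b k))%:E) (e / 4) xpredT _ (ltW e4).
  move=> H; apply: le_trans (le_trans (H _) _).
  - by [].
  - by move=> k; rewrite lee_fin volume_ge0.
  - by rewrite EFinD leeD2r.
have e42 : 0 < e / 2 by rewrite divr_gt0.
have /cvgrPdist_le/(_ _ e42)[N0 _ HN] := q_cvg Q.
exists N0 => // N /HN /= QN.
have NN : 0 < N.+1%:R :> R by rewrite ltr0n.
have : Q.[N.+1%:R^-1] <= e by move: QN; rewrite ler_norml; lra.
rewrite -(ler_pM2r (_ : 0 < (N.+1 ^ d)%:R)) ?ltr0n ?expn_gt0//; apply: le_trans.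
apply: (@le_trans _ _ (\sum_(k <- D) \sum_n (zero_grid (N := N.+1) n \in open_box (a' k) (b' k))%:R)).
  rewrite exchange_big/=; apply: ler_sum => n _; have [|_] := boolP (_ \in _); last by rewrite sumr_ge0.
  move=> /set_mem[k /= kD xk]; rewrite (big_rem k)//= mem_set// lerDl.
  exact: sumr_ge0.
rewrite /Q horner_sum mulr_suml; apply: ler_sum => k _.
apply: (le_trans (count_grid_box N (ab' k))); rewrite qE natrX -[X in _ ^+ X]card_ord -prodr_const -big_split/=.
rewrite le_eqVlt; apply/orP; left; apply/eqP; apply: eq_bigr => l _.
by rewrite mulrDl mulVf ?gt_eqF// mulrC.
Qed.

Lemma compact_unit_cube : compact (@unit_cube R d).
Proof.
have := @rV_compact R d (fun=> `[0, 1]%classic) (fun=> @segment_compact R 0 1).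
by congr compact; apply/seteqP; split => x /= H l; have := H l; rewrite /= in_itv.
Qed.

(** On the compact part of the cube outside [U] the distance from [f] to [K] stays away from [0], so
    narrow tents vanish there; inside [U] grid points are few by [null_compact_grid]. *)
Lemma null_level_grid (f : 'rV[R]_d -> R) (K : set R) (e : R) :
  continuous f -> closed K -> K !=set0 ->
  lebesgue_null (@unit_cube R d `&` [set x | K (f x)]) -> 0 < e ->
  \forall m \near \oo, \forall N \near \oo,
    \sum_n tent K m (f (zero_grid (N := N.+1) n)) <= e * (N.+1 ^ d)%:R.
Proof.
move=> cf cK K0 nZ e0; set Z := _ `&` _ in nZ.
have cZ : compact Z.
  apply: (subclosed_compact _ compact_unit_cube); last by move=> x [].
  apply: closedI; first exact/(compact_closed (@norm_hausdorff _ _))/compact_unit_cube.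
  by apply: preimage_closed => // x _; exact: cf.
have [U [oU ZU] HU] := null_compact_grid cZ nZ e0.
have cC : compact (@unit_cube R d `\` U).
  apply: (subclosed_compact _ compact_unit_cube); last by move=> x [].
  apply: closedI; first exact/(compact_closed (@norm_hausdorff _ _))/compact_unit_cube.
  exact: open_closedC.
pose h x := distance_to K (f x).
have ch : continuous h.
  move=> x; apply: (@cvg_comp _ _ _ f (distance_to K) _ (nbhs (f x))); first exact: cf.
  apply/cvgrPdist_le => r r0; near=> z; apply: (le_trans (distance_to_lipschitz K0 _ _)).
  near: z; exact: cvgr_dist_le.
have cI : compact (h @` (@unit_cube R d `\` U)).
  by apply: continuous_compact => //; exact: continuous_subspaceT.
have I0 : ~ (h @` (@unit_cube R d `\` U)) 0.
  by move=> [x [cx nUx] hx]; apply/nUx/ZU; split => //; exact: (distance_to_closed K0).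
have /nbhs_ballP[r /= r0 Hr] : nbhs (0 : R) (~` (h @` (@unit_cube R d `\` U))).
  apply: open_nbhs_nbhs; split => //; apply: closed_openC.
  exact: (compact_closed (@norm_hausdorff _ _)).
have Hr' x : unit_cube x -> distance_to K (f x) < r -> U x.
  move=> cx hx; apply: contrapT => nU; apply: (Hr (h x)); last by exists x.
  by rewrite /ball/= sub0r normrN ger0_norm ?distance_to_ge0.
have [m0 _ Hm] := near_infty_natSinv_lt (PosNum r0).
exists m0 => // m /Hm /= mr; apply: filterS HU => N; apply: le_trans.
apply: ler_sum => n _; have [|nU] := boolP (_ \in U).
  by case/andP: (tent_itv K0 m (f (zero_grid n))).
rewrite /tent ge_max lexx/= subr_le0 mulrC -ler_pdivrMr ?ltr0n// mul1r.
rewrite leNgt; apply/negP => hlt; move/negP: nU; apply; apply/mem_set/Hr'; last exact: lt_trans mr.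
move=> l; rewrite !mxE add0r divr_ge0//= ler_pdivrMr ?ltr0n// mul1r ler_nat.
exact/ltnW/ltn_ord.
Unshelve. all: by end_near. Qed.

End CompactNull.

(** * Absolute continuity *)

Section NullMeasure.
Variables (R : realType) (mu : {measure set (measurableTypeR R) -> \bar R}).
Hypothesis mu_fin : (mu setT < +oo)%E.
Hypothesis mu_closed : forall K : set R, closed K -> (@lebesgue_measure R K = 0)%E -> mu K = 0%E.

Local Notation leb := (@lebesgue_measure R).

(** The points at distance at least [1 / m.+1] from the complement: closed sets which increase to
    [U] when [U] is open. *)
Let inner_part (U : set R) (m : nat) : set R := ~` \bigcup_(y in ~` U) ball y m.+1%:R^-1.

Let closed_inner_part U m : closed (inner_part U m).
Proof. by apply: open_closedC; apply: bigcup_open => y _; exact: ball_open. Qed.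

Let mclosed (K : set R) : closed K -> measurable (K : set (measurableTypeR R)).
Proof. exact: closed_measurable. Qed.

Let measurable_inner_part U m : measurable (inner_part U m : set (measurableTypeR R)).
Proof. exact: (closed_measurable (@closed_inner_part U m)). Qed.

Let inner_part_small (U : set R) (e : R) : open U -> 0 < e ->
  exists m, (mu (U `\` inner_part U m) <= e%:E)%E.
Proof.
move=> oU e0; pose F m := U `\` inner_part U m.
have mF m : measurable (F m : set (measurableTypeR R)).
  by apply: measurableD; [exact: open_measurable|exact: (@measurable_inner_part U m)].
have F0 : \bigcap_m F m = set0.
  apply/seteqP; split => // x H; have Ux : U x by case: (H 0%N I).
  have /nbhs_ballP[r /= r0 Hr] := open_nbhs_nbhs (conj oU Ux).
  have [m0 _ /(_ m0 (leqnn _)) /= mr] := near_infty_natSinv_lt (PosNum r0).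
  have [_] := H m0 I; apply => -[y nUy xy]; apply: nUy; apply: Hr.
  by apply: ball_sym; exact: (le_ball (ltW mr)).
have := @nonincreasing_cvg_mu _ _ _ mu F.
rewrite F0 measure0 => H.
have {}H : mu \o F @ \oo --> 0%E.
  have h0 : (mu (F 0%N) < +oo)%E by exact: (le_lt_trans (le_measure mu (mem_set (mF 0%N)) (mem_set measurableT) (@subsetT _ _)) mu_fin).
  apply: H => //.
  apply/nonincreasing_seqP => n; apply/subsetPset.
  have sub : inner_part U n `<=` inner_part U n.+1.
    move=> z Hz [y nUy yz]; apply: Hz; exists y => //.
    by apply: le_ball yz; rewrite lef_pV2 ?posrE// ler_nat.
  by move=> x [Ux nx]; split=> // /sub.
have fF m : mu (F m) \is a fin_num.
  rewrite ge0_fin_numE//.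
  exact: (le_lt_trans (le_measure mu (mem_set (mF m)) (mem_set measurableT) (@subsetT _ _)) mu_fin).
have /fine_cvgP[_ /cvgrPdist_le/(_ _ e0)[N _ HN]] := H.
exists N; have := HN N (leqnn _); rewrite /= sub0r normrN ger0_norm ?fine_ge0// -lee_fin fineK//.
Qed.

(* A null set lies in a null G_delta set [\bigcap_k U k], which is exhausted in
   measure by the closed sets [\bigcap_k inner_part (U k) (m k)]. *)
Lemma null_of_closed_null (B : set R) : measurable (B : set (measurableTypeR R)) ->
  (leb B = 0)%E -> mu B = 0%E.
Proof.
move=> mB B0.
have /choice[U HU] k : exists U : set R, [/\ open U, B `<=` U & (leb U < (k.+1%:R^-1)%:E)%E].
  have [||U [oU BU Ue]] := @lebesgue_regularity_outer R B k.+1%:R^-1 mB.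
  - exact: (eq_ind_r (fun z => (z < +oo)%E) (ltry 0) B0).
  - by rewrite invr_gt0.
  exists U; split => //; apply: le_lt_trans Ue.
  rewrite -[in leLHS](setDUK BU) measureU//=.
  - by rewrite B0 add0e.
  - by apply: measurableD => //; exact: open_measurable.
  - by rewrite setDIK.
have mU k : measurable (U k : set (measurableTypeR R)) by apply: open_measurable; case: (HU k).
pose D := \bigcap_k U k.
have mD : measurable (D : set (measurableTypeR R)) by exact: bigcapT_measurable.
have D0 (A : set R) : measurable (A : set (measurableTypeR R)) -> A `<=` D -> leb A = 0%E.
  move=> mA AD; apply/eqP; rewrite eq_le measure_ge0 andbT; apply/lee_addgt0Pr => e e0.
  rewrite add0e; have [m _ /(_ m (leqnn _)) /= me] := near_infty_natSinv_lt (PosNum e0).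
  have [_ _ /ltW H] := HU m; apply: (@le_trans _ _ (leb (U m))).
    by apply: (le_measure (@lebesgue_measure R) (mem_set mA) (mem_set (mU m))) => x /AD/(_ m I).
  by rewrite (le_trans H)// lee_fin ltW.
suff mD0 : mu D = 0%E.
  apply/eqP; rewrite eq_le measure_ge0 andbT -mD0; apply: (le_measure mu (mem_set mB) (mem_set mD)).
  by move=> x Bx k _; have [_ + _] := HU k; exact.
apply/eqP; rewrite eq_le measure_ge0 andbT; apply/lee_addgt0Pr => e e0; rewrite add0e.
have ek k : 0 < e / (2 ^ k.+1)%:R by rewrite divr_gt0// ltr0n expn_gt0.
have /choice[m Hm] k := inner_part_small (let: And3 oU _ _ := HU k in oU) (ek k).
pose K := \bigcap_k inner_part (U k) (m k).
have inU k : inner_part (U k) (m k) `<=` U k.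
  move=> x Hx; apply: contrapT => nUx; apply: Hx; exists x => //; exact: ballxx.
have cK : closed K by apply: closed_bigI => k _; exact: closed_inner_part.
have KD : K `<=` D by move=> x Kx k _; apply/inU/Kx.
have K0 : mu K = 0%E by apply: mu_closed => //; apply: D0 => //; exact: mclosed.
have mi k : measurable (U k `\` inner_part (U k) (m k) : set (measurableTypeR R)).
  by apply: measurableD => //; exact: (@measurable_inner_part (U k) (m k)).
apply: (@le_trans _ _ (mu K + mu (\bigcup_k (U k `\` inner_part (U k) (m k))))%E).
  have mK := mclosed cK; have mV := bigcupT_measurable _ mi.
  apply: le_trans (measureU2 mu mK mV).
  apply: (le_measure mu (mem_set mD) (mem_set (measurableU _ _ mK mV))).
    move=> x Dx; have [Kx|nK] := pselect (K x); [by left|right].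
    have [k nk] : exists k, ~ inner_part (U k) (m k) x.
      by apply: contrapT => H; apply: nK => k _; apply: contrapT => nk; apply: H; exists k.
    by exists k => //; split => //; exact: Dx.
rewrite K0 add0e; apply: (le_trans (@measure_sigma_subadditive _ _ _ mu _ _ mi (bigcupT_measurable _ mi) (@subset_refl _ _))).
apply: (@le_trans _ _ (\sum_(k <oo) (0 + (e / (2 ^ k.+1)%:R)%:E))%E).
  by apply: lee_nneseries => // k _; rewrite add0e.
by rewrite (le_trans (epsilon_trick _ _ (ltW e0)))// eseries0// add0e.
Qed.

End NullMeasure.

(** * From nonvanishing gradients to vanishing spectral mass *)

Section Expanding.
Variables (R : realType) (d : nat).
Implicit Types (f g : 'rV[R]_d -> R).

(** Some partial derivative [D] is nonzero, so small difference quotients of [f] have modulus at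
    least [|D| / 2]. It suffices that [1 / n.+1] is below both the radius and [|c| * |D| / 2]. In
    the application [g] is the scaled eigenvalue of slope [c] in [f]. *)
Lemma gradient_expanding f g (c : R) x : c != 0 -> (forall y, g y - g x = c * (f y - f x)) ->
  differentiable (f : 'rV[R]_d -> R^o) x -> gradient f x <> 0 -> exists i n, expanding g i n x.
Proof.
move=> c0 Hg df gf.
have [i Di] : exists i : 'I_d, 'D_(delta_mx 0 i) (f : 'rV[R]_d -> R^o) x != 0.
  apply: contrapT => H; apply: gf; apply/rowP => i; rewrite !mxE.
  by apply: contrapT => /eqP Di; apply: H; exists i.
exists i; set D := 'D_ _ _ _ in Di.
have : h^-1 *: ((f : 'rV[R]_d -> R^o) (h *: delta_mx 0 i + x) - f x) @[h --> 0^'] --> D.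
  exact: (@diff_derivable _ _ _ _ x (delta_mx 0 i) df).
have D0 : 0 < `|D| / 2 by rewrite divr_gt0// normr_gt0.
move=> /cvgrPdist_le/(_ _ D0)/nbhs_ballP[r /= r0 Hr].
have cD : 0 < `|c| * (`|D| / 2) by rewrite mulr_gt0// normr_gt0.
have [n1 _ Hn1] := near_infty_natSinv_lt (PosNum r0).
have [n2 _ Hn2] := near_infty_natSinv_lt (PosNum cD).
pose n := maxn n1 n2; exists n => t tn.
have /= nr := Hn1 n (leq_maxl _ _); have /= nD := Hn2 n (leq_maxr _ _).
have n0 : 0 < n.+1%:R :> R by rewrite ltr0n.
have [->|t0] := eqVneq t 0; first by rewrite normr0 mulr_ge0// ltW.
have := Hr t; rewrite /ball/= sub0r normrN (le_lt_trans tn nr) => /(_ isT t0).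
set q := _ *: _ => qD.
have q2 : `|D| / 2 <= `|q|.
  have := ler_normD q (D - q); rewrite addrC subrK; move: qD; rewrite distrC.
  by move: `|D| `|q| `|D - q| `|q - D| => *; lra.
have fq : f (t *: delta_mx 0 i + x) - f x = t * q by rewrite /q -[X in t * X]/(t^-1 * _) mulVKf.
rewrite (addrC x) Hg /axis fq normrM (normrM t).
have h : n.+1%:R^-1 <= `|c| * `|q| by rewrite (le_trans (ltW nD))// ler_wpM2l.
rewrite -ler_pdivrMl// (_ : `|c| * _ = `|c| * `|q| * `|t|); last by ring.
by rewrite ler_wpM2r.
Qed.

End Expanding.

Section LipschitzRows.
Variables (R : realType) (d : nat).
Hypothesis hd : (0 < d)%N.

Lemma row_norm_le (x : 'rV[R]_d) (e : R) : (forall l, `|x 0 l| <= e) -> `|x| <= e.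
Proof.
move=> xe; have e0 : 0 <= e by apply: le_trans (xe (Ordinal hd)).
rewrite [leLHS]/Num.norm /= mx_normrE; apply/bigmax_leP; split => // -[i l] _ /=.
by rewrite (ord1 i).
Qed.

Definition row_lipschitz (f : 'rV[R]_d -> R) (L : R) :=
  forall (x y : 'rV[R]_d) (e : R), (forall l : 'I_d, `|x 0 l - y 0 l| <= e) -> `|f x - f y| <= L * e.

Lemma lipschitz_rows (f : 'rV[R]_d -> R) : lipschitz (f : 'rV[R]_d -> R^o) ->
  exists2 L, 0 <= L & row_lipschitz f L.
Proof.
move=> /pinfty_ex_gt0[L L0 HL]; exists L; first exact: ltW.
move=> x y e xy; have := HL (x, y) (conj I I); move/le_trans; apply => /=.
by rewrite ler_pM2l//; apply: row_norm_le => l; rewrite !mxE.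
Qed.

Lemma row_lipschitz_continuous (f : 'rV[R]_d -> R) (L : R) : 0 <= L -> row_lipschitz f L -> continuous f.
Proof.
move=> L0 fL x; apply/(@cvgrPdist_le _ R^o _ (nbhs x) (nbhs_filter x)) => e e0.
have L1 : 0 < L + 1 by rewrite ltr_wpDl.
have eL : 0 < e / (L + 1) by rewrite divr_gt0.
near=> y; apply: (@le_trans _ _ (L * (e / (L + 1)))).
  apply: fL => l; have : `|x - y| <= e / (L + 1) by near: y; exact: cvgr_dist_le.
  apply: le_trans; have -> : x 0 l - y 0 l = (x - y) 0 l by rewrite !mxE.
  by rewrite [leRHS]/Num.norm /= mx_normrE; apply/bigmax_geP; right => /=; exists (0, l).
by rewrite mulrCA -[leRHS]mulr1 ler_wpM2l ?(ltW e0)// ler_pdivrMr// mul1r lerDl.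
Unshelve. all: by end_near. Qed.

End LipschitzRows.

Section NullSpectrum.
Variables (R : realType) (d nu : nat) (G : crystal R d nu).
Hypotheses (hd : (0 < d)%N) (nu0 : (0 < nu)%N).
Variable E : 'I_nu -> 'rV[R]_d -> R.
Hypothesis hE : floquet_eigenvalues G E.
Hypothesis hlip : forall j, lipschitz (E j : 'rV[R]_d -> R^o).

Local Notation sE := (@scaled_eigenvalue R d nu G E).

Lemma sE_lipschitz j : exists2 L, 0 <= L & row_lipschitz (sE j) L.
Proof.
have [L L0 HL] := lipschitz_rows hd (hlip j).
have c0 : 0 < (2 * hscale G)^-1 by rewrite invr_gt0 mulr_gt0 ?hscale_gt0.
exists ((2 * hscale G)^-1 * L); first by rewrite mulr_ge0// ltW.
move=> x y e /HL xy; rewrite /scaled_eigenvalue -mulrBr normrM gtr0_norm// -mulrA ler_pM2l//.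
by rewrite opprD addrACA subrr addr0.
Qed.

Hypothesis hgrad : forall j, almost_everywhere_on [set: 'rV[R]_d] (fun theta =>
  differentiable (E j : 'rV[R]_d -> R^o) theta /\ gradient (E j) theta <> 0).

Lemma sE_null_level j (K : set R) : (@lebesgue_measure R K = 0)%E ->
  lebesgue_null (@unit_cube R d `&` [set x | K (sE j x)]).
Proof.
move=> K0; have [L L0 HL] := sE_lipschitz j.
apply: (null_level hd L0 HL K0 (hgrad j)) => x nN.
have c0 : (2 * hscale G)^-1 != 0 by rewrite invr_eq0 mulf_neq0// gt_eqF ?hscale_gt0.
have [df gf] : differentiable (E j : 'rV[R]_d -> R^o) x /\ gradient (E j) x <> 0.
  by apply: contrapT => H; apply: nN.
apply: (gradient_expanding c0 _ df gf) => y.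
by rewrite /scaled_eigenvalue -mulrBr; congr (_ * _); ring.
Qed.

(** The tent dominates [\1_K], and its density is the limit of its grid averages. The width [m] is
    fixed first, for all bands at once; then each of the [nu] bands contributes at most [e / nu] on
    fine grids. *)
Lemma state_density_closed_null (K : set R) : closed K -> (@lebesgue_measure R K = 0)%E ->
  state_density G \1_K = 0.
Proof.
move=> cK KN; have [->|/set0P K0] := eqVneq K set0.
  rewrite /state_density big1// => j _; rewrite (@eq_integral01 _ _ _ (fun=> 0)); last first.
    by move=> x _; rewrite indicE in_set0.
  by rewrite /integral01 Rintegral_cst// mul0r.
have mK : measurable (K : set (measurableTypeR R)) by exact: closed_measurable.
have bK := bounded_measurable_indic mK.
have bb m : bounded_measurable (tent K m).
  split; first exact: (measurable_fun_lipschitzT (tent_lipschitz K0 m)).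
  by exists 1 => x _; rewrite ger0_norm; case/andP: (tent_itv K0 m x).
apply/eqP; rewrite eq_le; apply/andP; split; last first.
  apply: sumr_ge0 => j _; rewrite integral01_indic//; exact: fine_ge0.
have nuR : 0 < nu%:R :> R by rewrite ltr0n.
apply/ler_addgt0Pr => e e0; rewrite add0r.
have en : 0 < e / nu%:R by rewrite divr_gt0.
have H : \forall m \near \oo, forall j : 'I_nu, \forall N \near \oo,
    \sum_n tent K m (sE j (zero_grid R (d := d) (N := N.+1) n)) <= e / nu%:R * (N.+1 ^ d)%:R.
  apply: filter_forall => j; have [L L0 HL] := sE_lipschitz j.
  apply: null_level_grid => //; last exact: sE_null_level.
  exact: (@row_lipschitz_continuous R d (sE j) L L0 HL).
have [m Hm] : exists m, forall j : 'I_nu, \forall N \near \oo,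
    \sum_n tent K m (sE j (zero_grid R (d := d) (N := N.+1) n)) <= e / nu%:R * (N.+1 ^ d)%:R.
  by have [m _ /(_ m (leqnn _))] := H; exists m.
apply: (@le_trans _ _ (state_density G (tent K m))).
  apply: state_density_le => // x _; rewrite indicE; have [|_] := boolP (x \in K).
    by move=> /set_mem/(tent_mem K0 m)->.
  by case/andP: (tent_itv K0 m x).
have C := @grid_avg_lipschitz R d nu G nu0 E hE 0 _ _ (tent_lipschitz K0 m).
 rewrite -(cvg_lim (@norm_hausdorff _ R^o) C).
apply: limr_le; first by apply/cvg_ex; eexists; exact: C.
have {Hm} : \forall N \near \oo, forall j : 'I_nu,
    \sum_n tent K m (sE j (zero_grid R (d := d) (N := N.+1) n)) <= e / nu%:R * (N.+1 ^ d)%:R.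
  by apply: filter_forall.
apply: filterS => N HN; rewrite /grid_avg exchange_big/= mulrC ler_pdivrMr ?ltr0n ?expn_gt0//.
apply: (@le_trans _ _ (\sum_(j < nu) e / nu%:R * (N.+1 ^ d)%:R)); first by apply: ler_sum => j _; exact: HN.
rewrite sumr_const card_ord -[leLHS]mulr_natr mulrAC mulfVK ?gt_eqF//.
Qed.

(** The density is a sum of nonnegative terms, so each cell state gives no mass to closed null sets;
    [null_of_closed_null] passes to Borel sets. *)
Lemma smu_cell_null j (B : set (measurableTypeR R)) : measurable B -> (@lebesgue_measure R B = 0)%E ->
  integral01 (smu (cell_state G j)) \1_B = 0.
Proof.
move=> mB B0; pose I01 : set (measurableTypeR R) := `[0, 1]%classic.
have mI : measurable I01 by exact: measurable_itv.
have := @null_of_closed_null R (mrestr (smu (cell_state G j)) mI).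
rewrite integral01_indic// => H; rewrite [X in fine X](_ : _ = 0%E)//.
apply: (H _ _ B mB B0).
  have mTI : measurable (setT `&` I01) by exact: measurableI.
  exact: (le_lt_trans (le_measure (smu (cell_state G j)) (mem_set mTI) (mem_set measurableT) (@subsetT _ _)) (smu_fin _)).
move=> K cK K0; rewrite /mrestr.
have mK : measurable (K : set (measurableTypeR R)) by exact: closed_measurable.
have f0 i : 0 <= integral01 (smu (cell_state G i)) \1_K by rewrite integral01_indic// fine_ge0.
have := state_density_closed_null cK K0; rewrite /state_density => /psumr_eq0P => /(_ (fun i _ => f0 i)) /(_ j isT).
rewrite integral01_indic// => /eqP; rewrite fine_eq0; first by move/eqP.
rewrite ge0_fin_numE//.
have mKI := measurableI _ _ mK mI.
exact: (le_lt_trans (le_measure (smu (cell_state G j)) (mem_set mKI) (mem_set measurableT) (@subsetT _ _)) (smu_fin _)).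
Qed.

End NullSpectrum.

(** * The projection-valued measure *)

Section Translations.
Variables (R : realType) (d nu : nat) (G : crystal R d nu).
Local Notation T := (vertices G).
Local Notation H2 := (l2space R T).
Implicit Types (x y : H2) (v : T) (l : 'rV[int]_d) (B C : set (measurableTypeR R)).

Lemma sq_summable_shift l (y : T -> R) : sq_summable y -> sq_summable (fun v => y (vshift l v)).
Proof.
by rewrite /sq_summable (reindex_esum _ _ _ _ (@vshift_bij R d nu G l)).
Qed.

Definition l2shift l x : H2 := to_l2 (sq_summable_shift l (l2space_sq x)).

Lemma l2shiftE l x v : l2shift l x v = x (vshift l v). Proof. by []. Qed.

Lemma sop_shift l (y : T -> R) v : sop (fun u => y (vshift l u)) v = sop y (vshift l v).
Proof. by rewrite /sop hop_shift. Qed.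

Lemma iter_sop2_shift l x k v : iter k (@sop2 R d nu G) (l2shift l x) v = iter k (@sop2 R d nu G) x (vshift l v).
Proof.
elim: k v => [//|k IH] v; rewrite !iterS !sop2E -sop_shift.
have -> // : (iter k (@sop2 R d nu G) (l2shift l x) : T -> R) = fun u => iter k (@sop2 R d nu G) x (vshift l u).
by apply/funext => u; exact: IH.
Qed.

Lemma l2delta_shift i l : l2delta R (vertex G (i, l)) = l2shift (- l) (cell_state G i).
Proof.
apply: l2_ext => v; rewrite l2shiftE !l2deltaE -(vcoordK v); case: (vcoord v) => j k.
rewrite vshift_vertex; congr (nat_of_bool _)%:R.
apply/eqP/eqP => [/vertex_inj[-> ->]|/vertex_inj[-> /eqP]]; first by rewrite subrr.
by rewrite subr_eq0 => /eqP->.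
Qed.

(** Translations commute with the operator, so delta functions at translated vertices have the same
    moments. *)
Lemma smu_delta v B : measurable B ->
  integral01 (smu (l2delta R v)) \1_B = integral01 (smu (cell_state G (vcoord v).1)) \1_B.
Proof.
move=> mB; apply: (@sigma_functional_eq R (integral01 (smu (l2delta R v)))
  (integral01 (smu (cell_state G (vcoord v).1))) _ _ _ B mB) => [||k].
- exact: (sigma_functional_integral01 (smu_fin _)).
- exact: (sigma_functional_integral01 (smu_fin _)).
have e w : l2dot (iter k (@sop2 R d nu G) (l2delta R w)) (l2delta R w) = iter k (@sop2 R d nu G) (l2delta R w) w.
  by rewrite l2dotC l2dot_delta.
apply: (etrans (smuX (l2delta R v) k)); apply: (etrans (e v)); apply/esym.
apply: (etrans (smuX (cell_state G (vcoord v).1) k)); apply: (etrans (e _)); apply/esym.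
have H i l : iter k (@sop2 R d nu G) (l2delta R (vertex G (i, l))) (vertex G (i, l)) =
    iter k (@sop2 R d nu G) (l2delta R (vertex G (i, 0))) (vertex G (i, 0)).
  by rewrite l2delta_shift iter_sop2_shift vshift_vertex subrr.
have := H (vcoord v).1 (vcoord v).2; rewrite -surjective_pairing vcoordK.
exact.
Qed.

Lemma sproj_sym B x y : measurable B -> l2dot (sproj B x) y = l2dot x (sproj B y).
Proof. exact: spectral_proj_sym. Qed.

Lemma sproj_lin B c x y : measurable B -> sproj B (c *: x + y) = c *: sproj B x + sproj B y.
Proof. exact: spectral_proj_lin. Qed.

Lemma sprojI B C x : measurable B -> measurable C -> sproj (B `&` C) x = sproj B (sproj C x).
Proof. exact: spectral_projI. Qed.

Lemma sproj_full B x : measurable B -> `[0, 1]%classic `<=` B -> sproj B x = x.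
Proof. exact: spectral_proj_full. Qed.

Lemma sproj0 x : sproj set0 x = 0. Proof. exact: spectral_proj0. Qed.

Lemma sproj_eigen (r : R) x : sop2 (sproj [set r] x) = r *: sproj [set r] x.
Proof. exact: spectral_proj_eigen. Qed.

Lemma sproj_norm B x : measurable B -> l2dot (sproj B x) (sproj B x) = integral01 (smu x) \1_B.
Proof. by move=> mB; rewrite -sproj_diag// -[in RHS](setIid B) sprojI// [RHS]sproj_sym. Qed.

Lemma l2dot0l x : l2dot 0 x = 0.
Proof.
have := @l2dot_lin R T 1 0 0 x; rewrite scaler0 addr0 mul1r => /eqP.
by rewrite -subr_eq0 opprD addNKr oppr_eq0 => /eqP.
Qed.

Lemma sprojU B C x : measurable B -> measurable C -> B `&` C = set0 ->
  sproj (B `|` C) x = sproj B x + sproj C x.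
Proof.
move=> mB mC BC.
have ext (u v : H2) : (forall z : H2, l2dot u z = l2dot v z) -> u = v.
  by move=> H; apply: l2_ext => t; rewrite -!l2dot_delta !(l2dotC (l2delta _ _)) H.
apply: ext => z; rewrite -[X in X + _]scale1r l2dot_lin mul1r.
rewrite /sproj !spectral_projE//; last exact: measurableU.
rewrite /spectral_form.
set F := mixed _ _ _ _ _ _ _ _ x z.
have [lin _] : sigma_functional F by exact: sigma_mixed.
have := lin 1 \1_B \1_C (bounded_measurable_indic mB) (bounded_measurable_indic mC).
rewrite mul1r => <-; congr F; apply/funext => t; rewrite mul1r !indicE in_setU.
have [tB|_] := boolP (t \in B); have [tC|_] := boolP (t \in C); rewrite ?addr0 ?add0r//.
have : (B `&` C) t by split; exact: set_mem.
by rewrite BC.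
Qed.

(** The squared norm of the projected delta function is its spectral mass on [B], so [sproj B] kills
    delta functions; by symmetry all coordinates of [sproj B x] vanish. This leads from cell states
    to arbitrary states. *)
Lemma sproj_null B : measurable B -> (forall v, integral01 (smu (l2delta R v)) \1_B = 0) ->
  forall x, sproj B x = 0.
Proof.
move=> mB H x; have P0 v : sproj B (l2delta R v) = 0 by apply: l2dot_eq0; rewrite sproj_norm.
apply: l2_ext => v; rewrite -l2dot_delta -sproj_sym// P0 l2dot0l.
by [].
Qed.

End Translations.

Lemma l2dot_rsum (R : realType) (T : choiceType) (x y : l2space R T) :
  l2dot x y = rsum (fun t => x t * y t).
Proof. by []. Qed.

Opaque l2dot smu sproj.

(** * Complexification and countable additivity *)

Section SpectralResolution.
Variables (R : realType) (d nu : nat) (G : crystal R d nu).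
Local Notation T := (vertices G).
Local Notation H2 := (l2space R T).
Local Notation Re := complex.Re.
Local Notation Im := complex.Im.
Local Notation M := (hscale G).
Local Notation mR := (measurableTypeR R).
Implicit Types (x y : H2) (psi phi : T -> R[i]) (B C : set (measurableTypeR R)).

(** Junk [0] when [f] is not square summable, which makes [pvm] total. *)
Definition l2part (f : T -> R) : H2 := if pselect (sq_summable f) is left h then to_l2 h else 0.

Lemma l2partE f : sq_summable f -> (l2part f : T -> R) = f.
Proof. by move=> h; rewrite /l2part; case: pselect. Qed.

Definition re2 psi := l2part (fun t => Re (psi t)).
Definition im2 psi := l2part (fun t => Im (psi t)).
Definition cplx x y : T -> R[i] := fun t => x t +i* y t.

Lemma l2P psi : l2 psi <-> sq_summable (fun t => Re (psi t)) /\ sq_summable (fun t => Im (psi t)).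
Proof.
have s0 (f : T -> R) t : 0 <= f t ^+ 2 by exact: sqr_ge0.
split=> [h|[h1 h2]].
  by split; apply: le_lt_trans h; apply: le_esumR => t /=;
    have := sqr_ge0 (Re (psi t)); have := sqr_ge0 (Im (psi t)); lra.
rewrite /l2 /l2normsq (esumRD (s0 _) (s0 _)).
exact: lte_add_pinfty.
Qed.

Lemma l2_cplx x y : l2 (cplx x y).
Proof. by apply/l2P; split; exact: l2space_sq. Qed.

Lemma re2_cplx x y : re2 (cplx x y) = x.
Proof. by apply: l2_ext => t; rewrite /re2 l2partE//; exact: l2space_sq. Qed.

Lemma im2_cplx x y : im2 (cplx x y) = y.
Proof. by apply: l2_ext => t; rewrite /im2 l2partE//; exact: l2space_sq. Qed.

Lemma cplx_re2_im2 psi : l2 psi -> cplx (re2 psi) (im2 psi) = psi.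
Proof.
move=> /l2P[h1 h2]; apply/funext => t; rewrite /cplx /re2 /im2 !l2partE//.
by case: (psi t).
Qed.

Lemma cplx_lin (c : R[i]) x y x' y' : (fun t => c * cplx x y t + cplx x' y' t) =
  cplx (Re c *: x + (- Im c *: y + x')) (Re c *: y + (Im c *: x + y')).
Proof.
apply/funext => t; apply: complex_eq; rewrite ?complexReD ?complexImD ?complexReM ?complexImM /=.
  by rewrite -[RHS]/(Re c * x t + (- Im c * y t + x' t)); ring.
by rewrite -[RHS]/(Re c * y t + (Im c * x t + y' t)); ring.
Qed.

Lemma dotl2_cplx x y x' y' : dotl2 (cplx x y) (cplx x' y') =
  (l2dot x x' + l2dot y y') +i* (l2dot x y' - l2dot y x').
Proof.
have s (u v : H2) : abs_summable (fun t => u t * v t) by apply: abs_summable_mul; exact: l2space_sq.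
rewrite /dotl2 /csum !l2dot_rsum; congr (_ +i* _).
  by rewrite -rsumD//; congr rsum; apply/funext => t; rewrite complexReM/=; ring.
rewrite -[- _]mulN1r addrC -rsum_lin//; congr rsum; apply/funext => t.
by rewrite complexImM/=; ring.
Qed.

Lemma l2normsq_cplx x y : l2normsq (cplx x y) = (l2dot x x + l2dot y y)%:E.
Proof.
have s0 (f : T -> R) t : 0 <= f t ^+ 2 by exact: sqr_ge0.
rewrite /l2normsq (esumRD (s0 _) (s0 _)) !l2dotE EFinD !esumR_fineK//; exact: l2space_sq.
Qed.

(* Inverse of the affine map [sop] applies to the spectrum. *)
Definition unscaled (s : R) : R := 2 * M * s - M.

Lemma measurable_unscale : measurable_fun [set: mR] (unscaled : mR -> mR).
Proof.
apply: (measurable_fun_lipschitzT (K := 2 * M)) => s t.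
by rewrite /unscaled opprB addrA subrK -mulrBr normrM gtr0_norm// mulr_gt0// hscale_gt0.
Qed.

Lemma measurable_unscale_preimage B : measurable B -> measurable (unscaled @^-1` B : set mR).
Proof. by move=> mB; rewrite -[_ @^-1` _]setTI; exact: measurable_unscale. Qed.

(** Real projections of the scaled operator acting on both parts; the preimage under [unscaled]
    transports them to the spectrum of the original operator. *)
Definition pvm (B : set R) psi : T -> R[i] :=
  cplx (sproj (unscaled @^-1` B) (re2 psi)) (sproj (unscaled @^-1` B) (im2 psi)).

Lemma pvm_cplx B x y : pvm B (cplx x y) = cplx (sproj (unscaled @^-1` B) x) (sproj (unscaled @^-1` B) y).
Proof. by rewrite /pvm re2_cplx im2_cplx. Qed.

Lemma dotl2_diag psi B : l2 psi -> measurable B ->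
  Re (dotl2 psi (pvm B psi)) = integral01 (smu (re2 psi)) \1_(unscaled @^-1` B)
    + integral01 (smu (im2 psi)) \1_(unscaled @^-1` B).
Proof.
move=> hpsi mB; have mB' := measurable_unscale_preimage mB.
rewrite -{1}(cplx_re2_im2 hpsi) dotl2_cplx /=.
by rewrite l2dotC sproj_diag// l2dotC sproj_diag.
Qed.

Lemma pvm_projection B : measurable B -> orthogonal_projection (pvm B).
Proof.
move=> mB; have mB' := measurable_unscale_preimage mB; split.
- by move=> psi _; exact: l2_cplx.
- move=> c phi psi /cplx_re2_im2 <- /cplx_re2_im2 <-.
  by rewrite cplx_lin !pvm_cplx cplx_lin !sproj_lin.
- have e x : sproj (unscaled @^-1` B) (sproj (unscaled @^-1` B) x) = sproj (unscaled @^-1` B) x.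
    by rewrite -sprojI// setIid.
  by move=> psi _; apply: (etrans (pvm_cplx _ _ _)); exact: (f_equal2 cplx (e _) (e _)).
- move=> phi psi /cplx_re2_im2 <- /cplx_re2_im2 <-.
  move: (re2 phi) (im2 phi) (re2 psi) (im2 psi) => a b a' b'.
  rewrite (pvm_cplx B a b) (pvm_cplx B a' b') (dotl2_cplx a) (dotl2_cplx (sproj _ a)).
  have e1 := sproj_sym a a' mB'; have e2 := sproj_sym b b' mB'.
  have e3 := sproj_sym a b' mB'; have e4 := sproj_sym b a' mB'.
  apply: (f_equal2 (fun u v : R => u +i* v)).
    exact: (esym (f_equal2 (fun u v : R => u + v) e1 e2)).
  exact: (esym (f_equal2 (fun u v : R => u - v) e3 e4)).
Qed.

(** The remainder after [n] terms is the projection on the tail union [D n]. Its squared norm is the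
    spectral mass of [D n], which tends to [0] because each point leaves the tails of a disjoint
    sequence. *)
Lemma pvm_sigma_additive (F : nat -> set mR) : (forall n, measurable (F n)) ->
  trivIset [set: nat] F -> forall psi, l2 psi ->
  (fun n => l2normsq (fun t => pvm (\bigcup_k F k) psi t - \sum_(k < n) pvm (F k) psi t)) @ \oo --> 0%E.
Proof.
move=> mF tF psi hpsi; pose F' n := unscaled @^-1` F n : set mR.
have mF' n : measurable (F' n) by exact: measurable_unscale_preimage.
pose D n := \bigcup_k F' (n + k)%N : set mR.
have mD n : measurable (D n) by exact: bigcupT_measurable.
have DS n : D n = F' n `|` D n.+1.
  apply/seteqP; split => x.
    by move=> [[|k] _ xk]; [left; rewrite addn0 in xk|right; exists k => //; rewrite addSnnS].
  by move=> [xn|[k _ xk]]; [exists 0%N; rewrite ?addn0|exists k.+1; rewrite -?addSnnS].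
have FD n : F' n `&` D n.+1 = set0.
  apply/seteqP; split => // x [xn [k _ xk]].
  have /trivIsetP/(_ n (n.+1 + k)%N I I) := tF; rewrite neq_ltn addSn ltnS leq_addr => /(_ isT).
  by move=> /seteqP[+ _] => /(_ (unscaled x)); apply.
have telescope_D n (x : H2) : sproj (D 0) x - \sum_(k < n) sproj (F' k) x = sproj (D n) x.
  elim: n => [|n IH]; first by rewrite big_ord0 subr0.
  by rewrite big_ord_recr/= opprD addrA IH DS sprojU// addrAC subrr add0r.
have DT : unscaled @^-1` (\bigcup_k F k) = D 0 by apply/seteqP; split => x.
have E n : (fun t => pvm (\bigcup_k F k) psi t - \sum_(k < n) pvm (F k) psi t) =
    cplx (sproj (D n) (re2 psi)) (sproj (D n) (im2 psi)).
  have l2sumE (I : Type) (r : seq I) (f : I -> H2) t : (\sum_(i <- r) f i : H2) t = \sum_(i <- r) f i t.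
    by elim: r => [|i r IH]; rewrite ?big_nil// !big_cons -IH.
  apply/funext => t; rewrite -(telescope_D n (re2 psi)) -(telescope_D n (im2 psi)); apply: complex_eq.
    rewrite complexReD -[- _]mulN1r complexReM Re_sum/= oppr0 mul0r subr0 mulN1r /pvm DT/=.
    by rewrite -[RHS]/(_ - (\sum_(i < n) sproj (F' i) (re2 psi) : H2) t) l2sumE.
  rewrite complexImD -[- _]mulN1r complexImM Im_sum/= oppr0 mul0r addr0 mulN1r /pvm DT/=.
  by rewrite -[RHS]/(_ - (\sum_(i < n) sproj (F' i) (im2 psi) : H2) t) l2sumE.
have En n : l2normsq (fun t => pvm (\bigcup_k F k) psi t - \sum_(k < n) pvm (F k) psi t) =
    (integral01 (smu (re2 psi)) \1_(D n) + integral01 (smu (im2 psi)) \1_(D n))%:E.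
  rewrite E; move: (re2 psi) (im2 psi) => a b; rewrite (l2normsq_cplx (sproj _ a)).
  by rewrite -(sproj_norm a (mD n)) -(sproj_norm b (mD n)).
under eq_fun do rewrite En.
have L x : (fun n => integral01 (smu x) \1_(D n)) @ \oo --> (0 : R).
  have z : integral01 (smu x) (fun=> 0) = 0 by rewrite /integral01 Rintegral_cst// mul0r.
  rewrite -z; apply: (integral01_cvg (smu_fin x) (C := 1)).
  - by move=> n; exact: measurable_indic.
  - by move=> n t _; rewrite indicE; case: (_ \in _); rewrite ?normr1 ?normr0.
  - move=> t _; apply: cvg_near_cst.
    have [[k Dk]|nk] := pselect (exists k, F' k t).
      exists k.+1 => // n /= kn; rewrite indicE memNset// => -[m _ Fm].
      have /trivIsetP/(_ k (n + m)%N I I) := tF; rewrite neq_ltn ltn_addr// => /(_ isT).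
      by move=> /seteqP[+ _] => /(_ (unscaled t)); apply.
    exists 0%N => // n _ /=; rewrite indicE memNset// => -[m _ Fm].
    by apply: nk; exists (n + m)%N.
  - exact: bounded_measurable_cst.
apply: cvg_EFin; first by near=> n.
rewrite -[X in _ --> X](addr0 (0 : R)).
by apply: cvgD; exact: L.
Unshelve. all: by end_near. Qed.

End SpectralResolution.

(** * The operator as an integral against its projections *)

Section SpectralIntegral.
Variables (R : realType) (d nu : nat) (G : crystal R d nu).
Local Notation T := (vertices G).
Local Notation H2 := (l2space R T).
Local Notation M := (hscale G).
Local Notation mR := (measurableTypeR R).
Local Notation unscale := (@unscaled R d nu G).
Implicit Types (x y : H2) (psi phi : T -> R[i]) (B : set mR).

Let mI : measurable (`[0, 1]%classic : set mR). Proof. exact: measurable_itv. Qed.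

(* Composing with the retraction onto the unit interval makes the integrand bounded. *)
Definition unscale01 (s : mR) : mR := unscale (Num.max 0 (Num.min 1 s)).

Lemma unscale01E (s : R) : 0 <= s <= 1 -> unscale01 s = unscale s.
Proof. by move=> /andP[s0 s1]; rewrite /unscale01 (min_idPr s1) (max_idPr s0). Qed.

Lemma unscale_bound (s : R) : 0 <= s <= 1 -> `|unscale s| <= M.
Proof.
have M0 := hscale_gt0 G; move=> /andP[s0 s1]; rewrite /unscale ler_norml.
by apply/andP; split; nra.
Qed.

Lemma unscale01_bound (s : R) : `|unscale01 s| <= M.
Proof.
apply: unscale_bound; rewrite le_max lexx/= ge_max ler01/= ge_min lexx.
by [].
Qed.

Lemma measurable_unscale01 : measurable_fun [set: mR] unscale01.
Proof.
apply: (measurable_fun_lipschitzT (K := 2 * M)) => s t.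
have M0 : 0 < 2 * M by rewrite mulr_gt0// hscale_gt0.
rewrite /unscale01 /unscaled opprB addrA subrK -mulrBr normrM gtr0_norm//.
by rewrite ler_wpM2l ?(ltW M0)//; exact: clamp01_lipschitz.
Qed.

Definition pushed_measure x : {measure set mR -> \bar R} :=
  measure_function_pushforward__canonical__measure_function_Measure
    (mrestr (smu x) mI) measurable_unscale01.

Lemma pushed_measureE x B : measurable B ->
  pushed_measure x B = (integral01 (smu x) \1_(unscale @^-1` B))%:E.
Proof.
move=> mB; have mB' := measurable_unscale_preimage G mB; rewrite integral01_indic// fineK.
  rewrite /pushed_measure /= /pushforward /mrestr; congr (smu x _).
  by apply/seteqP; split => s [] /= h1 h2; split => //; move: h1; rewrite /= unscale01E//;
    move: h2; rewrite /= in_itv.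
have mBI := measurableI _ _ mB' mI.
rewrite ge0_fin_numE//.
exact: (le_lt_trans (le_measure (smu x) (mem_set mBI) (mem_set measurableT) (@subsetT _ _)) (smu_fin x)).
Qed.

Let restr_fin x : (mrestr (smu x) mI setT < +oo)%E.
Proof.
have mTI : measurable (setT `&` `[0, 1]%classic : set mR) by exact: measurableI.
exact: (le_lt_trans (le_measure (smu x) (mem_set mTI) (mem_set measurableT) (@subsetT _ _)) (smu_fin _)).
Qed.

Let integrable_restr x : (mrestr (smu x) mI).-integrable setT (EFin \o unscale01).
Proof.
apply: (@measurable_bounded_integrable _ mR R _ unscale01 setT measurableT (restr_fin x) measurable_unscale01).
exists M; split; first exact: num_real.
by move=> r Mr s _; apply: (le_trans (unscale01_bound s)); exact: ltW.
Qed.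

Lemma integrable_pushed x : (pushed_measure x).-integrable setT (EFin \o (id : mR -> R)).
Proof.
apply: (integrable_pushforward measurable_unscale01) => //.
  by apply/measurable_EFinP; exact: measurable_id.
by rewrite preimage_setT; exact: integrable_restr.
Qed.

(** On the unit interval the integrand is affine, so only the moments of orders 0 and 1 enter, and
    [2 * M] times the scaled form minus [M] times the squared norm is the form of [hop2]. *)
Lemma integral_pushed x : (\int[pushed_measure x]_s (s : R)%:E = (l2dot (hop2 x) x)%:E)%E.
Proof.
rewrite (integral_pushforward measurable_unscale01 (f := EFin \o (id : mR -> R)))//; last 2 first.
  by apply/measurable_EFinP; exact: measurable_id.
  by rewrite preimage_setT; exact: integrable_restr.
rewrite preimage_setT.
have mN : measurable (~` `[0, 1]%classic : set mR) by exact: measurableC.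
(* The restricted measure gives no mass to the complement of the unit interval. *)
rewrite (negligible_integral mN measurableT (integrable_restr x)); last first.
  exact: (etrans (congr1 (smu x) (setICl _)) (measure0 _)).
rewrite setTD setCK (@eq_measure_integral _ _ _ _ (smu x)); last first.
  by move=> A mA AI; rewrite /mrestr; congr (smu x _); apply/setIidl.
have b1 : bounded_measurable (fun s : R => s ^+ 1) by exact: bounded_measurableX.
have b0 : bounded_measurable (fun s : R => s ^+ 0) by exact: bounded_measurableX.
have bu : bounded_measurable unscale01.
  split; first exact: measurable_unscale01.
  by exists M => s _; exact: unscale01_bound.
rewrite -[LHS]fineK; last first.
  by apply: integrable_fin_num => //; exact: (bounded_measurable_integrable (smu_fin x)).
congr _%:E; rewrite -[LHS]/(integral01 (smu x) unscale01).
rewrite (@eq_integral01 _ _ _ (fun s => 2 * M * s ^+ 1 + - M * s ^+ 0)); last first.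
  by move=> s s01; rewrite unscale01E// /unscaled expr1 expr0 mulr1.
rewrite (integral01D (smu_fin x)); [|exact: bounded_measurableZ|exact: bounded_measurableZ].
rewrite !(integral01Z (smu_fin x))// (smuX x 1) (smuX x 0).
have -> : l2dot (iter 1 (@sop2 R d nu G) x) x = (2 * M)^-1 * (l2dot (hop2 x) x + M * l2dot x x).
  rewrite -[iter 1 _ _]/((2 * M)^-1 *: (hop2 x + M *: x)) -[_ *: _]addr0 l2dot_lin l2dot0l addr0.
  by rewrite (addrC (hop2 x)) l2dot_lin addrC.
rewrite -[iter 0 _ _]/x; have M0 := hscale_gt0 G.
move: (l2dot (hop2 x) x) (l2dot x x) M M0 => a b m m0.
by field; rewrite gt_eqF.
Qed.

(** The measure is the sum of those of the real and imaginary parts; the imaginary part of the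
    quadratic form cancels by symmetry of [hop2]. *)
Lemma pvm_integral psi : l2 psi ->
  exists2 mu : {measure set mR -> \bar R}, spectral_measure (@pvm R d nu G) psi mu
    & dotl2 psi (schrodinger psi) = (\int[mu]_s (s : R))%:C.
Proof.
move=> hpsi; exists (measure_add (pushed_measure (re2 psi)) (pushed_measure (im2 psi))).
  move=> B mB; apply: (etrans (measure_addE _ _ _)); rewrite (dotl2_diag hpsi mB).
  move: (re2 psi) (im2 psi) => x y; rewrite EFinD.
  exact: (f_equal2 (fun u v => u + v)%E (pushed_measureE x mB) (pushed_measureE y mB)).
have I x y : (\int[measure_add (pushed_measure x) (pushed_measure y)]_s (s : R)) =
    l2dot (hop2 x) x + l2dot (hop2 y) y.
  rewrite /Rintegral (integral_measure_add measurableT (integrable_pushed x) (integrable_pushed y)).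
  exact: (congr1 fine (f_equal2 (fun u v => u + v)%E (integral_pushed x) (integral_pushed y))).
rewrite {}I.
rewrite -{1 2}(cplx_re2_im2 hpsi); move: (re2 psi) (im2 psi) => x y.
have -> : schrodinger (cplx x y) = cplx (hop2 x) (hop2 y).
  by apply/funext => v; apply: (etrans (schrodingerE _ v)).
have e : l2dot x (hop2 y) - l2dot y (hop2 x) = 0 by rewrite (l2dotC y (hop2 x)) hop2_sym subrr.
by rewrite (dotl2_cplx x) e (l2dotC x (hop2 x)) (l2dotC y (hop2 y)).
Qed.

Lemma pvm_spectral_resolution : spectral_resolution (@schrodinger R d nu G) (@pvm R d nu G).
Proof.
have M0 := hscale_gt0 G.
split.
- exact: pvm_projection.
- move=> psi _; rewrite /pvm preimage_set0 !sproj0; apply/funext => t.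
  by rewrite /cplx.
(* The spectrum lies in the closed interval from [- M] to [M]; the interval asked for is open. *)
- exists (M + 1) => psi hpsi; rewrite /pvm.
  have mB : measurable (`]- (M + 1), M + 1[%classic : set mR) by exact: measurable_itv.
  have mB' := measurable_unscale_preimage G mB.
  have sub : `[0, 1]%classic `<=` (unscale @^-1` `]- (M + 1), M + 1[%classic).
    move=> s /=; rewrite !in_itv/= => /unscale_bound; rewrite ler_norml; lra.
  rewrite (sproj_full (re2 psi) mB' sub) (sproj_full (im2 psi) mB' sub).
  exact: cplx_re2_im2.
- move=> B C mB mC psi _; rewrite -[X in pvm B X]/(cplx _ _) pvm_cplx /pvm preimage_setI.
  have mB' := measurable_unscale_preimage G mB; have mC' := measurable_unscale_preimage G mC.
  by rewrite (sprojI (re2 psi) mB' mC') (sprojI (im2 psi) mB' mC').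
- exact: pvm_sigma_additive.
- exact: pvm_integral.
Qed.

End SpectralIntegral.

(** * Spectral measures of null sets *)

Section AbsoluteContinuity.
Variables (R : realType) (d nu : nat) (G : crystal R d nu).
Local Notation T := (vertices G).
Local Notation mR := (measurableTypeR R).

(** Taking preimages divides lengths by [2 * M >= 1], so the pulled-back cover is no longer than the
    given one. *)
Lemma lebesgue_unscale_preimage (B : set mR) : measurable B -> (@lebesgue_measure R B = 0)%E ->
  (@lebesgue_measure R (@unscaled R d nu G @^-1` B) = 0)%E.
Proof.
move=> mB B0; have mB' := measurable_unscale_preimage G mB.
have M0 := hscale_gt0 G; have M1 := hscale_ge1 G; set M := hscale G in M0 M1.
apply/eqP; rewrite eq_le measure_ge0 andbT; apply/lee_addgt0Pr => e e0; rewrite add0e.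
have [a [b [ab Bab Sab]]] := null_itv_cover B0 e0.
pose F k : set mR := `[(a k + M) / (2 * M), (b k + M) / (2 * M)]%classic.
have mF k : measurable (F k) by exact: measurable_itv.
have BF : unscaled G @^-1` B `<=` \bigcup_k F k.
  move=> s /Bab[k _ /= abk]; exists k => //; rewrite /F/= in_itv/=.
  by move: abk; rewrite /unscaled -/M ler_pdivrMr ?mulr_gt0// ler_pdivlMr ?mulr_gt0//; lra.
apply: (le_trans (@measure_sigma_subadditive _ _ _ (@lebesgue_measure R) _ _ mF mB' BF)).
apply: le_trans Sab; apply: lee_nneseries => // k _.
rewrite -[X in (X <= _)%E]/(@lebesgue_measure R (F k)) /F lebesgue_measure_itv/= lte_fin.
case: ifPn => [_|_]; last by rewrite lee_fin subr_ge0.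
rewrite -EFinB lee_fin -mulrBl ler_pdivrMr ?mulr_gt0//.
have := ab k; move: (a k) (b k) => u v uv; nra.
Qed.

Hypotheses (hd : (0 < d)%N) (nu0 : (0 < nu)%N).
Variable E : 'I_nu -> 'rV[R]_d -> R.
Hypothesis hE : floquet_eigenvalues G E.
Hypothesis hlip : forall j, lipschitz (E j : 'rV[R]_d -> R^o).
Hypothesis hgrad : forall j, almost_everywhere_on [set: 'rV[R]_d] (fun theta =>
  differentiable (E j : 'rV[R]_d -> R^o) theta /\ gradient (E j) theta <> 0).

Lemma schrodinger_absolutely_continuous : purely_absolutely_continuous (@schrodinger R d nu G).
Proof.
exists (@pvm R d nu G); first exact: pvm_spectral_resolution.
move=> psi hpsi mu Hmu N N0 A mA AN; rewrite (Hmu A mA) (dotl2_diag hpsi mA).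
have A0 : (@lebesgue_measure R A = 0)%E by exact: N0.
have mA' := measurable_unscale_preimage G mA; have A'0 := lebesgue_unscale_preimage mA A0.
have P0 := sproj_null mA' (fun v => etrans (smu_delta v mA') (smu_cell_null hd nu0 hE hlip hgrad _ mA' A'0)).
have Z (x : l2space R T) : integral01 (smu x) \1_(unscaled G @^-1` A) = 0.
  by rewrite -(sproj_diag x mA') P0 l2dot0l.
by rewrite (Z (re2 psi)) (Z (im2 psi)) addr0.
Qed.

End AbsoluteContinuity.

(** * Functions with vanishing gradient *)

Section FlatLine.
Variable R : realType.
Implicit Types (a b t u v w : R).

(** Supremum argument: the local property at the supremum of the good endpoints joins a good point
    on its left to a point beyond it, unless the supremum is [b]. *)
Lemma itv_induction a b (P : R -> R -> Prop) : a <= b ->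
  (forall u v w, a <= u -> u <= v -> v <= w -> w <= b -> P u v -> P v w -> P u w) ->
  (forall t, a <= t <= b -> exists2 e, 0 < e & forall u v, a <= u -> u <= t -> t <= v -> v <= b ->
     v - u < e -> P u v) ->
  P a b.
Proof.
move=> ab Padd Ploc; pose S : set R := [set t | a <= t <= b /\ P a t].
have Sa : S a.
  split; first by rewrite lexx.
  have [|e e0 He] := Ploc a; first by rewrite lexx.
  by apply: He; rewrite ?subrr.
have hS : has_sup S by split; [exists a|exists b => t [/andP[]]].
have sa : a <= sup S by apply: ub_le_sup => //; case: hS.
have sb : sup S <= b by apply: ge_sup => //; [exists a|move=> t [/andP[]]].
have [|e e0 He] := Ploc (sup S); first by rewrite sa.
have e2 : 0 < e / 2 by rewrite divr_gt0.
have [t [/andP[at_ tb] Pt] st] := sup_adherent e2 hS.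
have ts : t <= sup S by apply: ub_le_sup; [case: hS|split => //; rewrite at_].
(* [t] is within [e / 2] on the left and [v] within [e / 3] on the right, so [v - t < e]. *)
pose v := Num.min b (sup S + e / 3).
have e3 : 0 < e / 3 by rewrite divr_gt0.
have sv : sup S <= v by rewrite le_min sb lerDl ltW.
have vb : v <= b by rewrite ge_min lexx.
have ve : v <= sup S + e / 3 by rewrite ge_min lexx orbT.
have Ptv : P t v by apply: He => //; lra.
have Pv : P a v by apply: (Padd a t v) => //; exact: le_trans sv.
have vs : v <= sup S by apply: ub_le_sup; [case: hS|split => //; rewrite vb andbT (le_trans sa)].
have -> // : b = v.
apply/eqP; rewrite eq_le vb andbT leNgt; apply/negP => vb'.
have [vE|vE] : v = b \/ v = sup S + e / 3 by rewrite /v minElt; case: ifP; [left|right].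
  by rewrite vE ltxx in vb'.
by rewrite vE in vs; lra.
Qed.

(** Take [U] open around [N] of measure at most [r]. The bound of [|h v - h u|] by [r * (v - u)]
    plus [L] times the measure of [U] in []u, v]] is additive, so it may be checked locally: near a
    point of [N] the interval lies in [U] and the Lipschitz bound suffices, elsewhere the derivative
    vanishes. *)
Lemma flat_line (h : R -> R) (L a b : R) (N : set R) : a <= b -> 0 <= L ->
  (forall u v, `|h u - h v| <= L * `|u - v|) ->
  measurable (N : set (measurableTypeR R)) -> (@lebesgue_measure R N = 0)%E ->
  (forall t, a <= t <= b -> ~ N t -> forall e, 0 < e ->
     \forall s \near (0 : R), `|h (t + s) - h t| <= e * `|s|) ->
  h a = h b.
Proof.
move=> ab L0 hL mN N0 Hd; apply/eqP; rewrite -subr_eq0 -normr_le0.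
apply/ler_addgt0Pr => e e0; rewrite add0r.
have K0 : 0 < L + (b - a) + 1 by rewrite ltr_wpDl// addr_ge0// subr_ge0.
pose r := e / (L + (b - a) + 1); have r0 : 0 < r by rewrite divr_gt0.
have [||U [oU NU Ue]] := @lebesgue_regularity_outer R N r mN.
- exact: (eq_ind_r (fun z => (z < +oo)%E) (ltry 0) N0).
- by [].
have mU : measurable (U : set (measurableTypeR R)) by exact: open_measurable.
have Ur : (@lebesgue_measure R U <= r%:E)%E.
  rewrite -[in leLHS](setDUK NU) measureU//=.
  - by rewrite N0 add0e ltW.
  - exact: measurableD.
  - by rewrite setDIK.
pose J u v : set (measurableTypeR R) := U `&` `]u, v]%classic.
have mJ u v : measurable (J u v) by apply: measurableI => //; exact: measurable_itv.
have leJU u v : (@lebesgue_measure R (J u v) <= r%:E)%E.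
  apply: le_trans Ur; apply: (le_measure (@lebesgue_measure R) (mem_set (mJ u v)) (mem_set mU)).
  by move=> x [].
have fJ u v : @lebesgue_measure R (J u v) \is a fin_num.
  by rewrite ge0_fin_numE// (le_lt_trans (leJU u v))// ltry.
pose g u v := fine (@lebesgue_measure R (J u v)).
have g0 u v : 0 <= g u v by apply: fine_ge0; exact: measure_ge0.
have main : `|h b - h a| <= r * (b - a) + L * g a b.
  apply: (@itv_induction a b (fun u v => `|h v - h u| <= r * (v - u) + L * g u v)) => //.
    move=> u v w _ uv vw _ Puv Pvw.
    have -> : g u w = g u v + g v w.
      rewrite /g -fineD//; congr fine; rewrite -measureU//.
        congr (@lebesgue_measure R _); apply/seteqP; split => x; rewrite /J/= !in_itv/=.
          by move=> [Ux /andP[ux xw]]; have [xv|vx] := leP x v; [left|right]; split => //; apply/andP.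
        move=> [[Ux /andP[ux xv]]|[Ux /andP[vx xw]]]; split => //; apply/andP; split => //.
          exact: le_trans vw.
        exact: le_lt_trans vx.
      apply/seteqP; split => // x [[_]] /=; rewrite in_itv/= => /andP[_ xv] [_] /=.
      by rewrite in_itv/= ltNge xv.
    have -> : h w - h u = (h w - h v) + (h v - h u) by ring.
    by apply: (le_trans (ler_normD _ _)); lra.
  move=> t tab; have [Nt|nNt] := pselect (N t).
    have /nbhs_ballP[e1 /= e10 Hb] := open_nbhs_nbhs (conj oU (NU _ Nt)).
    exists e1 => // u v _ ut tv _ uv; have uv' : u <= v by exact: le_trans tv.
    have -> : g u v = v - u.
      rewrite /g (_ : J u v = `]u, v]%classic).
        have [uv0|uv0] := ltP u v; first by rewrite lebesgue_measure_itv/= lte_fin uv0 -EFinB.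
        have -> : u = v by apply/eqP; rewrite eq_le uv'.
        by rewrite set_itvoc0 measure0 subrr.
      apply/seteqP; split=> x; first by move=> [].
      rewrite /= in_itv/= => /andP[ux xv]; split; last by rewrite /= in_itv/= ux.
      by apply: Hb; rewrite /ball/= ltr_norml; lra.
    apply: (le_trans (hL v u)); rewrite ger0_norm ?subr_ge0// lerDr mulr_ge0 ?subr_ge0//.
    exact: ltW.
  have /nbhs_ballP[e1 /= e10 Hb] := Hd t tab nNt r r0.
  exists e1 => // u v _ ut tv _ uv.
  have D s : `|s - t| < e1 -> `|h s - h t| <= r * `|s - t|.
    by move=> st; have := Hb (s - t); rewrite /ball/= sub0r normrN (addrC t) subrK; exact.
  have vt : `|h v - h t| <= r * (v - t).
    by rewrite -[X in _ * X]ger0_norm ?subr_ge0//; apply: D; rewrite ger0_norm ?subr_ge0//; lra.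
  have ut' : `|h u - h t| <= r * (t - u).
    rewrite -[X in _ * X]ger0_norm ?subr_ge0// (distrC t); apply: D.
    by rewrite distrC ger0_norm ?subr_ge0//; lra.
  have -> : h v - h u = (h v - h t) - (h u - h t) by ring.
  apply: (le_trans (ler_normB _ _)).
  by have := mulr_ge0 L0 (g0 u v); lra.
rewrite distrC (le_trans main)//.
have : g a b <= r by rewrite -lee_fin fineK// leJU.
have : e = r * (L + (b - a) + 1) by rewrite /r divfK// gt_eqF.
move: (g a b) => q -> qr; have := ler_wpM2l L0 qr; lra.
Qed.

End FlatLine.

Lemma injective_unbounded (g : nat -> nat) : injective g -> forall n, exists k, (n <= g k)%N.
Proof.
move=> ig n; apply: contrapT => H.
have Hk k : (g k < n)%N by rewrite ltnNge; apply/negP => nk; apply: H; exists k.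
have := @uniq_leq_size _ (map g (iota 0 n.+1)) (iota 0 n).
rewrite map_inj_uniq// iota_uniq size_map !size_iota ltnn => /(_ isT) F.
have // : false.
by apply: F => _ /mapP[k _ ->]; rewrite mem_iota add0n Hk.
Qed.

(** * Slicing a null set one coordinate at a time *)

Section Slices.
Variables (R : realType) (d : nat).
Implicit Types (x y : 'rV[R]_d) (l i : 'I_d).

(** Covers of volume [1 / 2 ^ k.+1] for all [k] are merged into one summable family; a point of [N]
    lies in a box of each level, hence in infinitely many. Summability, unlike a bound by [e], is
    inherited by slices. *)
Lemma null_infinitely_often (N : set 'rV[R]_d) : lebesgue_null N ->
  exists a b : nat -> 'rV[R]_d, [/\ forall n i, a n 0 i <= b n 0 i,
    (\sum_(n <oo) (volume (a n) (b n))%:E < +oo)%E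
    & forall x, N x -> forall n, exists2 m, (n <= m)%N & box (a m) (b m) x].
Proof.
move=> nN; have /choice[a Ha] k : exists a : nat -> 'rV[R]_d * 'rV[R]_d,
    [/\ forall n i, (a n).1 0 i <= (a n).2 0 i, N `<=` \bigcup_n box (a n).1 (a n).2
    & (\sum_(n <oo) (volume (a n).1 (a n).2)%:E <= (1 / (2 ^ k.+1)%:R)%:E)%E].
  have [|a [b H]] := nN (1 / (2 ^ k.+1)%:R); first by rewrite divr_gt0// ltr0n expn_gt0.
  by exists (fun n => (a n, b n)).
have /card_esym/ppcard_eqP[f] := card_nat2.
pose v (p : nat * nat) := (volume (a p.1 p.2).1 (a p.1 p.2).2)%:E.
have v0 p : (0 <= v p)%E by rewrite lee_fin volume_ge0//; case: (Ha p.1).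
exists (fun n => (a (f n).1 (f n).2).1), (fun n => (a (f n).1 (f n).2).2); split.
- by move=> n i; case: (Ha (f n).1).
- rewrite -[X in (X < _)%E]/(\sum_(n <oo) v (f n))%E nneseries_esumT//.
  rewrite -(@reindex_esum R nat (nat * nat)%type [set: nat] [set: nat * nat] f v); last by split.
  rewrite (_ : [set: nat * nat] = [set: nat] `*`` (fun=> [set: nat])); last by apply/seteqP.
  rewrite -(@esum_esum R nat nat setT (fun=> setT) (fun k n => v (k, n)))//.
  apply: (@le_lt_trans _ _ (\esum_(k in [set: nat]) (1 / (2 ^ k.+1)%:R)%:E)).
    by apply: le_esum => k _; rewrite -nneseries_esumT//; case: (Ha k).
  rewrite -nneseries_esumT; last by move=> k; rewrite lee_fin divr_ge0.
  have := @epsilon_trick R (fun=> 0%E) 1 xpredT (fun=> lexx _) ler01.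
  rewrite [X in (_ <= X + _)%E]eseries0// add0e => H; apply: le_lt_trans (ltry 1); apply: le_trans H.
  by apply: lee_nneseries => k _; rewrite ?add0e// lee_fin divr_ge0.
move=> x Nx n.
have /choice[m Hm] k : exists m, box (a k m).1 (a k m).2 x.
  by have [_ + _] := Ha k; move=> /(_ x Nx)[m _ xm]; exists m.
have [|k nk] := @injective_unbounded (fun k => f^-1%FUN (k, m k)) _ n.
  by move=> k k' /(congr1 f); rewrite !invK ?inE// => -[].
by exists (f^-1%FUN (k, m k)) => //=; rewrite invK ?inE.
Qed.

Definition update x l (t : R) : 'rV[R]_d := \row_k if k == l then t else x 0 k.

Variables a b : nat -> 'rV[R]_d.
Hypothesis ab : forall n i, a n 0 i <= b n 0 i.

(* The volume of the box [n] sliced at the coordinates of [x] in [P]. *)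
Definition slice_weight (P : seq 'I_d) x n : R :=
  \prod_l (if l \in P then (a n 0 l <= x 0 l <= b n 0 l)%R%:R else b n 0 l - a n 0 l).

Lemma slice_weight_ge0 P x n : 0 <= slice_weight P x n.
Proof. by apply: prodr_ge0 => l _; case: ifP => _; rewrite ?subr_ge0. Qed.

(** Integrated over the coordinate [l], the sliced series gives at most the old one, which is
    finite. So it cannot diverge throughout an interval of length [2 * e]. *)
Lemma slice_step (P : seq 'I_d) x l (e : R) : 0 < e ->
  (\sum_(n <oo) (slice_weight P x n)%:E < +oo)%E ->
  exists2 y : 'rV[R]_d, (forall k, k \notin l :: P -> y 0 k = x 0 k) /\ (forall k : 'I_d, `|y 0 k - x 0 k| <= e)
    & (\sum_(n <oo) (slice_weight (l :: P) y n)%:E < +oo)%E.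
Proof.
move=> e0 fx; have [lP|lP] := boolP (l \in P).
  exists x; first by split=> // k; rewrite subrr normr0 ltW.
  rewrite (_ : slice_weight (l :: P) x = slice_weight P x)//.
  by apply/funext => n; apply: eq_bigr => k _; rewrite inE; case: eqP => [->|//]; rewrite lP.
pose V n := \prod_(k | k != l) (if k \in P then (a n 0 k <= x 0 k <= b n 0 k)%R%:R else b n 0 k - a n 0 k).
have V0 n : 0 <= V n by apply: prodr_ge0 => k _; case: ifP => _; rewrite ?subr_ge0.
have Wx n : slice_weight P x n = (b n 0 l - a n 0 l) * V n.
  by rewrite /slice_weight (bigD1 l)//= (negbTE lP).
pose J n : set (measurableTypeR R) := `[a n 0 l, b n 0 l]%classic.
have mJ n : measurable (J n) by exact: measurable_itv.
have Wu t n : slice_weight (l :: P) (update x l t) n = V n * \1_(J n) t.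
  rewrite /slice_weight (bigD1 l)//= mem_head mxE eqxx mulrC; congr (_ * _).
    by apply: eq_bigr => k kl; rewrite inE (negbTE kl)/= mxE (negbTE kl).
  by rewrite indicE; congr (nat_of_bool _)%:R; apply/idP/idP; rewrite inE /J/= in_itv.
pose I : set (measurableTypeR R) := `[x 0 l - e, x 0 l + e]%classic.
have mI : measurable I by exact: measurable_itv.
have [t It Ht] : exists2 t, I t & (\sum_(n <oo) (V n * \1_(J n) t)%:E < +oo)%E.
  apply: contrapT => H.
  have Hoo t : I t -> (\sum_(n <oo) (V n * \1_(J n) t)%:E = +oo)%E.
    move=> It; apply/eqP; rewrite -leye_eq leNgt; apply/negP => Hlt; apply: H; exists t => //.
  have : (\int[@lebesgue_measure R]_(t in I) \sum_(n <oo) (V n * \1_(J n) t)%:E < +oo)%E.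
    rewrite integral_nneseries//; last 2 first.
    - by move=> n; apply/measurable_EFinP; apply: measurable_funM => //; exact: measurable_indic.
    - by move=> n t _; rewrite lee_fin mulr_ge0.
    apply: le_lt_trans fx; apply: lee_nneseries => [n _ _|n _].
      by apply: integral_ge0 => t _; rewrite lee_fin mulr_ge0.
    under eq_integral do rewrite EFinM.
    rewrite ge0_integralZl_EFin//; last by apply/measurable_EFinP; exact: measurable_indic.
    rewrite integral_indic// Wx mulrC EFinM; apply: lee_wpmul2l; first by rewrite lee_fin.
    apply: (@le_trans _ _ (@lebesgue_measure R (J n))).
      apply: (le_measure (@lebesgue_measure R) (mem_set (measurableI _ _ (mJ n) mI)) (mem_set (mJ n))).
      by move=> ? [].
    rewrite /J lebesgue_measure_itv/= lte_fin; case: ifPn => [_|_]; first by rewrite -EFinB.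
    by rewrite lee_fin subr_ge0.
  rewrite (eq_integral (fun=> +oo%E)); last by move=> t /set_mem It; rewrite Hoo.
  rewrite (integral_cst (@lebesgue_measure R) mI) -[X in (_ * X)%E]/(@lebesgue_measure R I).
  rewrite /I lebesgue_measure_itv/= lte_fin.
  rewrite (_ : x 0 l - e < x 0 l + e); last by lra.
  by rewrite gt0_mulye// -EFinB lte_fin; lra.
exists (update x l t).
  split=> k; first by rewrite inE negb_or mxE => /andP[/negbTE-> _].
  rewrite mxE; case: eqP => [->|_]; last by rewrite subrr normr0 ltW.
  by move: It; rewrite /I/= in_itv/= ler_norml; lra.
by under eq_eseriesr do rewrite Wu.
Qed.

Lemma slice_seq (P : seq 'I_d) x (e : R) : 0 < e ->
  (\sum_(n <oo) (volume (a n) (b n))%:E < +oo)%E ->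
  exists2 y : 'rV[R]_d, (forall k, k \notin P -> y 0 k = x 0 k) /\ (forall k : 'I_d, `|y 0 k - x 0 k| <= e)
    & (\sum_(n <oo) (slice_weight P y n)%:E < +oo)%E.
Proof.
move=> e0 fv; elim: P e e0 => [|l P IH] e e0.
  exists x => //; first by split=> // k; rewrite subrr normr0 ltW.
have e2 : 0 < e / 2 by rewrite divr_gt0.
have [y [yx ye] fy] := IH _ e2; have [z [zy ze] fz] := @slice_step P y l _ e2 fy.
exists z => //; split => k.
  by move=> kP; rewrite zy// yx//; move: kP; rewrite inE negb_or => /andP[].
have -> : z 0 k - x 0 k = (z 0 k - y 0 k) + (y 0 k - x 0 k) by ring.
by rewrite (le_trans (ler_normD _ _))// [leRHS]splitr lerD.
Qed.

(** Borel-Cantelli on the line: with the other coordinates fixed, a slice weight is the length of an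
    interval or [0], and these are summable. *)
Lemma null_slice i x : (\sum_(n <oo) (slice_weight [seq l <- enum 'I_d | l != i] x n)%:E < +oo)%E ->
  exists2 N : set (measurableTypeR R), measurable N /\ (@lebesgue_measure R N = 0)%E
  & forall t, (forall n, exists2 m, (n <= m)%N & box (a m) (b m) (x + t *: axis R i)) -> N t.
Proof.
set P := [seq l <- enum 'I_d | l != i]; move=> fx.
have inP k : (k \in P) = (k != i) by rewrite mem_filter mem_enum andbT.
pose J n : set (measurableTypeR R) :=
  if [forall k, (k != i) ==> (a n 0 k <= x 0 k <= b n 0 k)%R]
  then `[a n 0 i - x 0 i, b n 0 i - x 0 i]%classic else set0.
have mJ n : measurable (J n) by rewrite /J; case: ifP => _ //; exact: measurable_itv.
exists (lim_sup_set J).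
  split; first by apply: bigcapT_measurable => n; apply: bigcup_measurable => k _.
  apply: lim_sup_set_cvg0 => //; apply: le_lt_trans fx; apply: lee_nneseries => // n _.
  rewrite /J; case: ifPn => [H|_]; last by rewrite measure0 lee_fin slice_weight_ge0.
  rewrite /slice_weight (bigD1 i)//= inP eqxx/= big1 ?mulr1; last first.
    by move=> k ki; rewrite inP ki; move/forallP: H => /(_ k); rewrite ki => /= ->.
  rewrite lebesgue_measure_itv/= lte_fin; case: ifPn => [_|_]; last by rewrite lee_fin subr_ge0.
  by rewrite -EFinB lee_fin opprB addrA subrK.
move=> t Ht n _; have [m nm xm] := Ht n; exists m => //.
have H : [forall k, (k != i) ==> (a m 0 k <= x 0 k <= b m 0 k)%R].
  apply/forallP => k; apply/implyP => ki; have := xm k; rewrite !mxE eqxx (negbTE ki)/=.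
  by rewrite mulr0 addr0.
rewrite /J H /= in_itv/=; have := xm i; rewrite !mxE !eqxx/= mulr1; lra.
Qed.

End Slices.

(** * Constancy on a cube *)

Section FlatCube.
Variables (R : realType) (d : nat).
Variables (f : 'rV[R]_d -> R) (L : R).
Hypotheses (L0 : 0 <= L) (fL : row_lipschitz f L).
Implicit Types (x y p : 'rV[R]_d) (i l : 'I_d).

Lemma gradient0_near p i (e : R) : differentiable (f : 'rV[R]_d -> R^o) p -> gradient f p = 0 -> 0 < e ->
  \forall s \near (0 : R), `|f (p + s *: axis R i) - f p| <= e * `|s|.
Proof.
move=> df gf e0.
have D0 : 'D_(delta_mx 0 i) (f : 'rV[R]_d -> R^o) p = 0.
  by have := congr1 (fun z : 'rV[R]_d => z 0 i) gf; rewrite !mxE.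
have : h^-1 *: ((f : 'rV[R]_d -> R^o) (h *: delta_mx 0 i + p) - f p) @[h --> 0^'] --> (0 : R^o).
  by rewrite -[X in _ --> X]D0; exact: (@diff_derivable _ _ _ _ p (delta_mx 0 i) df).
move=> /cvgrPdist_le/(_ _ e0)/nbhs_ballP[r /= r0 Hr].
apply/nbhs_ballP; exists r => //= s sr.
have [->|s0] := eqVneq s 0; first by rewrite scale0r addr0 subrr !normr0 mulr0.
have := Hr s sr s0; rewrite sub0r normrN => H.
by rewrite (addrC p) -[X in `|X|](mulVKf s0) normrM mulrC ler_wpM2r.
Qed.

Variables (S : set 'rV[R]_d) (s0 : 'rV[R]_d) (r : R).
Hypotheses (r0 : 0 < r) (QS : forall y, (forall l, `|y 0 l - s0 0 l| <= 2 * r) -> S y).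
Hypothesis hgrad : almost_everywhere_on S (fun x => differentiable (f : 'rV[R]_d -> R^o) x /\ gradient f x = 0).

(** The segment itself may lie in the exceptional set. It is moved by at most [c'] to a parallel one
    which meets that set in a null set; there [flat_line] applies, and the Lipschitz bound leads
    back. *)
Lemma flat_axis i x y : (forall l, `|x 0 l - s0 0 l| <= r) -> (forall l, `|y 0 l - s0 0 l| <= r) ->
  (forall l, l != i -> x 0 l = y 0 l) -> f x = f y.
Proof.
wlog xy : x y / x 0 i <= y 0 i.
  move=> H hx hy e; have [xy|/ltW xy] := leP (x 0 i) (y 0 i); first exact: H.
  by apply/esym/H => // l li; rewrite e.
move=> hx hy e; apply/eqP; rewrite -subr_eq0 -normr_le0; apply/ler_addgt0Pr => c c0; rewrite add0r.
have L1 : 0 < 2 * L + 1 by rewrite ltr_wpDl// mulr_ge0.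
(* The bound [r] keeps the moved segment within the larger cube contained in [S]; the other makes
   the two errors [L * c'] add up to at most [c]. *)
pose c' := Num.min r (c / (2 * L + 1)).
have c'0 : 0 < c' by rewrite lt_min r0 divr_gt0.
have [a [b [ab sv io]]] := null_infinitely_often hgrad.
have [z [zx ze] fz] := @slice_seq R d a b ab [seq l <- enum 'I_d | l != i] x c' c'0 sv.
have zi : z 0 i = x 0 i by apply: zx; rewrite mem_filter eqxx.
have [N [mN N0] HN] := null_slice ab fz.
pose t := y 0 i - x 0 i; have t0 : 0 <= t by rewrite subr_ge0.
have flat : f (z + 0 *: axis R i) = f (z + t *: axis R i).
  apply: (@flat_line R (fun u => f (z + u *: axis R i)) L 0 t N t0 L0 _ mN N0).
    move=> u v; apply: fL => l; rewrite !mxE eqxx/=.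
    rewrite opprD addrACA subrr add0r -mulrBl normrM; case: (l == i).
      by rewrite normr1 mulr1.
    by rewrite normr0 mulr0.
  move=> u /andP[u0 ut] Nu e1 e10.
  have Su : S (z + u *: axis R i).
    apply: QS => l; rewrite !mxE eqxx/=; have [->|li] := eqVneq l i.
      by rewrite mulr1 zi; have := hx i; have := hy i; move: ut; rewrite /t !ler_norml; lra.
    rewrite mulr0 addr0; have := ze l; have := hx l.
    have : c' <= r by rewrite ge_min lexx.
    by rewrite !ler_norml; lra.
  have [df gf] : differentiable (f : 'rV[R]_d -> R^o) (z + u *: axis R i) /\ gradient f (z + u *: axis R i) = 0.
    by apply: contrapT => H; apply: Nu; apply: HN; apply: io.
  have := gradient0_near i df gf e10; apply: filterS => s.
  by rewrite scalerDl addrA.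
have d1 : `|f x - f (z + 0 *: axis R i)| <= L * c'.
  by apply: fL => l; rewrite scale0r addr0 distrC.
have d2 : `|f (z + t *: axis R i) - f y| <= L * c'.
  apply: fL => l; rewrite !mxE eqxx/=; have [->|li] := eqVneq l i.
    by rewrite mulr1 zi /t addrC subrK subrr normr0 ltW.
  by rewrite mulr0 addr0 -(e l li).
have -> : f x - f y = (f x - f (z + 0 *: axis R i)) + (f (z + t *: axis R i) - f y) by rewrite flat; ring.
apply: (le_trans (ler_normD _ _)); apply: (le_trans (lerD d1 d2)).
have : c' * (2 * L + 1) <= c by rewrite -ler_pdivlMr// ge_min lexx orbT.
by lra.
Qed.

Lemma flat_cube y : (forall l, `|y 0 l - s0 0 l| <= r) -> f y = f s0.
Proof.
move=> hy; pose z (P : seq 'I_d) : 'rV[R]_d := \row_l if l \in P then y 0 l else s0 0 l.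
have hz P l : `|z P 0 l - s0 0 l| <= r.
  by rewrite mxE; case: ifP => _ //; rewrite subrr normr0 ltW.
have H P : f (z P) = f s0.
  elim: P => [|i P IH]; first by congr f; apply/rowP => l; rewrite mxE.
  rewrite -IH; apply: (@flat_axis i) => // l li.
  by rewrite !mxE inE (negbTE li).
by rewrite -(H (enum 'I_d)); congr f; apply/rowP => l; rewrite mxE mem_enum.
Qed.

End FlatCube.

(** * Eigenvalues of infinite multiplicity *)

Section DecayingRecurrence.
Variable R : realType.
Local Notation Re := complex.Re.
Local Notation Im := complex.Im.
Implicit Types (z : R[i]) (w v : int -> R[i]) (m : int) (q : {poly R[i]}).

Definition sqmod z : R := Re z ^+ 2 + Im z ^+ 2.

Lemma sqmod_ge0 z : 0 <= sqmod z.
Proof. by rewrite addr_ge0// sqr_ge0. Qed.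

Lemma sqmodM z z' : sqmod (z * z') = sqmod z * sqmod z'.
Proof. by rewrite /sqmod complexReM complexImM; ring. Qed.

Lemma sqmodB z z' : sqmod (z - z') <= 2 * sqmod z + 2 * sqmod z'.
Proof.
case: z z' => [a b] [c e]; rewrite /sqmod/=.
have := sqr_ge0 (a + c); have := sqr_ge0 (b + e); lra.
Qed.

Lemma sqmod_eq0 z : sqmod z <= 0 -> z = 0.
Proof.
move=> z0; have r0 := sqr_ge0 (Re z); have i0 := sqr_ge0 (Im z); rewrite /sqmod in z0.
by apply: complex_eq => /=; apply/eqP; rewrite -sqrf_eq0 eq_le; apply/andP; split => //; lra.
Qed.

(** Decay at both ends; decay at one end only would admit geometric sequences. *)
Definition decaying w := forall e : R, 0 < e -> exists n : nat, forall m, (n <= `|m|)%N -> sqmod (w m) <= e.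

Definition shift_sub z w : int -> R[i] := fun m => w (m + 1) - z * w m.

Lemma decaying_shift_sub z w : decaying w -> decaying (shift_sub z w).
Proof.
move=> dw e e0; have k0 : 0 < 2 + 2 * sqmod z by have := sqmod_ge0 z; lra.
have [n Hn] := dw _ (divr_gt0 e0 k0); exists n.+1 => m nm.
apply: (le_trans (sqmodB _ _)); rewrite sqmodM.
have h1 : sqmod (w (m + 1)) <= e / (2 + 2 * sqmod z) by apply: Hn; lia.
have h2 : sqmod (w m) <= e / (2 + 2 * sqmod z) by apply: Hn; lia.
have := ler_wpM2l (sqmod_ge0 z) h2.
have : e / (2 + 2 * sqmod z) * (2 + 2 * sqmod z) = e by rewrite divfK ?gt_eqF.
by move: h1; move: (e / _) => c; lra.
Qed.

(** The moduli form a geometric sequence, which does not decrease in one of the two directions: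
    backwards if [|z| <= 1], forwards otherwise. *)
Lemma decaying_geometric z w : decaying w -> (forall m, shift_sub z w m = 0) -> forall m, w m = 0.
Proof.
move=> dw Hw m; apply: sqmod_eq0; apply/ler_addgt0Pr => e e0; rewrite add0r.
have step k : sqmod (w (k + 1)) = sqmod z * sqmod (w k).
  by rewrite -sqmodM; congr sqmod; apply/eqP; rewrite -subr_eq0; apply/eqP; exact: Hw.
have [n Hn] := dw e e0; have [z1|/ltW z1] := leP (sqmod z) 1.
  have H (k : nat) : sqmod (w m) <= sqmod (w (m - k%:Z)).
    elim: k => [|k IH]; first by rewrite subr0.
    apply: (le_trans IH); have -> : m - k%:Z = (m - k.+1%:Z) + 1 by lia.
    by rewrite step ler_piMl// sqmod_ge0.
  by apply: (le_trans (H (n + `|m|)%N)); apply: Hn; lia.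
have H (k : nat) : sqmod (w m) <= sqmod (w (m + k%:Z)).
  elim: k => [|k IH]; first by rewrite addr0.
  apply: (le_trans IH); have -> : m + k.+1%:Z = (m + k%:Z) + 1 by lia.
  by rewrite step ler_peMl// sqmod_ge0.
by apply: (le_trans (H (n + `|m|)%N)); apply: Hn; lia.
Qed.

(** The sequence [q(S) w], with [S] the shift by one. *)
Definition poly_shift q w m : R[i] := \sum_(i < size q) q`_i * w (m + i%:Z).

Lemma poly_shiftE N q w m : (size q <= N)%N -> poly_shift q w m = \sum_(i < N) q`_i * w (m + i%:Z).
Proof.
move=> qN; rewrite /poly_shift (big_ord_widen N (fun i => q`_i * w (m + i%:Z)))// big_mkcond/=.
apply: eq_bigr => i _; case: ltnP => // qi; by rewrite nth_default// mul0r.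
Qed.

Lemma poly_shift_XsubC z q w m :
  poly_shift (('X - z%:P) * q) w m = shift_sub z (poly_shift q w) m.
Proof.
rewrite (@poly_shiftE (size q).+1); last first.
  by rewrite (leq_trans (size_polyMleq _ _))// size_XsubC.
rewrite /shift_sub (@poly_shiftE (size q).+1 q w m)// [in RHS]/poly_shift.
under eq_bigr do rewrite mulrBl coefB coefXM coefCM mulrBl.
rewrite sumrB; congr (_ - _); last by rewrite mulr_sumr; apply: eq_bigr => i _; rewrite mulrA.
rewrite big_ord_recl/= mul0r add0r; apply: eq_bigr => i _ /=.
by rewrite add0n /fintype.bump leq0n add1n; congr (_ * w _); lia.
Qed.

(** Over the complex numbers [q] splits into linear factors. Each [S - z] preserves decay and is
    injective on decaying sequences, so the factors are removed one by one. *)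
Lemma decaying_poly_shift q w : q != 0 -> decaying w -> (forall m, poly_shift q w m = 0) ->
  forall m, w m = 0.
Proof.
move=> q0 dw Hq; have [r Er] := closed_field_poly_normal q.
have lz : lead_coef q != 0 by rewrite lead_coef_eq0.
have {}Hq m : poly_shift (\prod_(z <- r) ('X - z%:P)) w m = 0.
  have sP : (size (\prod_(z <- r) ('X - z%:P))%R <= size q)%N by rewrite [in leqRHS]Er size_scale.
  have cP i : q`_i = lead_coef q * (\prod_(z <- r) ('X - z%:P))`_i by rewrite {1}Er coefZ.
  apply: (mulfI lz); rewrite mulr0 -[RHS](Hq m) (poly_shiftE _ _ sP) mulr_sumr.
  by apply: eq_bigr => i _; rewrite cP mulrA.
have P1 v m : poly_shift 1 v m = v m.
  by rewrite /poly_shift size_poly1 big_ord1 coef1 mul1r addr0.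
have Pd s v : decaying v -> decaying (poly_shift (\prod_(z <- s) ('X - z%:P)) v).
  elim: s v => [|z s IH] v dv.
    by rewrite big_nil (_ : poly_shift 1 v = v)//; apply/funext => m.
  rewrite big_cons (_ : poly_shift _ v = shift_sub z (poly_shift (\prod_(j <- s) ('X - j%:P)) v)).
    exact/decaying_shift_sub/IH.
  by apply/funext => m; exact: poly_shift_XsubC.
elim: r Hq {Er} => [|z s IH] Hq; first by move=> m; rewrite -(P1 w m) -(Hq m) big_nil.
apply: IH; apply: (@decaying_geometric z) => [|m]; first exact: Pd.
by rewrite -poly_shift_XsubC -(Hq m) big_cons.
Qed.

End DecayingRecurrence.

(** * Independence of the translates of an eigenvector *)

Section Multiplicity.
Variables (R : realType) (d nu : nat) (G : crystal R d nu).
Local Notation T := (vertices G).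
Hypothesis hd : (0 < d)%N.

Definition along (m : int) : 'rV[int]_d := \row_l m.

(** Off a finite set of vertices the squares are small, and a diagonal line of translates leaves
    this set, as one lattice coordinate shows. *)
Lemma along_decaying (x : l2space R T) (v : T) :
  decaying (fun m => (x (vshift (along m) v))%:C).
Proof.
move=> e e0; have g0 t : 0 <= x t ^+ 2 by exact: sqr_ge0.
have [s us Hs] := esumR_tail g0 (l2space_sq x) e0.
have small t : t \notin s -> x t ^+ 2 <= e.
  move=> ts; pose h u := if u \in [:: t] then x t ^+ 2 else 0.
  have [_ Eh] := @rsum_seq R T [:: t] (fun=> x t ^+ 2) isT.
  rewrite big_seq1 in Eh; rewrite -[leLHS](ger0_norm (g0 t)) -Eh; apply: Hs => u.
    by case: ifPn => [|_]; rewrite ?normr0// mem_seq1 => /eqP->; rewrite ger0_norm.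
  by move=> us'; rewrite mem_seq1; case: eqP => // ut; move: ts; rewrite -ut us'.
pose l0 := Ordinal hd; pose f (t : T) : nat := `|((vcoord t).2 - (vcoord v).2)%R 0%R l0|%N.
exists (\max_(t <- s) f t).+1 => m nm; rewrite /sqmod/= expr0n addr0; apply: small.
apply/negP => ms; move: nm; rewrite ltnNge => /negP; apply.
have -> : `|m|%N = f (vshift (along m) v).
  by rewrite /f /vshift vertexK/= addrAC subrr add0r mxE.
by rewrite (big_rem _ ms)/= leq_maxl.
Qed.

(** Translates of an eigenvector are eigenvectors. A linear relation among them is a recurrence for
    the values along the diagonal through each vertex, where decay forces these values to vanish. *)
Lemma infinite_multiplicity (x : l2space R T) (r : R) : x <> 0 -> hop2 x = r *: x ->
  eigenvalue_of_infinite_multiplicity (@schrodinger R d nu G) r%:C.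
Proof.
move=> x0 Hx n; pose psi (i : 'I_n) (v : T) : R[i] := (x (vshift (along i%:Z) v))%:C.
exists psi; split.
- by move=> i; exact: (l2_cplx (l2shift (along i%:Z) x) 0).
- move=> i; apply/funext => v; rewrite schrodingerE /psi/=.
  have -> : hop (fun u => x (vshift (along i%:Z) u)) v = r * x (vshift (along i%:Z) v).
    by rewrite (hop_shift (along i%:Z) x v) -[RHS]/((r *: x : l2space R T) (vshift (along i%:Z) v)) -Hx.
  have -> : hop (fun _ : T => 0 : R) v = 0.
    have := hop_lin (-1) (bounded_fun0 G) (bounded_fun0 G); under eq_fun do rewrite mulr0 addr0.
    by move=> /(congr1 (@^~ v)) /= ->; rewrite mulN1r addNr.
  by apply: complex_eq; rewrite ?complexReM ?complexImM/=; ring.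
move=> c Hc; apply: contrapT => cn0.
pose q : {poly R[i]} := \poly_(i < n) (if insub i is Some j then c j else 0).
have qE (i : 'I_n) : q`_i = c i by rewrite coef_poly ltn_ord valK.
have q0 : q != 0.
  apply/negP => /eqP q0; apply: cn0 => i; by rewrite -qE q0 coef0.
apply: x0; apply: l2_ext => v.
have := decaying_poly_shift q0 (along_decaying x v) _ 0.
have e0 : vshift (along 0) v = v.
  by rewrite (_ : along 0 = 0) ?vshift0//; apply/rowP => l; rewrite !mxE.
rewrite e0 => H; have : (x v)%:C = 0 :> R[i].
  apply: H => m; rewrite (@poly_shiftE _ n) ?size_poly//; rewrite -[RHS](Hc (vshift (along m) v)).
  apply: eq_bigr => i _; rewrite qE; congr (_ * _); rewrite /psi vshiftD.
  by congr (_%:C); congr (x (vshift _ v)); apply/rowP => l; rewrite !mxE.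
by move=> /(congr1 (@complex.Re R)).
Qed.

End Multiplicity.

(** * A flat cube produces an atom *)

Section FlatBand.
Variables (R : realType) (d nu : nat) (G : crystal R d nu).
Hypothesis nu0 : (0 < nu)%N.
Variable E : 'I_nu -> 'rV[R]_d -> R.
Hypothesis hE : floquet_eigenvalues G E.
Local Notation sE := (@scaled_eigenvalue R d nu G E).
Local Notation M := (hscale G).

Lemma count_initial (u : R) n : u <= n%:R -> u <= \sum_(k < n) (k%:R <= u)%R%:R.
Proof.
(* Carried by induction: the count has reached [u], or every [k] so far has been counted. *)
move=> un; suff [//|H] : u <= \sum_(k < n) (k%:R <= u)%R%:R \/ n%:R <= \sum_(k < n) (k%:R <= u)%R%:R :> R.
  exact: le_trans H.
elim: n {un} => [|n IH]; first by right; rewrite big_ord0.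
have e1 : n.+1%:R = n%:R + 1 :> R by rewrite natr1.
rewrite big_ord_recr/= e1; have [nu_|un] := boolP (n%:R <= u).
  by rewrite (_ : true%:R = 1 :> R)//; case: IH => H; [left|right]; lra.
rewrite addr0; left; case: IH => // H; apply: le_trans H.
by rewrite ltW// ltNge.
Qed.

Variables (j : 'I_nu) (s0 : 'rV[R]_d) (r : R).
Hypothesis r0 : 0 < r.
Hypothesis flat : forall y : 'rV[R]_d, (forall l : 'I_d, `|y 0 l - s0 0 l| <= r) -> E j y = E j s0.

(** On the unit interval the polynomials [p k] decrease to the indicator of the flat value [la].
    Their grid averages are at least the proportion of grid points in the cube, so this lower bound
    passes first to the density of [p k] and then to that of the point. *)
Lemma flat_band_density : exists2 k : R, 0 < k & k <= state_density G \1_[set sE j s0].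
Proof.
(* With [2 * r' <= 1] the cube fits into one period of the grid started at its corner [theta0]. *)
pose r' := Num.min r 2^-1; set la := sE j s0.
have r'0 : 0 < r' by rewrite lt_min r0/= invr_gt0.
have r'r : r' <= r by rewrite ge_min lexx.
have r'2 : r' <= 2^-1 by rewrite ge_min lexx orbT.
pose theta0 : 'rV[R]_d := \row_l (s0 0 l - r').
exists ((2 * r') ^+ d); first by rewrite exprn_gt0// mulr_gt0.
pose p k x : R := (1 - (x - la) ^+ 2) ^+ k.
have la01 : 0 <= la <= 1 by exact: (sE_itv hE).
have b01 x : 0 <= x <= 1 -> 0 <= 1 - (x - la) ^+ 2 <= 1.
  move=> /andP[x0 x1]; move/andP: la01 => [l0 l1]; have := sqr_ge0 (x - la).
  have h1 : 0 <= 1 - (x - la) by lra.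
  have h2 : 0 <= 1 + (x - la) by lra.
  by have := mulr_ge0 h1 h2; lra.
have p01 k x : 0 <= x <= 1 -> 0 <= p k x <= 1.
  by move=> /b01/andP[b0 b1]; rewrite exprn_ge0//= exprn_ile1.
have pE k : p k = horner ((1 - ('X - la%:P) ^+ 2) ^+ k).
  by apply/funext => x; rewrite !hornerE.
have bp k : bounded_measurable (p k) by rewrite pE; exact: bounded_measurable_horner.
have lower k N : (2 * r') ^+ d <= grid_avg G E theta0 (p k) N.
  have NN : 0 < N.+1%:R :> R by rewrite ltr0n.
  rewrite /grid_avg [leRHS]mulrC ler_pdivlMr ?ltr0n ?expn_gt0//.
  pose c (l : 'I_d) (m : 'I_N.+1) : R := (m%:R <= 2 * r' * N.+1%:R)%R%:R.
  apply: (@le_trans _ _ (\sum_(n : {ffun 'I_d -> 'I_N.+1}) \prod_l c l (n l))).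
    rewrite -(bigA_distr_bigA c) natrX -exprMn -[X in _ ^+ X]card_ord -prodr_const.
    apply: ler_prod => l _; rewrite mulr_ge0 ?(ltW NN) ?mulr_ge0 ?(ltW r'0)//=.
    apply: count_initial; rewrite -[leRHS]mul1r ler_pM2r//; lra.
  apply: ler_sum => n _; rewrite (bigD1 j)//=.
  have P0 i : 0 <= p k (sE i (gridpt theta0 n)) by case/andP: (p01 k _ (sE_itv hE i (gridpt theta0 n))).
  have S0 : 0 <= \sum_(i < nu | i != j) p k (sE i (gridpt theta0 n)) by exact: sumr_ge0.
  have [H|] := boolP [forall l, ((n l)%:R <= 2 * r' * N.+1%:R)%R]; last first.
    rewrite negb_forall => /existsP[l Hl]; rewrite (bigD1 l)//= /c (negbTE Hl) mul0r.
    exact: addr_ge0.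
  rewrite big1; last by move=> l _; rewrite /c (forallP H l).
  rewrite -[leLHS]addr0 lerD// /p.
  have -> : sE j (gridpt theta0 n) = la.
    rewrite /la /scaled_eigenvalue flat// => l; rewrite !mxE.
    have := forallP H l; rewrite -ler_pdivrMr// => h.
    have : 0 <= (n l)%:R / N.+1%:R :> R by rewrite divr_ge0// ltW.
    by move: h; move: (_ / _) => q; rewrite ler_norml; lra.
  by rewrite subrr expr0n subr0 expr1n.
have density k : (2 * r') ^+ d <= state_density G (p k).
  have C := @grid_avg_poly R d nu G nu0 E hE theta0 ((1 - ('X - la%:P) ^+ 2) ^+ k).
  rewrite -pE in C; rewrite -(cvg_lim (@norm_hausdorff _ R^o) C).
  apply: limr_ge; first by apply/cvg_ex; eexists; exact: C.
  by near=> N.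
have limit : (fun k => state_density G (p k)) @ \oo --> state_density G \1_[set la].
  apply: cvg_fsum => i; apply: (integral01_cvg (smu_fin _) (C := 1)).
  - by move=> k; case: (bp k).
  - by move=> k x /(p01 k)/andP[q0 q1]; rewrite ger0_norm.
  - move=> x x01; rewrite indicE; have [/set_mem ->|] := boolP (x \in [set la]).
      by apply: cvg_near_cst; near=> k; rewrite /p subrr expr0n subr0 expr1n.
    rewrite notin_setE/= => /eqP xla.
    apply: cvg_expr; have /andP[q0 q1] := b01 x x01; rewrite ger0_norm//.
    by rewrite ltrBlDr ltrDl lt_def sqrf_eq0 subr_eq0 xla sqr_ge0.
  - by apply: bounded_measurable_indic; exact: measurable_set1.
rewrite -(cvg_lim (@norm_hausdorff _ R^o) limit).
apply: limr_ge; first by apply/cvg_ex; eexists; exact: limit.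
by near=> k.
Unshelve. all: by end_near. Qed.

(** Some cell state has positive mass at the atom; its projection is then nonzero and an eigenvector
    of the scaled operator, and undoing the scaling recovers [E j s0]. *)
Lemma flat_band_eigenvector :
  exists2 x : l2space R (vertices G), x <> 0 & hop2 x = E j s0 *: x.
Proof.
have [k k0 kd] := flat_band_density; set la := sE j s0 in kd.
have mla : measurable ([set la] : set (measurableTypeR R)) by exact: measurable_set1.
have [i Hi] : exists i, integral01 (smu (cell_state G i)) \1_[set la] != 0.
  apply: contrapT => H; move: (lt_le_trans k0 kd); rewrite /state_density big1 ?ltxx// => i _.
  by apply/eqP; apply: contrapT => /negP Hi; apply: H; exists i.
exists (sproj [set la] (cell_state G i)).
  move=> H; move/eqP: Hi; apply; rewrite -(sproj_norm (cell_state G i) mla) H.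
  exact: l2dot0l.
have M0 := hscale_gt0 G.
have := sproj_eigen la (cell_state G i); move: (sproj _ _) => x.
move=> Sx; have M2 : 2 * M != 0 by rewrite gt_eqF// mulr_gt0.
have : (2 * M) *: sop2 x = hop2 x + M *: x.
  by rewrite -[sop2 x]/((2 * M)^-1 *: (hop2 x + M *: x)) scalerA mulfV// scale1r.
rewrite Sx => /eqP; rewrite -subr_eq => /eqP <-; rewrite scalerA -scalerBl; congr (_ *: _).
by rewrite /la /scaled_eigenvalue mulrA mulfV// mul1r addrK.
Qed.

End FlatBand.

Section FlatBandConclusion.
Variables (R : realType) (d nu : nat) (G : crystal R d nu).
Hypotheses (hd : (0 < d)%N) (nu0 : (0 < nu)%N).
Variable E : 'I_nu -> 'rV[R]_d -> R.
Hypothesis hE : floquet_eigenvalues G E.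
Hypothesis hlip : forall j, lipschitz (E j : 'rV[R]_d -> R^o).

Lemma open_row_cube (S : set 'rV[R]_d) (s : 'rV[R]_d) : open S -> S s ->
  exists2 r : R, 0 < r & forall y : 'rV[R]_d, (forall l : 'I_d, `|y 0 l - s 0 l| <= 2 * r) -> S y.
Proof.
move=> oS Ss; have /nbhs_ballP[e /= e0 He] := open_nbhs_nbhs (conj oS Ss).
exists (e / 4); first by rewrite divr_gt0.
move=> y Hy; apply: He; split => // i l; rewrite (ord1 i) /ball/= distrC.
by apply: (le_lt_trans (Hy l)); lra.
Qed.

Lemma flat_band_infinite_multiplicity (j : 'I_nu) (S : set 'rV[R]_d) : open S -> S !=set0 ->
  almost_everywhere_on S (fun theta =>
    differentiable (E j : 'rV[R]_d -> R^o) theta /\ gradient (E j) theta = 0) ->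
  exists lambda : R[i], eigenvalue_of_infinite_multiplicity (@schrodinger R d nu G) lambda.
Proof.
move=> oS [s Ss] hS; have [r r0 Hr] := open_row_cube oS Ss.
have [L L0 HL] := lipschitz_rows hd (hlip j).
have [x x0 Hx] := flat_band_eigenvector nu0 hE r0 (flat_cube L0 HL r0 Hr hS).
by exists (E j s)%:C; exact: (infinite_multiplicity hd x0 Hx).
Qed.

End FlatBandConclusion.

Theorem theorem6p3 (R : realType) (d nu : nat) (hd : (0 < d)%N)
    (hnu : (0 < nu)%N) (G : crystal R d nu) (E : 'I_nu -> 'rV[R]_d -> R)
    (hE : floquet_eigenvalues G E)
    (hlip : forall j, lipschitz (E j : 'rV[R]_d -> R^o)) :
  ((forall j, almost_everywhere_on [set: 'rV[R]_d] (fun theta =>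
      differentiable (E j : 'rV[R]_d -> R^o) theta /\
      gradient (E j) theta <> 0)) ->
    purely_absolutely_continuous (@schrodinger R d nu G)) /\
  (forall (j : 'I_nu) (S : set 'rV[R]_d), open S -> S !=set0 ->
    almost_everywhere_on S (fun theta =>
      differentiable (E j : 'rV[R]_d -> R^o) theta /\
      gradient (E j) theta = 0) ->
    exists lambda : R[i],
      eigenvalue_of_infinite_multiplicity (@schrodinger R d nu G) lambda).
Proof.
split=> [hg|j S oS S0 hS].
  exact: (schrodinger_absolutely_continuous hd hnu hE hlip hg).
exact: (flat_band_infinite_multiplicity hd hnu hE hlip oS S0 hS).
Qed.
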